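(* Let $\Omega\subset\mathbb{R}^n$ be a bounded open set, $T>0$, $\Omega_T:=\Omega\times(0,T)$. Let $G,H:[0,\infty)\to[0,\infty)$ be Young functions with $G,H\in\Delta_2\cap\nabla_2$ and $G\prec H$, and let $a:\Omega_T\to[0,\infty)$ be a continuous function with modulus of continuity $\omega$ (with respect to the parabolic distance). For $w\in L^1(0,T;W^{1,1}(\Omega))$ and an open set $U\subset\Omega_T$ put $$\mathcal{P}(w,U):=\iint_{U}\bigl[G(|Dw(z)|)+a(z)H(|Dw(z)|)\bigr]\,dz .$$ Let $w\in L^1(0,T;W^{1,1}(\Omega))$ be such that $\mathcal{P}(w,\Omega_T)<\infty$ and let $Q\subset\subset\Omega_T$ be any (parabolic) cylinder. Assume that one of the following conditions holds: (i) $$\limsup_{\rho\to0^+}\ \omega(\rho)\,\frac{(H\circ G^{-1})(\rho^{-n-2})}{\rho^{-n-2}}<\infty;$$ (ii) $w\in L^\infty(\Omega_T)$ and $$\limsup_{\rho\to0^+}\ \omega(\rho)\,\frac{H(\rho^{-1})}{G(\rho^{-1})}<\infty;$$ (iii) $w\in L^\infty(0,T;L^s(\Omega))$ for some $s\ge 2$ and $$\limsup_{\rho\to0^+}\ \omega(\rho)\,\frac{H(\rho^{-(n+s)/s})}{G(\rho^{-(n+s)/s})}<\infty.$$ Then there exists a sequence $\{w_m\}_{m=1}^\infty$ in $C^\infty(Q)$ such that $$w_m\to w\ \text{ in }L^1(Q),\qquad Dw_m\to Dw\ \text{ in }L^G(Q;\mathbb{R}^n),\qquad \mathcal{P}(w_m,Q)\to\mathcal{P}(w,Q)$$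 as $m\to\infty$.
   Context: Points of $\Omega_T$ are written $z=(x,t)$ with $x\in\Omega$, $t\in(0,T)$; $Dw$ denotes the (weak) gradient of the real-valued function $w$ with respect to the space variable $x$ only. The same formula defines $\mathcal{P}(v,Q)$ for $v\in C^\infty(Q)$. Young function: an increasing convex function $\Phi:[0,\infty)\to[0,\infty)$ with $\Phi(0)=0$, $\lim_{t\to\infty}\Phi(t)=\infty$, $\lim_{t\to0^+}\Phi(t)/t=0$, $\lim_{t\to\infty}\Phi(t)/t=\infty$. $\Phi\in\Delta_2$: there is a constant $\Delta_2(\Phi)>0$ with $\Phi(2t)\le\Delta_2(\Phi)\Phi(t)$ for all $t\ge0$. $\Phi\in\nabla_2$: there is a constant $\nabla_2(\Phi)>1$ with $\Phi(\nabla_2(\Phi)t)\ge2\nabla_2(\Phi)\Phi(t)$ for all $t\ge0$. $\Phi\in\Delta_2\cap\nabla_2$: both hold. For a Young function $\Phi$, $\Phi^{-1}(t)=\inf\{s\ge0:\Phi(s)\ge t\}$ is its left-inverse. For Young functions $\Phi_1,\Phi_2$, $\Phi_1\prec\Phi_2$ means that $\Phi_2\circ\Phi_1^{-1}$ is a Young function. Modulus of continuity: $\omega:[0,\infty)\to[0,\infty)$ is non-decreasing with $\omega(0)=0$ and $\lim_{\rho\to0^+}\omega(\rho)=0$, and $$|a(x,t)-a(y,s)|\le\omega\bigl(\max\{|x-y|,|t-s|^{1/2}\}\bigr)\quad\text{for all }(x,t),(y,s)\in\Omega_T.$$ A (parabolic) cylinder of radius $R>0$ centred at $z_0=(x_0,t_0)$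 is $Q=Q_R(z_0)=B_R(x_0)\times(t_0-R^2,t_0+R^2)$, where $B_R(x_0)$ is the open ball in $\mathbb{R}^n$. $Q\subset\subset\Omega_T$ means that $\overline{Q}$ is a compact subset of $\Omega_T$. $L^G(Q;\mathbb{R}^n)$ is the Orlicz space of measurable $f:Q\to\mathbb{R}^n$ with $\iint_Q G(|f|/\lambda)\,dz<\infty$ for some $\lambda>0$, with the Luxemburg norm $\|f\|_{L^G(Q)}=\inf\{\lambda>0:\iint_Q G(|f|/\lambda)\,dz\le1\}$; convergence in $L^G$ is convergence in this norm. *)

(* Defs.v *)
From HB Require Import structures.
From mathcomp Require Import all_boot all_order all_algebra.
From mathcomp Require Import all_classical all_reals all_analysis.

Set Implicit Arguments.
Unset Strict Implicit.
Unset Printing Implicit Defensive.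

Import Order.TTheory GRing.Theory Num.Theory.
Import numFieldNormedType.Exports.

Local Open Scope classical_set_scope.
Local Open Scope ring_scope.

(* The sigma-algebra on 'rV[R]_n is the one generated by the coordinates; as
   'rV[R]_n is second countable, it is the Borel sigma-algebra. *)
Section measurable_rV.
Variables (R : realType) (n : nat).

Definition rV_coord (i : 'I_n) (v : 'rV[R]_n) : R := v ord0 i.

Let rV_set0 : g_sigma_preimage rV_coord set0.
Proof. exact: sigma_algebra0. Qed.

Let rV_setC A : g_sigma_preimage rV_coord A -> g_sigma_preimage rV_coord (~` A).
Proof. exact: sigma_algebraC. Qed.

Let rV_bigcup (F : _^nat) : (forall i, g_sigma_preimage rV_coord (F i)) ->
  g_sigma_preimage rV_coord (\bigcup_i (F i)).
Proof. exact: sigma_algebra_bigcup. Qed.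

HB.instance Definition _ := @isMeasurable.Build
  (measure_tuple_display default_measure_display)
  'rV[R]_n (g_sigma_preimage rV_coord) rV_set0 rV_setC rV_bigcup.

Lemma measurable_rV_coord (i : 'I_n) :
  measurable_fun [set: 'rV[R]_n] (@rV_coord i).
Proof.
move=> _ Y mY; rewrite setTI; apply: sub_sigma_algebra => /=.
rewrite -bigcup_seq/=; exists i => /=; first by rewrite mem_index_enum.
by exists Y => //; rewrite setTI.
Qed.

End measurable_rV.

Lemma measurable_fun_rVP (R : realType) d (T : measurableType d) n
    (f : T -> 'rV[R]_n) :
  (forall i, measurable_fun [set: T] (fun x => f x ord0 i)) ->
  measurable_fun [set: T] f.
Proof.
move=> mf.
have : g_sigma_preimage (fun i => @rV_coord R n i \o f) `<=` measurable.
  apply: smallest_sub; first exact: sigma_algebra_measurable.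
  case: n => [|n] in f mf *; first by rewrite big_ord0.
  rewrite -bigcup_mkord_ord; apply: bigcup_sub => i Ii.
  by move=> A [B mB <-]; exact: mf.
rewrite g_sigma_preimage_comp => h _ A mA.
by apply: h; exists A.
Qed.

(* Lebesgue measure on 'rV[R]_n, as an iterated product measure. *)
Section lebesgue_rV.
Variable R : realType.
Local Open Scope ereal_scope.

Definition rV_cons n (p : (measurableTypeR R * 'rV[R]_n)%type) : 'rV[R]_n.+1 :=
  \row_(i < n.+1) if unlift ord0 i is Some j then p.2 ord0 j else p.1.

Definition rV_uncons n (v : 'rV[R]_n.+1) :
    (measurableTypeR R * 'rV[R]_n)%type :=
  (v ord0 ord0, \row_(j < n) v ord0 (lift ord0 j)).

Lemma rV_consK n : cancel (@rV_cons n) (@rV_uncons n).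
Proof.
move=> [x v]; rewrite /rV_uncons /rV_cons mxE unlift_none; congr pair.
by apply/rowP => j; rewrite !mxE liftK.
Qed.

Lemma measurable_rV_cons n : measurable_fun setT (@rV_cons n).
Proof.
apply: measurable_fun_rVP => i; rewrite /rV_cons.
case: (unliftP ord0 i) => [j|] ->.
- under eq_fun do rewrite mxE liftK.
  exact: measurableT_comp (measurable_rV_coord j) measurable_snd.
- under eq_fun do rewrite mxE unlift_none.
  exact: measurable_fst.
Qed.

Lemma measurable_rV_uncons n : measurable_fun setT (@rV_uncons n).
Proof.
apply/measurable_fun_pair; first exact: measurable_rV_coord.
apply: measurable_fun_rVP => j; under eq_fun do rewrite mxE.
exact: measurable_rV_coord.
Qed.

Section step.
Variables (n : nat) (m : {sigma_finite_measure set 'rV[R]_n -> \bar R}).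

Definition lebesgue_rV_step : set 'rV[R]_n.+1 -> \bar R :=
  pushforward (lebesgue_measure \x m) (@rV_cons n).

Let step0 : lebesgue_rV_step set0 = 0.
Proof. by rewrite /lebesgue_rV_step /pushforward preimage_set0 measure0. Qed.

Let step_ge0 A : 0 <= lebesgue_rV_step A.
Proof. by rewrite /lebesgue_rV_step /pushforward; exact: measure_ge0. Qed.

Let step_sigma_additive : semi_sigma_additive lebesgue_rV_step.
Proof.
move=> F mF tF mUF; rewrite /lebesgue_rV_step /pushforward preimage_bigcup.
apply: measure_semi_sigma_additive.
- by move=> k; rewrite -[X in measurable X]setTI; exact: measurable_rV_cons.
- apply/trivIsetP => /= i j _ _ ij; rewrite -preimage_setI.
  by move/trivIsetP : tF => /(_ _ _ _ _ ij) ->//; rewrite preimage_set0.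
- by rewrite -preimage_bigcup -[X in measurable X]setTI;
     exact: measurable_rV_cons.
Qed.

HB.instance Definition _ := isMeasure.Build _ _ _ lebesgue_rV_step
  step0 step_ge0 step_sigma_additive.

Let step_sigma_finite : sigma_finite setT lebesgue_rV_step.
Proof.
have /sigma_finiteP[F [TF ndF Foo]] :=
  @sigma_finiteT _ _ _ (@lebesgue_measure R).
have /sigma_finiteP[G [TG ndG Goo]] := sigma_finiteT m.
exists (fun k => @rV_uncons n @^-1` (F k `*` G k)).
  rewrite -preimage_bigcup [X in _ @^-1` X](_ : _ = setT) ?preimage_setT//.
  apply/seteqP; split => // -[x y] _.
  have [k _ Fkx] : (\bigcup_k F k) x by rewrite -TF.
  have [l _ Gly] : (\bigcup_k G k) y by rewrite -TG.
  exists (maxn k l) => //; split => /=.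
  - by move: x Fkx; exact/subsetPset/ndF/leq_maxl.
  - by move: y Gly; exact/subsetPset/ndG/leq_maxr.
move=> k; have [mF Fk] := Foo k; have [mG Gk] := Goo k; split.
  rewrite -[X in measurable X]setTI.
  by apply: measurable_rV_uncons => //; exact: measurableX.
rewrite /lebesgue_rV_step /pushforward -comp_preimage.
rewrite (_ : _ \o _ = id) ?preimage_id; last first.
  by apply/funext => p; exact: rV_consK.
by rewrite product_measure1E// lte_mul_pinfty// ge0_fin_numE.
Qed.

HB.instance Definition _ := Measure_isSigmaFinite.Build _ _ _ lebesgue_rV_step
  step_sigma_finite.

End step.

Fixpoint lebesgue_rV n : {sigma_finite_measure set 'rV[R]_n -> \bar R} :=
  match n with
  | 0 => \d_(0%R : 'rV[R]_0)
  | k.+1 => lebesgue_rV_step (lebesgue_rV k)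
  end.

Lemma lebesgue_rV_box n (A : 'I_n -> set R) :
  (forall i, measurable (A i)) ->
  lebesgue_rV n [set v | forall i, A i (v ord0 i)] =
  \prod_(i < n) lebesgue_measure (A i).
Proof.
elim: n A => [|n ih] A mA.
  by rewrite big_ord0 /= diracE mem_set// => -[].
pose B := [set v : 'rV[R]_n | forall i, A (lift ord0 i) (v ord0 i)].
have mB : measurable B.
  rewrite (_ : B =
      \bigcap_(i in [set: 'I_n]) (@rV_coord R n i @^-1` A (lift ord0 i))).
    apply: fin_bigcap_measurable => // i _; rewrite -[X in measurable X]setTI.
    exact: measurable_rV_coord.
  by apply/seteqP; split => v /= h i; [move=> _; exact: h|exact: (h i I)].
rewrite big_ord_recl /= -(ih (fun i => A (lift ord0 i)))// -/B.
rewrite -product_measure1E//; last exact: mA.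
rewrite /lebesgue_rV_step /pushforward.
congr (_ _); apply/seteqP; split => -[x v] /=.
- move=> h; split; first by have := h ord0; rewrite mxE unlift_none.
  by move=> i; have := h (lift ord0 i); rewrite mxE liftK.
- case=> hx hv i; rewrite mxE.
  by case: (unliftP ord0 i) => [j|] -> //; exact: hv.
Qed.

End lebesgue_rV.

Section euclidean_and_smooth.
Variable R : realType.

(* `|x| on 'rV[R]_n is the maximum norm, hence a separate Euclidean norm. *)
Definition enorm n (x : 'rV[R]_n) : R := Num.sqrt (\sum_i (x ord0 i) ^+ 2).

(* [U] is meant to be open, and [f] is a function on [U]: its values elsewhere
   are irrelevant. *)
Fixpoint Ck (V : normedModType R) (k : nat) (U : set V) (f : V -> R) : Prop :=
  match k with
  | 0 => forall x, U x -> {for x, continuous f}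
  | k'.+1 => (forall x, U x -> differentiable f x) /\
             forall v, Ck k' U ('D_v f)
  end.

Definition smooth_on (V : normedModType R) (U : set V) (f : V -> R) : Prop :=
  forall k, Ck k U f.

Definition test_function n (U : set 'rV[R]_n) (phi : 'rV[R]_n -> R) : Prop :=
  let K := closure [set x | phi x != 0] in
  [/\ smooth_on setT phi, compact K & K `<=` U].

Definition grad_x n (f : 'rV[R]_n * R -> R) (z : 'rV[R]_n * R) : 'rV[R]_n :=
  \row_i 'D_(delta_mx ord0 i, 0) f z.

End euclidean_and_smooth.

Section space_time.
Variables (R : realType) (n : nat).

Definition lebesgue_xt :
    set ('rV[R]_n * measurableTypeR R)%type -> \bar R :=
  (lebesgue_rV R n \x @lebesgue_measure R)%E.

HB.instance Definition _ := Measure.on lebesgue_xt.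

Definition parabolic_domain (Om : set 'rV[R]_n) (T : R) :
    set ('rV[R]_n * R) := Om `*` `]0, T[%classic.

Definition cylinder (z0 : 'rV[R]_n * R) (r : R) : set ('rV[R]_n * R) :=
  [set x | enorm (x - z0.1) < r] `*` `]z0.2 - r ^+ 2, z0.2 + r ^+ 2[%classic.

Definition compactly_contained (Q U : set ('rV[R]_n * R)) : Prop :=
  compact (closure Q) /\ closure Q `<=` U.

Definition modulus_of_continuity (om : R -> R) (U : set ('rV[R]_n * R))
    (a : 'rV[R]_n * R -> R) : Prop :=
  [/\ forall r, 0 <= r -> 0 <= om r,
      {in `[0, +oo[ &, {homo om : r s / r <= s}},
      om 0 = 0, om r @[r --> 0^'+] --> (0 : R) &
      forall z z', U z -> U z' ->
        `|a z - a z'| <=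
          om (Num.max (enorm (z.1 - z'.1)) (Num.sqrt `|z.2 - z'.2|))].

End space_time.
Arguments lebesgue_xt : clear implicits.

Section young.
Variable R : realType.

Definition young (Phi : R -> R) : Prop :=
  [/\ forall t, 0 <= t -> 0 <= Phi t,
      {in `[0, +oo[ &, {homo Phi : s t / s <= t}},
      convex_function (`[0, +oo[%classic : set R) Phi &
      [/\ Phi 0 = 0, Phi t @[t --> +oo] --> +oo,
          Phi t / t @[t --> 0^'+] --> (0 : R) &
          Phi t / t @[t --> +oo] --> +oo]].

Definition Delta2 (Phi : R -> R) : Prop :=
  exists2 K : R, 0 < K & forall t, 0 <= t -> Phi (2 * t) <= K * Phi t.

Definition nabla2 (Phi : R -> R) : Prop :=
  exists2 K : R, 1 < K & forall t, 0 <= t -> 2 * K * Phi t <= Phi (K * t).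

Definition young_linv (Phi : R -> R) (t : R) : R :=
  inf [set s | 0 <= s /\ t <= Phi s].

Definition young_prec (Phi1 Phi2 : R -> R) : Prop :=
  young (Phi2 \o young_linv Phi1).

Definition limsup0 (f : R -> R) : \bar R := limf_esup (EFin \o f) 0^'+.

End young.

Section function_spaces.
Variables (R : realType) (n : nat).
Local Open Scope ereal_scope.

(* u belongs to W^{1,1}(Om) and g is (a representative of) its weak gradient. *)
Definition sobolev11 (Om : set 'rV[R]_n) (u : 'rV[R]_n -> R)
    (g : 'rV[R]_n -> 'rV[R]_n) : Prop :=
  [/\ (lebesgue_rV R n).-integrable Om (EFin \o u),
      forall i, (lebesgue_rV R n).-integrable Om (fun x => (g x ord0 i)%:E) &
      forall phi i, test_function Om phi ->
        \int[lebesgue_rV R n]_(x in Om) (u x * 'D_(delta_mx ord0 i) phi x)%:E =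
        - \int[lebesgue_rV R n]_(x in Om) (g x ord0 i * phi x)%:E].

Definition sobolev11_norm (Om : set 'rV[R]_n) (u : 'rV[R]_n -> R)
    (g : 'rV[R]_n -> 'rV[R]_n) : \bar R :=
  \int[lebesgue_rV R n]_(x in Om) `|u x|%:E +
  \int[lebesgue_rV R n]_(x in Om) (enorm (g x))%:E.

(* w belongs to L^1(0, T; W^{1,1}(Om)) and Dw is (a representative of) its
   weak gradient in x.  Elements of this Bochner space are identified with
   jointly measurable functions on Om x (0, T); since W^{1,1}(Om) is separable,
   the joint measurability of w and Dw makes t |-> w(., t) strongly
   measurable. *)
Definition L1W11 (Om : set 'rV[R]_n) (T : R) (w : 'rV[R]_n * R -> R)
    (Dw : 'rV[R]_n * R -> 'rV[R]_n) : Prop :=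
  [/\ @measurable_fun _ _ ('rV[R]_n * measurableTypeR R)%type R
        (parabolic_domain Om T) w,
      @measurable_fun _ _ ('rV[R]_n * measurableTypeR R)%type 'rV[R]_n
        (parabolic_domain Om T) Dw,
      {ae @lebesgue_measure R, forall t, (0 < t < T)%R ->
        sobolev11 Om (fun x => w (x, t)) (fun x => Dw (x, t))} &
      \int[lebesgue_measure]_(t in `]0%R, T[)
        sobolev11_norm Om (fun x => w (x, t)) (fun x => Dw (x, t)) < +oo].

(* Measurability is not included: w is measurable on U (resp. Om x (0, T)) in
   all the uses of [in_Linfty] and [in_LinftyLs]. *)
Definition in_Linfty (U : set ('rV[R]_n * R)) (w : 'rV[R]_n * R -> R) : Prop :=
  'N[lebesgue_xt R n]_+oo [EFin \o (w \_ U)] < +oo.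

Definition in_LinftyLs (Om : set 'rV[R]_n) (T s : R)
    (w : 'rV[R]_n * R -> R) : Prop :=
  let Ls_norm t := 'N[lebesgue_rV R n]_(s%:E)
    [EFin \o ((fun x => w (x, t)) \_ Om)] in
  'N[@lebesgue_measure R]_+oo [Ls_norm \_ `]0%R, T[%classic] < +oo.

Definition energy (G H : R -> R) (a : 'rV[R]_n * R -> R)
    (Dw : 'rV[R]_n * R -> 'rV[R]_n) (U : set ('rV[R]_n * R)) : \bar R :=
  \int[lebesgue_xt R n]_(z in U)
    (G (enorm (Dw z)) + a z * H (enorm (Dw z)))%:E.

Definition in_LG (G : R -> R) (Q : set ('rV[R]_n * R))
    (f : 'rV[R]_n * R -> 'rV[R]_n) : Prop :=
  @measurable_fun _ _ ('rV[R]_n * measurableTypeR R)%type 'rV[R]_n Q f /\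
  exists2 l : R, (0 < l)%R &
    \int[lebesgue_xt R n]_(z in Q) (G (enorm (f z) / l))%:E < +oo.

Definition luxemburg (G : R -> R) (Q : set ('rV[R]_n * R))
    (f : 'rV[R]_n * R -> 'rV[R]_n) : \bar R :=
  ereal_inf [set l%:E | l in [set l : R | (0 < l)%R /\
    \int[lebesgue_xt R n]_(z in Q) (G (enorm (f z) / l))%:E <= 1]].

Definition cvg_L1 (Q : set ('rV[R]_n * R)) (u : nat -> 'rV[R]_n * R -> R)
    (w : 'rV[R]_n * R -> R) : Prop :=
  [/\ forall m, (lebesgue_xt R n).-integrable Q (EFin \o u m),
      (lebesgue_xt R n).-integrable Q (EFin \o w) &
      \int[lebesgue_xt R n]_(z in Q) `|u m z - w z|%:E @[m --> \oo] --> 0].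

Definition cvg_LG (G : R -> R) (Q : set ('rV[R]_n * R))
    (f : nat -> 'rV[R]_n * R -> 'rV[R]_n) (g : 'rV[R]_n * R -> 'rV[R]_n) :
    Prop :=
  [/\ forall m, in_LG G Q (f m), in_LG G Q g &
      luxemburg G Q (fun z => f m z - g z)%R @[m --> \oo] --> 0].

End function_spaces.

(* Main.v *)
Require Import Defs.
From HB Require Import structures.
From mathcomp Require Import all_boot all_order all_algebra.
From mathcomp Require Import all_classical all_reals all_analysis.
From mathcomp Require Import measurable_realfun ess_sup_inf ring lra.

Set Implicit Arguments.
Unset Strict Implicit.
Unset Printing Implicit Defensive.

Import Order.TTheory GRing.Theory Num.Theory.
Import numFieldNormedType.Exports.

Local Open Scope classical_set_scope.
Local Open Scope ring_scope.

(** Extend [w] and [Dw] by zero outside the domain and average them over parabolic boxes of size rho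
    = 1/(m+1) in space and rho^2 in time. The averages of [w] are smooth, and on the cylinder, whose
    closure is compact in the domain, their spatial gradient v is, for m large, the average of [Dw].
    Averages of integrable functions converge in L^1; the difficulty is the limit of the energies,
    where the weight a(z) stands outside the average.

    The central estimate, [smoothed_gradient_energy], is G(|v|) + a(z) H(|v|) <= (2 + C) A, where A
    is the average around z of the energy density of [w]. Put b = max(0, a(z) - om(rho)). Since b <=
    a(y) at every y within reach of the kernel at z, Jensen's inequality bounds both G(|v|) and b
    H(|v|) by A. What remains, om(rho) H(|v|), has to be absorbed into C G(|v|) with C independent
    of m and z. As H o G^-1 is convex and vanishes at 0, the ratio H/G is nondecreasing; as H is
    doubling, it is enough to have om(rho) H(theta) <= C G(theta) at one size theta = theta(rho)
    that dominates |v| up to a constant ([young_prec_growth], [growth_of_size]).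

    Each of the three conditions supplies its theta. In (i), Jensen and the bound rho^-(n+2) of the
    kernel give G(|v|) <= const rho^-(n+2), so theta = G^-1(rho^-(n+2)). In (ii) and (iii) the
    derivative is moved onto the kernel, so |v| is at most const rho^-(n+3) times the integral of
    |w| over a box; boundedness of [w] gives theta = rho^-1, and Hölder's inequality in space on
    each time slice gives theta = rho^(-(n+s)/s).

    Finally, indices are chosen along which the L^1 errors of the averages of [w], of the components
    of [Dw] and of the energy density are summable ([fast_subsequence]). The sum S of the errors is
    integrable, convergence holds almost everywhere, and (2 + C)(density + S) dominates all the
    energy densities. Dominated convergence yields the convergence of the energies and, [G] being
    doubling, of the modular at every level, hence in Luxemburg norm ([mollified_approximation]). *)

(** * L^1 convergence of averages against abstract localizing kernels *)

Section approximate_identity.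
Context d (X : measurableType d) (R : realType).
Variable mu : {sigma_finite_measure set X -> \bar R}.
Local Open Scope ereal_scope.

(** The kernel depends on two points rather than on their difference, so that this section needs
    only a measure space; convolution comes back as a special case. *)
Definition kernel_smoothing (k : X -> X -> R) (f : X -> R) (z : X) : R :=
  (\int[mu]_y (k z y * f y))%R.

Lemma integrable_indic_lty A : measurable A -> mu A < +oo ->
  mu.-integrable setT (EFin \o \1_A : X -> \bar R).
Proof.
move=> mA Aoo; apply/integrableP; split; first exact/measurable_EFinP.
under eq_integral do rewrite /= ger0_norm//.
by rewrite integral_indic// setIT.
Qed.

Section one_kernel.
Variable k : X -> X -> R.
Hypothesis k_ge0 : forall z y, (0 <= k z y)%R.
Hypothesis k_meas : measurable_fun setT (fun p : X * X => k p.1 p.2).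
Hypothesis k_int1 : forall z, \int[mu]_y (k z y)%:E = 1.
Hypothesis k_int2 : forall y, \int[mu]_z (k z y)%:E = 1.
Variable B : R.
Hypothesis k_le : forall z y, (k z y <= B)%R.

Let kl z : measurable_fun setT (k z).
Proof. exact: (measurableT_comp k_meas (measurable_pair1 z)). Qed.

Lemma integrable_kernelM z f : mu.-integrable setT (EFin \o f) ->
  mu.-integrable setT (fun y => (k z y * f y)%:E).
Proof.
move=> fi; have mf : measurable_fun setT f.
  by apply/measurable_EFinP; case/integrableP : fi.
have Bf : mu.-integrable setT (fun y => B%:E * (EFin \o f) y).
  exact: integrableZl.
apply: (le_integrable measurableT _ _ Bf) => [|y _].
  by apply/measurable_EFinP/measurable_funM.
rewrite /= lee_fin !normrM ler_wpM2r// ger0_norm//.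
by rewrite ger0_norm ?(le_trans _ (k_le z y)).
Qed.

Lemma integrable2_kernelM f : mu.-integrable setT (EFin \o f) ->
  (mu \x mu).-integrable setT (fun p : X * X => (k p.1 p.2 * f p.2)%:E).
Proof.
move=> fi; have mf : measurable_fun setT f.
  by apply/measurable_EFinP; case/integrableP : fi.
have mkf : measurable_fun setT (fun p : X * X => (k p.1 p.2 * f p.2)%R).
  by apply: measurable_funM => //; exact: measurableT_comp.
apply/integrable21ltyP; first exact/measurable_EFinP.
rewrite (_ : (fun y => _) = (fun y => `|(f y)%:E|)).
  by case/integrableP : fi.
apply/funext => y /=.
under eq_integral do rewrite normrM (ger0_norm (k_ge0 _ _)) EFinM muleC.
rewrite ge0_integralZl//= ?k_int2 ?mule1//.
- apply/measurable_EFinP.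
  exact: (measurableT_comp k_meas (measurable_pair2 y)).
- by move=> z _; rewrite lee_fin.
Qed.

Lemma measurable_kernel_smoothing f : mu.-integrable setT (EFin \o f) ->
  measurable_fun setT (kernel_smoothing k f).
Proof.
move=> fi; have := measurable_fubini_F (integrable2_kernelM fi).
by move=> mF; exact: (measurableT_comp (@fine_measurable R setT measurableT) mF).
Qed.

Lemma kernel_smoothing_le f z :  mu.-integrable setT (EFin \o f) ->
  `|kernel_smoothing k f z|%:E <= \int[mu]_y (k z y * `|f y|)%:E.
Proof.
move=> fi; rewrite /kernel_smoothing EFin_normr_Rintegral//; last first.
  exact: integrable_kernelM.
apply: le_trans (le_abse_integral _ _ _) _ => //.
  by case/integrableP: (integrable_kernelM z fi).
by under eq_integral do rewrite /= normrM (ger0_norm (k_ge0 _ _)).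
Qed.

(** Tonelli moves the outer integral onto the kernel, whose integral in its first argument is 1. The
    operator bound is thus uniform over all kernels of a family, as the density argument
    [smoothing_cvg_closed] requires. *)
Lemma kernel_smoothing_contraction f : mu.-integrable setT (EFin \o f) ->
  \int[mu]_z `|kernel_smoothing k f z|%:E <= \int[mu]_z `|f z|%:E.
Proof.
move=> fi; have mf : measurable_fun setT f.
  by apply/measurable_EFinP; case/integrableP : fi.
have mkf : measurable_fun setT (fun p : X * X => (k p.1 p.2 * `|f p.2|)%:E).
  apply/measurable_EFinP; apply: measurable_funM => //.
  by apply: measurableT_comp => //; exact: measurableT_comp.
have kf0 : forall p : X * X, 0 <= (k p.1 p.2 * `|f p.2|)%:E.
  by move=> p; rewrite lee_fin mulr_ge0.
apply: le_trans (_ : _ <= \int[mu]_z \int[mu]_y (k z y * `|f y|)%:E) _.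
  apply: ge0_le_integral => //.
  - apply/measurable_EFinP/measurableT_comp => //.
    exact: measurable_kernel_smoothing.
  - exact: (measurable_fun_fubini_tonelli_F _ mkf kf0).
  - by move=> z _; exact: kernel_smoothing_le.
rewrite (@fubini_tonelli _ _ _ _ _ mu mu _ mkf kf0)/=.
rewrite le_eqVlt; apply/orP; left; apply/eqP; apply: eq_integral => y _.
under eq_integral do rewrite EFinM muleC.
rewrite ge0_integralZl//= ?k_int2 ?mule1//.
- apply/measurable_EFinP.
  exact: (measurableT_comp k_meas (measurable_pair2 y)).
- by move=> z _; rewrite lee_fin.
Qed.

Lemma integrable_kernel_smoothing f : mu.-integrable setT (EFin \o f) ->
  mu.-integrable setT (EFin \o kernel_smoothing k f).
Proof.
move=> fi; apply/integrableP; split.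
  exact/measurable_EFinP/measurable_kernel_smoothing.
apply: le_lt_trans (kernel_smoothing_contraction fi) _.
by case/integrableP : fi.
Qed.

Lemma kernel_smoothingB f g z : mu.-integrable setT (EFin \o f) ->
  mu.-integrable setT (EFin \o g) ->
  kernel_smoothing k (fun x => f x - g x)%R z =
  (kernel_smoothing k f z - kernel_smoothing k g z)%R.
Proof.
move=> fi gi; rewrite /kernel_smoothing.
under eq_Rintegral do rewrite mulrBr.
by rewrite RintegralB//; exact: integrable_kernelM.
Qed.

Lemma kernel_smoothingD f g z : mu.-integrable setT (EFin \o f) ->
  mu.-integrable setT (EFin \o g) ->
  kernel_smoothing k (fun x => f x + g x)%R z =
  (kernel_smoothing k f z + kernel_smoothing k g z)%R.
Proof.
move=> fi gi; rewrite /kernel_smoothing.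
under eq_Rintegral do rewrite mulrDr.
by rewrite RintegralD//; exact: integrable_kernelM.
Qed.

Lemma kernel_smoothingZ f c z : mu.-integrable setT (EFin \o f) ->
  kernel_smoothing k (fun x => c * f x)%R z = (c * kernel_smoothing k f z)%R.
Proof.
move=> fi; rewrite /kernel_smoothing.
under eq_Rintegral do rewrite mulrCA.
by rewrite RintegralZl//; exact: integrable_kernelM.
Qed.

Lemma kernel_smoothing_integral f : mu.-integrable setT (EFin \o f) ->
  \int[mu]_z (kernel_smoothing k f z)%:E = \int[mu]_z (f z)%:E.
Proof.
move=> fi; transitivity (\int[mu]_z \int[mu]_y (k z y * f y)%:E).
  apply: eq_integral => z _; rewrite /kernel_smoothing /Rintegral fineK//.
  exact/integrable_fin_num/integrable_kernelM.
rewrite (Fubini (integrable2_kernelM fi))/=; apply: eq_integral => y _.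
under eq_integral do rewrite EFinM muleC.
rewrite integralZl//= ?k_int2 ?mule1//.
apply/integrableP; split.
  apply/measurable_EFinP.
  exact: (measurableT_comp k_meas (measurable_pair2 y)).
under eq_integral do rewrite /= (ger0_norm (k_ge0 _ _)).
by rewrite k_int2 ltry.
Qed.

(* As the integrals of [\1_A] and of its smoothing agree, only the negative part
   of their difference has to be controlled. *)
Lemma kernel_smoothing_indic_dist A : measurable A -> mu A < +oo ->
  \int[mu]_z `|kernel_smoothing k \1_A z - \1_A z|%:E =
  2%:E * \int[mu]_z (Num.max (\1_A z - kernel_smoothing k \1_A z) 0)%:E.
Proof.
move=> mA Aoo; have iA : mu.-integrable setT (EFin \o \1_A : X -> \bar R).
  exact: integrable_indic_lty.
have iT := integrable_kernel_smoothing iA.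
set g := kernel_smoothing k \1_A.
have id : mu.-integrable setT (EFin \o (fun z => g z - \1_A z)%R).
  by under [_ \o _]eq_fun do rewrite /= EFinB; exact: integrableB.
have in_ : mu.-integrable setT (EFin \o (fun z => Num.max (\1_A z - g z) 0)%R).
  have id' : mu.-integrable setT (EFin \o (fun z => \1_A z - g z)%R).
    by under [_ \o _]eq_fun do rewrite /= EFinB; exact: integrableB.
  rewrite (_ : _ \o _ = (EFin \o (fun z => \1_A z - g z)%R)^\+).
    exact: integrable_funepos.
  by apply/funext => z; rewrite funeposE /= EFin_max.
transitivity (\int[mu]_z ((g z - \1_A z)%:E +
    2%:E * (Num.max (\1_A z - g z) 0)%:E)).
  apply: eq_integral => z _; rewrite -EFinM -EFinD; congr EFin.
  by case: (lerP (g z) (\1_A z)) => h;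
    [rewrite max_l ?subr_ge0//; lra|
     rewrite max_r ?subr_le0 ?(ltW h)//; lra].
rewrite integralD//=; last exact: integrableZl.
rewrite integralZl//= [X in X + _](_ : _ = 0) ?add0e//.
under eq_integral do rewrite EFinB.
rewrite integralB//= kernel_smoothing_integral// subee//.
exact: integrable_fin_num.
Qed.

End one_kernel.

Section family.
Variable k : nat -> X -> X -> R.
Hypothesis k_ge0 : forall m z y, (0 <= k m z y)%R.
Hypothesis k_meas : forall m, measurable_fun setT (fun p : X * X => k m p.1 p.2).
Hypothesis k_int1 : forall m z, \int[mu]_y (k m z y)%:E = 1.
Hypothesis k_int2 : forall m y, \int[mu]_z (k m z y)%:E = 1.
Variable B : nat -> R.
Hypothesis k_le : forall m z y, (k m z y <= B m)%R.

Definition smoothing_cvg (f : X -> R) : Prop :=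
  mu.-integrable setT (EFin \o f) /\
  \int[mu]_z `|kernel_smoothing (k m) f z - f z|%:E @[m --> \oo] --> 0.

Lemma smoothing_cvgP f : mu.-integrable setT (EFin \o f) ->
  (smoothing_cvg f <-> forall e : R, (0 < e)%R -> \forall m \near \oo,
    \int[mu]_z `|kernel_smoothing (k m) f z - f z|%:E <= e%:E).
Proof.
move=> fi; split.
  move=> [_ fc] e e0; move/fine_cvgP : fc => [fc1 fc2].
  have := fc1; apply: filterS2 ((cvgr0Pnorm_le _).1 fc2 _ e0) => m /= + fm.
  by rewrite ger0_norm ?fine_ge0 ?integral_ge0// -lee_fin fineK.
move=> h; split => //; apply/fine_cvgP; split.
  have := h 1%R ltr01; apply: filterS => m /= hm.
  by rewrite ge0_fin_numE ?integral_ge0//; apply: le_lt_trans hm (ltry _).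
apply/cvgr0Pnorm_le => e e0; have := h e e0; apply: filterS => m /= hm.
rewrite ger0_norm ?fine_ge0 ?integral_ge0// -lee_fin fineK//.
by rewrite ge0_fin_numE ?integral_ge0//; apply: le_lt_trans hm (ltry _).
Qed.

Let dist_integrable f m : mu.-integrable setT (EFin \o f) ->
  mu.-integrable setT (EFin \o (fun z => kernel_smoothing (k m) f z - f z)%R).
Proof.
move=> fi; have ii := integrable_kernel_smoothing (k_ge0 m) (k_meas m)
  (k_int2 m) (k_le m) fi.
by under [_ \o _]eq_fun do rewrite /= EFinB; exact: integrableB.
Qed.

Let integral_normB_le (f g : X -> R) : mu.-integrable setT (EFin \o f) ->
  mu.-integrable setT (EFin \o g) ->
  \int[mu]_z `|f z - g z|%:E <=
  \int[mu]_z `|f z|%:E + \int[mu]_z `|g z|%:E.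
Proof.
move=> /integrableP[/measurable_EFinP mf _] /integrableP[/measurable_EFinP mg _].
rewrite -ge0_integralD//; last 2 first.
  exact/measurable_EFinP/measurableT_comp.
  exact/measurable_EFinP/measurableT_comp.
apply: ge0_le_integral => //.
- exact/measurable_EFinP/measurableT_comp/measurable_funB.
- by apply: emeasurable_funD; exact/measurable_EFinP/measurableT_comp.
- by move=> z _; rewrite -EFinD lee_fin ler_normB.
Qed.

Lemma smoothing_cvgB f g : smoothing_cvg f -> smoothing_cvg g ->
  smoothing_cvg (fun x => f x - g x)%R.
Proof.
move=> [fi fc] [gi gc].
have fgi : mu.-integrable setT (EFin \o (fun x => f x - g x)%R).
  by under [_ \o _]eq_fun do rewrite /= EFinB; exact: integrableB.
split => //; have := cvgeD _ fc gc; rewrite adde0 => /(_ _ isT).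
apply: (@squeeze_cvge _ _ _ _ (cst 0)); last exact: cvg_cst.
apply: nearW => m; rewrite integral_ge0//=.
apply: le_trans (integral_normB_le (dist_integrable m fi) (dist_integrable m gi)).
rewrite le_eqVlt; apply/orP; left; apply/eqP; apply: eq_integral => z _.
rewrite (kernel_smoothingB (k_ge0 m) (k_meas m) (k_le m))//.
by congr (`|_|%R%:E); lra.
Qed.

Lemma smoothing_cvgZ f c : smoothing_cvg f -> smoothing_cvg (fun x => c * f x)%R.
Proof.
move=> [fi fc]; have cfi : mu.-integrable setT (EFin \o (fun x => c * f x)%R).
  by under [_ \o _]eq_fun do rewrite /= EFinM; exact: integrableZl.
split => //; have := cvgeZl _ fc; move=> /(_ `|c|%:E isT); rewrite mule0.
apply: cvg_trans; apply: near_eq_cvg; apply: nearW => m.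
rewrite -integralZl//=; last exact: (integrable_norm (dist_integrable m fi)).
apply: eq_integral => z _.
by rewrite (kernel_smoothingZ (k_ge0 m) (k_meas m) (k_le m))// -EFinM -normrM mulrBr.
Qed.

(** An argument in three thirds of epsilon: writing S for the smoothing, Sf - f = (Sg - g) + S(f -
    g) - (f - g), and the middle term is controlled by the contraction property. *)
Lemma smoothing_cvg_closed f : mu.-integrable setT (EFin \o f) ->
  (forall e : R, (0 < e)%R -> exists g, smoothing_cvg g /\
     \int[mu]_z `|f z - g z|%:E <= e%:E) -> smoothing_cvg f.
Proof.
move=> fi h; apply/smoothing_cvgP => // e e0.
have e3 : (0 < e / 3)%R by rewrite divr_gt0.
have [g [gc fg]] := h _ e3; have gi := gc.1.
have fgi : mu.-integrable setT (EFin \o (fun x => f x - g x)%R).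
  by under [_ \o _]eq_fun do rewrite /= EFinB; exact: integrableB.
have /(smoothing_cvgP gi)/(_ _ e3) := gc; apply: filterS => m hm.
have cfg := kernel_smoothing_contraction (k_ge0 m) (k_meas m) (k_int2 m) (k_le m) fgi.
rewrite (_ : e = e / 3 + e / 3 + e / 3)%R; last lra.
rewrite 2!EFinD; apply: le_trans; last first.
  by apply: leeD; [apply: leeD; [exact: hm|exact: le_trans cfg fg]|exact: fg].
rewrite (_ : \int[mu]_z _ = \int[mu]_z `|(kernel_smoothing (k m) g z - g z) -
  (((f z - g z) - kernel_smoothing (k m) (fun x => f x - g x)%R z))|%:E); last first.
  apply: eq_integral => z _.
  by rewrite (kernel_smoothingB (k_ge0 m) (k_meas m) (k_le m))//; congr (`|_|%R%:E); lra.
apply: le_trans (integral_normB_le (dist_integrable m gi) _) _.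
  rewrite (_ : _ \o _ = EFin \o (fun z => - 1 *
      (kernel_smoothing (k m) (fun x => f x - g x) z - (f z - g z)))%R).
    under [_ \o _]eq_fun do rewrite /= EFinM.
    by apply: integrableZl => //; exact: dist_integrable.
  by apply/funext => z /=; congr EFin; lra.
rewrite -[leRHS]addeA; apply: leeD2l; rewrite addeC.
apply: integral_normB_le => //.
exact: (integrable_kernel_smoothing (k_ge0 m) (k_meas m) (k_int2 m) (k_le m)).
Qed.

Lemma smoothing_cvg0 : smoothing_cvg (fun=> 0%R).
Proof.
split; first exact: integrable0.
rewrite (_ : (fun _ => _) = cst 0); first exact: cvg_cst.
apply/funext => m; apply: integral0_eq => z _.
rewrite /kernel_smoothing (_ : Rintegral _ _ _ = 0%R) ?subr0 ?normr0//.
by rewrite /Rintegral integral0_eq// => y _; rewrite mulr0.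
Qed.

Lemma smoothing_cvg_sum (I : Type) (s : seq I) (F : I -> X -> R) :
  (forall i, smoothing_cvg (F i)) ->
  smoothing_cvg (fun x => \sum_(i <- s) F i x)%R.
Proof.
move=> Fc; elim: s => [|i s ih].
  by under [fun _ => _]eq_fun do rewrite big_nil; exact: smoothing_cvg0.
rewrite (_ : (fun _ => _) =
    (fun x => F i x - -1 * \sum_(i <- s) F i x)%R).
  by apply: smoothing_cvgB => //; exact: smoothing_cvgZ.
by apply/funext => x; rewrite big_cons mulN1r opprK.
Qed.

Section sets.
Variable G : set (set X).
Hypothesis G_setI : setI_closed G.
Hypothesis G_gen : @measurable _ X = <<s G >>.
Hypothesis G_local : forall U z, G U -> U z ->
  \forall m \near \oo, forall y, ~ U y -> k m z y = 0%R.

Let G_measurable U : G U -> measurable U.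
Proof. by move=> GU; rewrite G_gen; exact: sub_sigma_algebra. Qed.

(** By [kernel_smoothing_indic_dist] only the negative part of the error counts. At a point of U it
    is eventually 0, because the kernel there is carried by U; off U it is 0 because the smoothing
    is nonnegative. The indicator of U dominates it. *)
Lemma smoothing_cvg_local U : G U -> mu U < +oo -> smoothing_cvg \1_U.
Proof.
move=> GU Uoo; have mU := G_measurable GU; have iU := integrable_indic_lty mU Uoo.
split => //.
have -> : (fun m => \int[mu]_z `|kernel_smoothing (k m) \1_U z - \1_U z|%:E) =
  (fun m => 2%:E * \int[mu]_z
     (Num.max (\1_U z - kernel_smoothing (k m) \1_U z) 0)%:E).
  by apply/funext => m; rewrite (kernel_smoothing_indic_dist (k_ge0 m) (k_meas m)
    (k_int2 m) (k_le m)).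
rewrite -[X in _ --> X](mule0 2%:E).
apply: cvgeZl => //.
have mT m := measurable_kernel_smoothing (k_ge0 m) (k_meas m) (k_int2 m) iU.
have T0 m z : (0 <= kernel_smoothing (k m) \1_U z)%R.
  by apply: Rintegral_ge0 => y _; rewrite mulr_ge0.
have [] := @dominated_convergence _ _ _ mu setT measurableT
  (fun m z => (Num.max (\1_U z - kernel_smoothing (k m) \1_U z) 0)%:E)
  (cst 0) (EFin \o \1_U) _ _ _ iU.
- move=> m; apply/measurable_EFinP; apply: measurable_maxr => //.
  exact: measurable_funB.
- exact: measurable_cst.
- apply: aeW => z _; have [Uz|Uz] := pselect (U z).
    apply: cvg_near_cst; have := G_local GU Uz; apply: filterS => m hm.
    rewrite (_ : kernel_smoothing _ _ _ = 1%R).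
      by rewrite indicE mem_set// subrr maxxx.
    rewrite /kernel_smoothing /Rintegral.
    transitivity (fine (\int[mu]_y (k m z y)%:E)); last by rewrite k_int1.
    congr fine; apply: eq_integral => y _; rewrite indicE.
    have [Uy|Uy] := pselect (U y); first by rewrite mem_set// mulr1.
    by rewrite hm// mul0r.
  apply: cvg_near_cst; apply: nearW => m.
  by rewrite indicE memNset// sub0r max_r// oppr_le0.
- apply: aeW => z m _ /=; rewrite lee_fin ger0_norm ?le_max ?lexx ?orbT//.
  by rewrite ge_max gerBl ?T0//= indicE.
- by move=> _ _; rewrite integral0.
Qed.

Variable K : set X.
Hypothesis GK : G K.
Hypothesis K_fin : mu K < +oo.

(** The good sets form a lambda-system containing the generating pi-system [G]. Intersecting with
    [K], of finite measure, keeps every indicator integrable, including that of the whole space. *)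
Lemma smoothing_cvg_indic A : measurable A -> smoothing_cvg \1_(A `&` K).
Proof.
have mK := G_measurable GK.
have finK C : measurable C -> mu (C `&` K) < +oo.
  move=> mC; apply: le_lt_trans K_fin; apply: le_measure; rewrite ?inE//.
  exact: measurableI.
pose H := [set A | measurable A /\ smoothing_cvg \1_(A `&` K)].
suff : <<s G >> `<=` H by rewrite -G_gen => h /h[].
apply: lambda_system_subset => //; last first.
- by move=> U GU; split; [exact: G_measurable|apply: smoothing_cvg_local;
    [exact: G_setI|exact/finK/G_measurable]].
split => //.
- by split => //; rewrite setTI; exact: smoothing_cvg_local.
- move=> D C CD [mD Dc] [mC Cc]; split; first exact: measurableD.
  rewrite (_ : \1_ _ = (fun x => \1_(D `&` K) x - \1_(C `&` K) x)%R).
    exact: smoothing_cvgB.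
  apply/funext => x; rewrite !indicE !in_setI in_setC.
  have [xD|xD] := boolP (x \in D); have [xC|xC] := boolP (x \in C);
    have [xK|xK] := boolP (x \in K); rewrite /= ?subr0 ?subrr//.
  by move: xC; rewrite inE => /CD /mem_set; rewrite (negbTE xD).
- move=> F ndF HF; have mF i := (HF i).1.
  have mU : measurable (\bigcup_i F i) by exact: bigcup_measurable.
  have iU : mu.-integrable setT (EFin \o \1_((\bigcup_i F i) `&` K) : X -> \bar R).
    by apply/integrable_indic_lty/finK => //; exact: measurableI.
  split => //; apply: smoothing_cvg_closed => // e e0.
  (* Dominated convergence along the increasing union produces one [F i] whose indicator, cut by
     [K], is within e in L^1; closedness then applies. *)
  have [] := @dominated_convergence _ _ _ mu setT measurableT
    (fun i => EFin \o \1_(F i `&` K)) (EFin \o \1_((\bigcup_i F i) `&` K))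
    (EFin \o \1_((\bigcup_i F i) `&` K)) _ _ _ iU.
  + by move=> i; apply/measurable_EFinP/measurable_indic/measurableI.
  + by case/integrableP : iU.
  + apply: aeW => x _ /=; have [Ux|Ux] := pselect ((\bigcup_i F i) x).
      case: Ux => i _ Fix; apply: cvg_near_cst; near=> j.
      have Fjx : F j x.
        have /ndF/subsetPset : (i <= j)%N by near: j; exact: nbhs_infty_ge.
        exact.
      rewrite !indicE !in_setI [x \in F j]mem_set//.
      by rewrite [x \in \bigcup_i F i]mem_set//; exists i.
    apply: cvg_near_cst; near=> j.
    rewrite !indicE !in_setI [x \in \bigcup_i F i]memNset//.
    by rewrite memNset// => Fjx; apply: Ux; exists j.
  + apply: aeW => x i _ /=; rewrite lee_fin ger0_norm// !indicE ler_nat.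
    rewrite !in_setI; case: (boolP (x \in F i)) => // xi.
    by rewrite [x \in \bigcup_i F i]mem_set//; exists i => //; exact/set_mem.
  move=> _ /fine_cvgP[fc1 fc2] _.
  have [i [i1 i2]] : exists i, (\int[mu]_x `|(EFin \o \1_(F i `&` K)) x -
      (EFin \o \1_((\bigcup_i F i) `&` K)) x|) \is a fin_num /\
    (`|fine (\int[mu]_x `|(EFin \o \1_(F i `&` K)) x -
      (EFin \o \1_((\bigcup_i F i) `&` K)) x|)| <= e)%R.
    have := (cvgr0Pnorm_le _).1 fc2 _ e0.
    by case: (filterI fc1 (((cvgr0Pnorm_le _).1 fc2) _ e0)) => i _ /(_ i (leqnn i))[]; exists i.
  exists \1_(F i `&` K); split; first exact: (HF i).2.
  move: i2; rewrite ger0_norm ?fine_ge0 ?integral_ge0// -lee_fin fineK//.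
  apply: le_trans; rewrite le_eqVlt; apply/orP; left; apply/eqP.
  by apply: eq_integral => z _; rewrite /= distrC.
Unshelve. all: by end_near.
Qed.

Import HBSimple.

(** Simple functions are dense in L^1. Multiplying the approximant by the indicator of [K] does not
    worsen the error, since f vanishes off [K], and turns it into a finite combination of the
    indicators of [smoothing_cvg_indic]. *)
Lemma smoothing_cvg_integrable f : mu.-integrable setT (EFin \o f) ->
  (forall x, ~ K x -> f x = 0%R) -> smoothing_cvg f.
Proof.
have mK := G_measurable GK.
move=> fi fK; apply: smoothing_cvg_closed => // e e0.
have [g [gi _ /fine_cvgP[fc1 fc2]]] := approximation_sfun_integrable measurableT fi.
have [i [i1 i2]] : exists i, (\int[mu]_x `|(EFin \o f) x - (g i x)%:E|) \is a fin_num /\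
    (`|fine (\int[mu]_x `|(EFin \o f) x - (g i x)%:E|)| <= e)%R.
  by case: (filterI fc1 (((cvgr0Pnorm_le _).1 fc2) _ e0)) => i _ /(_ i (leqnn i))[]; exists i.
exists (fun x => g i x * \1_K x)%R; split.
  rewrite (_ : (fun _ => _) = (fun x => \sum_(y <- finmap.enum_fset (fset_set (range (g i))))
      y * \1_((g i @^-1` [set y]) `&` K) x)%R).
    apply: smoothing_cvg_sum => y; apply: smoothing_cvgZ.
    exact: smoothing_cvg_indic.
  apply/funext => x; rewrite fimfunE fsbig_finite//= mulr_suml.
  by apply: eq_bigr => y _; rewrite indicI -mulrA.
move: i2; rewrite ger0_norm ?fine_ge0 ?integral_ge0// -lee_fin fineK//.
apply: le_trans; apply: ge0_le_integral => //.
- apply/measurable_EFinP/measurableT_comp => //; apply: measurable_funB.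
    by case/integrableP : fi => /measurable_EFinP.
  exact: measurable_funM.
- apply: measurableT_comp => //; apply: emeasurable_funB.
    by case/integrableP : fi.
  exact/measurable_EFinP.
- move=> x _; rewrite /= lee_fin indicE; have [Kx|Kx] := pselect (K x).
    by rewrite mem_set// mulr1.
  by rewrite fK// memNset// mulr0 subrr normr0.
Qed.

End sets.
End family.
End approximate_identity.

(** * Young functions: regularity, left-inverse, and the growth of H relative to G *)

Section young_theory.
Variable R : realType.
Implicit Types (Phi G H : R -> R) (s t u l : R).

Lemma young_ge0 Phi t : young Phi -> 0 <= t -> 0 <= Phi t.
Proof. by case=> h _ _ _; exact: h. Qed.

Lemma young0 Phi : young Phi -> Phi 0 = 0.
Proof. by case=> _ _ _ []. Qed.

Lemma young_le Phi s t : young Phi -> 0 <= s -> s <= t -> Phi s <= Phi t.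
Proof.
case=> _ h _ _ s0 st; apply: h => //; rewrite in_itv/= andbT//.
exact: le_trans st.
Qed.

Lemma young_convex Phi l s t : young Phi -> 0 <= s -> 0 <= t -> 0 <= l <= 1 ->
  Phi (l * s + (1 - l) * t) <= l * Phi s + (1 - l) * Phi t.
Proof.
case=> _ _ h _ s0 t0 l01; have i01 : Itv.spec (@Itv.num_sem R) (Itv.Real `[0%Z, 1%Z]%R) l.
  by apply/andP; split; rewrite ?num_real//= in_itv/=.
have := h (Itv.mk i01) s t.
by rewrite !inE/= !in_itv/= !andbT !convRE; exact.
Qed.

Lemma young_scale Phi l t : young Phi -> 0 <= t -> 0 <= l <= 1 ->
  Phi (l * t) <= l * Phi t.
Proof.
move=> yP t0 l01; have := young_convex yP t0 (lexx 0) l01.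
by rewrite !mulr0 addr0 young0// mulr0 addr0.
Qed.

Lemma young_scale_ge Phi c t : young Phi -> 0 <= t -> 1 <= c ->
  c * Phi t <= Phi (c * t).
Proof.
move=> yP t0 c1; have c0 : 0 < c by exact: lt_le_trans c1.
have c01 : 0 <= c^-1 <= 1 by rewrite invr_ge0 (ltW c0)/= invf_le1.
have := young_scale yP (mulr_ge0 (ltW c0) t0) c01.
by rewrite mulKf ?gt_eqF// ler_pdivlMl.
Qed.

(** Difference quotients of a convex function increase; the cross-multiplied form allows coinciding
    points. *)
Lemma young_slopes Phi s t u : young Phi -> 0 <= s -> s <= t -> t <= u ->
  (Phi t - Phi s) * (u - t) <= (Phi u - Phi t) * (t - s).
Proof.
move=> yP s0 st tu; have [su|su] := eqVneq s u.
  by have -> : t = s; [apply/eqP; rewrite eq_le {1}su tu st|rewrite su !subrr].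
have us0 : 0 < u - s by rewrite subr_gt0 lt_neqAle su (le_trans st).
pose l := (u - t) / (u - s).
have l01 : 0 <= l <= 1.
  rewrite /l divr_ge0 ?subr_ge0 ?(ltW us0)//= ?ler_pdivrMr//; first lra.
  by apply: le_trans tu.
have := young_convex yP s0 (le_trans s0 (le_trans st tu)) l01.
have -> : l * s + (1 - l) * u = t by rewrite /l; field; rewrite gt_eqF.
have lE : l * (u - s) = u - t by rewrite /l divfK// gt_eqF.
rewrite -(ler_pM2r us0) mulrDl => h.
have h2 : Phi t * (u - s) <= (l * (u - s)) * Phi s + ((u - s) - l * (u - s)) * Phi u.
  by move: h; lra.
by move: h2; rewrite lE; lra.
Qed.

(** The slope on [s, t] is at most the slope from t to 2M, where the increment is at most
    [Phi (2 * M)] and the length at least M. *)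
Lemma young_lipschitz Phi s t M : young Phi -> 0 <= s -> s <= t -> t <= M ->
  0 < M -> Phi t - Phi s <= (Phi (2 * M) / M) * (t - s).
Proof.
move=> yP s0 st tM M0; have h := @young_slopes _ s t (2 * M) yP s0 st ltac:(lra).
have P0 : 0 <= Phi t by apply: young_ge0 => //; lra.
have d0 : 0 <= Phi t - Phi s by rewrite subr_ge0 young_le.
rewrite mulrAC ler_pdivlMr//; apply: le_trans (_ : _ <= (Phi t - Phi s) * (2 * M - t)) _.
  by rewrite ler_wpM2l//; lra.
by apply: le_trans h _; rewrite ler_wpM2r//; lra.
Qed.

(** [young] says nothing about negative arguments; composing with the absolute value gives a
    function continuous on the whole line, as measurability and limits of compositions require. *)
Lemma young_abs_continuous Phi : young Phi -> continuous (fun t => Phi `|t|).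
Proof.
move=> yP x; pose M := `|x| + 1; pose L := Phi (2 * M) / M.
have M0 : 0 < M by rewrite /M; have := normr_ge0 x; lra.
have L0 : 0 <= L by rewrite /L divr_ge0 ?(ltW M0)// young_ge0//; lra.
have lip y : `|y| <= M -> `|Phi `|x| - Phi `|y| | <= L * `|x - y|.
  move=> yM; apply: le_trans (_ : _ <= L * `| `|x| - `|y| |) _; last first.
    by rewrite ler_wpM2l// ler_dist_dist.
  have xM : `|x| <= M by rewrite /M; lra.
  case: (lerP `|x| `|y|) => xy.
    by rewrite distrC ger0_norm ?subr_ge0 ?(young_le yP)//; exact: young_lipschitz.
  by rewrite ger0_norm ?subr_ge0 ?(young_le yP) ?(ltW xy)//; apply: young_lipschitz => //; exact: ltW.
apply/cvgrPdist_le => e e0; near=> y.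
have xy1 : `|x - y| <= 1 by near: y; apply: cvgr_dist_le => //; exact: cvg_id.
have xye : `|x - y| <= e / (L + 1).
  near: y; apply: cvgr_dist_le; first exact: cvg_id.
  by rewrite divr_gt0// ltr_wpDl.
apply: le_trans (lip _ _) _.
  by have := ler_normD (y - x) x; rewrite subrK distrC /M; lra.
apply: le_trans (_ : _ <= L * (e / (L + 1))) _; first by rewrite ler_wpM2l.
by rewrite mulrCA ler_piMr ?ltW// ltr_pdivrMr ?mul1r; lra.
Unshelve. all: by end_near. Qed.

(** The slope of the supporting line is the supremum of the difference quotients from the left,
    which every quotient from the right bounds above. It is nonnegative by monotonicity; Jensen's
    inequality for the norm of a vector uses that sign. *)
Lemma young_support Phi r0 : young Phi -> 0 <= r0 ->
  exists2 p, 0 <= p & forall r, 0 <= r -> Phi r0 + p * (r - r0) <= Phi r.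
Proof.
move=> yP; rewrite le_eqVlt => /predU1P[<-|r00].
  by exists 0 => // r r0'; rewrite mul0r addr0 young0// young_ge0.
pose S := [set (Phi r0 - Phi s) / (r0 - s) | s in [set s | 0 <= s < r0]].
have Sub u : r0 < u -> ubound S ((Phi u - Phi r0) / (u - r0)).
  move=> r0u _ [s /= /andP[s0 sr] <-].
  rewrite ler_pdivrMr ?subr_gt0// mulrAC ler_pdivlMr ?subr_gt0//.
  by apply: young_slopes => //; exact: ltW.
have S0 : S ((Phi r0 - Phi 0) / (r0 - 0)) by exists 0 => //=; rewrite lexx.
have Ss : has_sup S.
  by split; [exists ((Phi r0 - Phi 0) / (r0 - 0))|eexists; apply: (Sub (r0 + 1)); lra].
exists (sup S).
  apply: le_trans (_ : _ <= (Phi r0 - Phi 0) / (r0 - 0)) _; last exact: sup_upper_bound.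
  by rewrite subr0 divr_ge0 ?(ltW r00)// subr_ge0 young_le// ltW.
move=> r rge0; case: (ltgtP r r0) => [rr|rr|->]; last by rewrite subrr mulr0 addr0.
- have : (Phi r0 - Phi r) / (r0 - r) <= sup S.
    by apply: sup_upper_bound => //; exists r => //=; rewrite rge0.
  by rewrite ler_pdivrMr ?subr_gt0//; lra.
- have : sup S <= (Phi r - Phi r0) / (r - r0) by apply: ge_sup; [exists ((Phi r0 - Phi 0) / (r0 - 0))|exact: Sub].
  by rewrite ler_pdivlMr ?subr_gt0//; lra.
Qed.

Lemma Delta2_iter Phi K t (j : nat) : 0 <= K ->
  (forall t, 0 <= t -> Phi (2 * t) <= K * Phi t) -> 0 <= t ->
  Phi (2 ^+ j * t) <= K ^+ j * Phi t.
Proof.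
move=> K0 h t0; elim: j => [|j ih]; first by rewrite !expr0 !mul1r.
rewrite !exprS -!mulrA; apply: le_trans (h _ _) _; last by rewrite ler_wpM2l.
by rewrite mulr_ge0// exprn_ge0.
Qed.

(** A zero at t > 0 would propagate by doubling to all 2^j t, against the divergence of [Phi] at
    infinity. *)
Lemma young_gt0 Phi t : young Phi -> Delta2 Phi -> 0 < t -> 0 < Phi t.
Proof.
move=> yP [K K0 h] t0; rewrite lt_neqAle young_ge0 ?ltW// andbT.
apply/eqP => P0; have [_ _ _ [_ Poo _ _]] := yP.
have [M [Mr hM]] : \forall s \near +oo, 1 <= Phi s.
  by move/cvgryPge : Poo; exact.
pose s := Num.max M 0 + 1.
have /hM : M < s by rewrite /s; case: (lerP M 0); lra.
apply/negP; rewrite -ltNge; apply: le_lt_trans ltr01.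
have s0 : 0 <= s by rewrite /s; case: (lerP M 0); lra.
have : s / t <= 2 ^+ (Num.trunc (s / t)).+1.
  apply: ltW; apply: lt_trans (truncnS_gt _) _; rewrite -natrX ltr_nat.
  exact: ltn_expl.
rewrite ler_pdivrMr// => /(young_le yP s0) /le_trans; apply.
by apply: le_trans (Delta2_iter _ (ltW K0) h (ltW t0)) _; rewrite -P0 mulr0.
Qed.

Lemma young_lt Phi s t : young Phi -> Delta2 Phi -> 0 <= s -> s < t ->
  Phi s < Phi t.
Proof.
move=> yP dP s0 st; have t0 : 0 < t by exact: le_lt_trans st.
have l01 : 0 <= s / t <= 1.
  by rewrite divr_ge0 ?(ltW t0)//= ler_pdivrMr// mul1r ltW.
have := young_scale yP (ltW t0) l01; rewrite divfK ?gt_eqF// => /le_lt_trans; apply.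
by rewrite gtr_pMl ?young_gt0// ltr_pdivrMr// mul1r.
Qed.

Lemma young_le_inv Phi s t : young Phi -> Delta2 Phi -> 0 <= t ->
  Phi s <= Phi t -> s <= t.
Proof.
by move=> yP dP t0; apply: contraTT; rewrite -!ltNge; exact: young_lt.
Qed.

Lemma young_linvK Phi t : young Phi -> Delta2 Phi -> 0 <= t ->
  young_linv Phi (Phi t) = t.
Proof.
move=> yP dP t0; rewrite /young_linv.
have St : [set s | 0 <= s /\ Phi t <= Phi s] t by [].
apply/eqP; rewrite eq_le; apply/andP; split.
  by apply: inf_lbound => //; exists 0 => s [].
apply: lb_le_inf; first by exists t.
by move=> s [s0]; exact: young_le_inv.
Qed.

(** The infimum is attained, by continuity: if [Phi th < u], the Lipschitz bound on [th, th + 1]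
    keeps [Phi] below u slightly to the right of th, where the defining set must have points. *)
Lemma young_linv_ge Phi u : young Phi -> 0 <= u ->
  0 <= young_linv Phi u /\ u <= Phi (young_linv Phi u).
Proof.
move=> yP u0; rewrite /young_linv; set S := [set s | _]; set th := inf S.
have S0 : S !=set0.
  have [_ _ _ [_ Poo _ _]] := yP.
  have [M [Mr hM]] : \forall s \near +oo, u <= Phi s.
    by move/cvgryPge : Poo; exact.
  exists (Num.max M 0 + 1); split; first by case: (lerP M 0); lra.
  by apply: hM; case: (lerP M 0); lra.
have th0 : 0 <= th by apply: lb_le_inf => // s [].
split => //; rewrite leNgt; apply/negP => thu.
have M0 : 0 < th + 1 by lra.
set L := Phi (2 * (th + 1)) / (th + 1).
have L0 : 0 <= L by rewrite /L divr_ge0 ?(ltW M0)// young_ge0//; lra.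
pose e := Num.min 1 ((u - Phi th) / (2 * (L + 1))).
have e0 : 0 < e by rewrite /e lt_min ltr01 divr_gt0 ?subr_gt0// mulr_gt0//; lra.
have Si : has_inf S by split => //; exists 0 => s [].
have [s [s1 s2] ss] := inf_adherent e0 Si.
have ss' : s <= th + e by exact: ltW.
have e1 : e <= 1 by rewrite /e ge_min lexx.
have := @young_lipschitz _ th (th + e) (th + 1) yP th0 ltac:(lra) ltac:(lra) M0.
rewrite -/L (addrC th) addrK => h.
have : L * e <= (u - Phi th) / 2.
  apply: le_trans (_ : _ <= (L + 1) * ((u - Phi th) / (2 * (L + 1)))) _; last first.
    by rewrite le_eqVlt; apply/orP; left; apply/eqP; field; lra.
  apply: ler_pM => //; [exact: ltW|lra|by rewrite /e ge_min lexx orbT].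
have := young_le yP s1 ss'; rewrite (addrC th).
by lra.
Qed.

Lemma young_linv_bound Phi u t c : young Phi -> Delta2 Phi -> 0 <= u -> 1 <= c ->
  0 <= t -> Phi t <= c * u -> t <= c * young_linv Phi u.
Proof.
move=> yP dP u0 c1 t0 tu; have [th0 uth] := young_linv_ge yP u0.
apply: (young_le_inv yP dP); first by rewrite mulr_ge0//; lra.
apply: le_trans tu _; apply: le_trans (young_scale_ge yP th0 c1).
by rewrite ler_wpM2l//; lra.
Qed.

(** H o G^-1 is convex and vanishes at 0, hence lies below its chord from the origin to [G th]; at
    the abscissa [G t] this says that H/G is nondecreasing. *)
Lemma young_prec_ratio G H t th : young G -> young H -> Delta2 G ->
  young_prec G H -> 0 < t -> t <= th -> H t * G th <= H th * G t.
Proof.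
move=> yG yH dG GH t0 tth; have th0 : 0 < th by exact: lt_le_trans tth.
have Gth : 0 < G th by exact: young_gt0.
have Gt : 0 < G t by exact: young_gt0.
have l01 : 0 <= G t / G th <= 1.
  by rewrite divr_ge0 ?(ltW Gt) ?(ltW Gth)//= ler_pdivrMr// mul1r (young_le yG (ltW t0)).
have := young_scale GH (ltW Gth) l01.
rewrite divfK ?gt_eqF//= !young_linvK ?(ltW t0) ?(ltW th0)// mulrAC ler_pdivlMr//.
by rewrite (mulrC (G t)).
Qed.

(* [theta] is the size of the mollified gradient at a given scale. *)
Lemma young_prec_growth G H K om C t th (j : nat) : young G -> young H ->
  Delta2 G -> young_prec G H -> 0 <= K ->
  (forall t, 0 <= t -> H (2 * t) <= K * H t) -> 0 <= om -> 0 <= C -> 0 < th ->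
  om * H th <= C * G th -> 0 <= t -> t <= 2 ^+ j * th ->
  om * H t <= C * K ^+ j * G t.
Proof.
move=> yG yH dG GH K0 dH om0 C0 th0 omH t0 tth.
have [->|tn0] := eqVneq t 0; first by rewrite (young0 yG) (young0 yH) !mulr0.
have {tn0}t0 : 0 < t by rewrite lt_neqAle eq_sym tn0.
(* T dominates both t and th. The monotone ratio H/G passes from t to T, doubling of H from T down
   to th at the price K^j, and [G th <= G T] closes the loop. *)
set T := 2 ^+ j * th; have thT : th <= T by rewrite /T ler_peMl ?(ltW th0)// exprn_ege1// ler1n.
have GT : 0 < G T by apply: young_gt0 => //; exact: lt_le_trans thT.
have h1 := young_prec_ratio yG yH dG GH t0 tth.
have h2 : H T <= K ^+ j * H th by apply: Delta2_iter => //; exact: ltW.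
have Gt0 : 0 <= G t by rewrite young_ge0// ltW.
rewrite -(ler_pM2r GT); apply: le_trans (_ : _ <= om * (H T * G t)) _.
  by rewrite -mulrA ler_wpM2l.
apply: le_trans (_ : _ <= om * (K ^+ j * H th * G t)) _.
  by rewrite ler_wpM2l// ler_wpM2r.
rewrite (_ : om * _ = (om * H th) * (K ^+ j * G t)); last ring.
rewrite (_ : _ * G T = (C * G T) * (K ^+ j * G t)); last ring.
rewrite ler_wpM2r ?mulr_ge0 ?exprn_ge0//; apply: le_trans omH _.
by rewrite ler_wpM2l// young_le// ltW.
Qed.

End young_theory.

(** * Convolution of an integrable function with functions having bounded derivatives *)

Lemma integrableZl_EFin d (X : measurableType d) (R : realType)
    (mu : {measure set X -> \bar R}) (D : set X) (r : R) (f : X -> R) :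
  measurable D -> mu.-integrable D (EFin \o f) ->
  mu.-integrable D (EFin \o (fun x => r * f x)).
Proof.
move=> mD fi; rewrite (_ : _ \o _ = fun x => (r%:E * (EFin \o f) x)%E) //.
exact: integrableZl.
Qed.

Lemma integrableB_EFin d (X : measurableType d) (R : realType)
    (mu : {measure set X -> \bar R}) (D : set X) (f g : X -> R) :
  measurable D -> mu.-integrable D (EFin \o f) ->
  mu.-integrable D (EFin \o g) ->
  mu.-integrable D (EFin \o (fun x => f x - g x)).
Proof.
move=> mD fi gi; rewrite (_ : _ \o _ = fun x => ((EFin \o f) x - (EFin \o g) x)%E) //.
exact: integrableB.
Qed.

Section bounded_smooth.
Variables (R : realType) (V : normedModType R).
Implicit Types (f g : V -> R) (k : nat).

(** In contrast to [Ck], the function and its iterated directional derivatives are globally bounded: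
    this makes translates integrable against an L^1 function and permits differentiation under the
    integral. *)
Fixpoint BCk k f : Prop :=
  (exists M : R, forall x, `|f x| <= M) /\
  match k with
  | 0 => continuous f
  | k'.+1 => (forall x, differentiable f x) /\ forall v, BCk k' ('D_v f)
  end.

Definition bounded_smooth f := forall k, BCk k f.

Lemma BCk_bounded k f : BCk k f -> exists2 M, 0 <= M & forall x, `|f x| <= M.
Proof.
by case: k => [|k] [[M h] _]; exists M => //; apply: le_trans (h 0).
Qed.

Lemma BCk_continuous k f : BCk k f -> continuous f.
Proof. by case: k => [|k] [_] // [df _] x; exact: differentiable_continuous. Qed.

Lemma BCkW k f : BCk k.+1 f -> BCk k f.
Proof.
elim: k f => [|k ih] f [fb [df Df]]; split => //.
  by move=> x; exact: differentiable_continuous.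
by split => // v; exact: ih.
Qed.

Lemma BCk_Ck k U f : BCk k f -> Ck k U f.
Proof.
elim: k f => [|k ih] f [fb h]; first by move=> /= x _; apply: h.
by case: h => df Df; split=> [x _|v]; [exact: (df x)|exact/ih/Df].
Qed.

Lemma BCkD k f g : BCk k f -> BCk k g -> BCk k (fun x => f x + g x).
Proof.
elim: k f g => [|k ih] f g fk gk;
  have [M M0 hM] := BCk_bounded fk; have [N N0 hN] := BCk_bounded gk.
  split; first by exists (M + N) => x; apply: le_trans (ler_normD _ _) _; apply: lerD.
  by move=> x; apply: cvgD; [exact: (BCk_continuous fk)|exact: (BCk_continuous gk)].
case: fk gk => _ [df Df] [_ [dg Dg]]; split.
  by exists (M + N) => x; apply: le_trans (ler_normD _ _) _; apply: lerD.
split; first by move=> x; exact: differentiableD.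
move=> v; rewrite (_ : 'D_v _ = fun x => 'D_v f x + 'D_v g x).
  by apply: ih; [exact: Df|exact: Dg].
by apply/funext => x; rewrite deriveD//; exact: diff_derivable.
Qed.

Lemma BCkM k f g : BCk k f -> BCk k g -> BCk k (fun x => f x * g x).
Proof.
elim: k f g => [|k ih] f g fk gk.
  have [M M0 hM] := BCk_bounded fk; have [N N0 hN] := BCk_bounded gk.
  split; first by exists (M * N) => x; rewrite normrM ler_pM.
  by move=> x; apply: cvgM; [exact: (BCk_continuous fk)|exact: (BCk_continuous gk)].
have [M M0 hM] := BCk_bounded fk; have [N N0 hN] := BCk_bounded gk.
have fw := BCkW fk; have gw := BCkW gk.
case: fk gk => _ [df Df] [_ [dg Dg]]; split.
  by exists (M * N) => x; rewrite normrM ler_pM.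
split; first by move=> x; exact: differentiableM.
move=> v; rewrite (_ : 'D_v _ = fun x => f x * 'D_v g x + g x * 'D_v f x).
  by apply: BCkD; apply: ih => //; [exact: Dg|exact: Df].
by apply/funext => x; rewrite deriveM//; exact: diff_derivable.
Qed.

Lemma bounded_smooth_cst (c : R) : bounded_smooth (fun=> c).
Proof.
move=> k; elim: k c => [|k ih] c; split; try by exists `|c|.
  by move=> x; exact: cvg_cst.
split=> [x|v]; first exact: differentiable_cst.
rewrite (_ : 'D_v _ = fun=> 0); first exact: ih.
by apply/funext => x; exact: derive_cst.
Qed.

Lemma bounded_smoothM f g : bounded_smooth f -> bounded_smooth g ->
  bounded_smooth (fun x => f x * g x).
Proof. by move=> hf hg k; exact: BCkM. Qed.

Lemma bounded_smooth_prod (I : Type) (s : seq I) (F : I -> V -> R) :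
  (forall i, bounded_smooth (F i)) ->
  bounded_smooth (fun x => \prod_(i <- s) F i x).
Proof.
move=> h; elim: s => [|i s ih].
  rewrite (_ : (fun x => _) = fun=> 1); first exact: bounded_smooth_cst.
  by apply/funext => x; rewrite big_nil.
rewrite (_ : (fun x => _) = fun x => F i x * \prod_(j <- s) F j x).
  exact: bounded_smoothM.
by apply/funext => x; rewrite big_cons.
Qed.

Lemma bounded_smooth_derive f v : bounded_smooth f -> bounded_smooth ('D_v f).
Proof. by move=> h k; have [_ [_]] := h k.+1; exact. Qed.

Lemma bounded_smooth_differentiable f x : bounded_smooth f -> differentiable f x.
Proof. by move=> h; have [_ [+ _]] := h 1%N; exact. Qed.

End bounded_smooth.

Section convolution.
Variables (R : realType) (V : normedModType R).
Variables (I : finType) (b : I -> V) (c : I -> {linear V -> R}).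
Hypothesis c_le : forall i h, `|c i h| <= `|h|.
Hypothesis c_basis : forall h, h = \sum_i c i h *: b i.

Lemma derive_line (f : V -> R) z h (s : R) : differentiable f (z + s *: h) ->
  is_derive s 1 (fun s : R => f (z + s *: h)) ('D_h f (z + s *: h)).
Proof.
move=> df; have df' : derivable f (z + s *: h) h by exact: diff_derivable.
have E : (fun t : R => t^-1 *: (((fun s : R => f (z + s *: h)) \o shift s) (t *: 1)
      - f (z + s *: h))) =
    (fun t => t^-1 *: ((f \o shift (z + s *: h)) (t *: h) - f (z + s *: h))).
  apply/funext => t /=; congr (_ *: (f _ - _)).
  by rewrite [t *: 1]mulr1 scalerDl addrCA.
by split; rewrite /derivable /derive E.
Qed.

Lemma derive_coordE (f : V -> R) z h : differentiable f z ->
  'D_h f z = \sum_i c i h * 'D_(b i) f z.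
Proof.
move=> df; rewrite deriveE// {1}(c_basis h) linear_sum.
by apply: eq_bigr => i _; rewrite linearZ deriveE.
Qed.

Lemma derive_MVT (f : V -> R) z h : (forall x, differentiable f x) ->
  exists2 s : R, 0 <= s <= 1 & f (z + h) - f z = 'D_h f (z + s *: h).
Proof.
move=> df; have der (s : R) := derive_line (df (z + s *: h)).
have cont : {within `[0, 1], continuous (fun s : R => f (z + s *: h))}.
  by apply: derivable_within_continuous => s _; exact: ex_derive.
have [s s01] := MVT ltr01 (fun s _ => der s) cont.
rewrite scale1r scale0r addr0 subr0 mulr1 => fE; exists s => //.
by move: s01; rewrite in_itv/= => /andP[/ltW -> /ltW ->].
Qed.

Lemma BC1_derive_bound (f : V -> R) : BCk 1 f ->
  exists2 M, 0 <= M & forall z h, `|'D_h f z| <= M * `|h|.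
Proof.
move=> [_ [df Df]].
have /choice[M hM] : forall i, exists M : R, 0 <= M /\ forall x, `|'D_(b i) f x| <= M.
  by move=> i; have [M M0 h] := BCk_bounded (Df (b i) : BCk 0 _); exists M.
exists (\sum_i M i); first by apply: sumr_ge0 => i _; exact: (hM i).1.
move=> z h; rewrite derive_coordE// (le_trans (ler_norm_sum _ _ _))// mulr_suml.
apply: ler_sum => i _; rewrite normrM mulrC ler_pM//; exact: (hM i).2.
Qed.

Lemma BC1_lipschitz (f : V -> R) : BCk 1 f ->
  exists2 M, 0 <= M & forall z h, `|f (z + h) - f z| <= M * `|h|.
Proof.
move=> f1; have [M M0 hM] := BC1_derive_bound f1; exists M => // z h.
by have [s _ ->] := derive_MVT z h f1.2.1.
Qed.

(** Along the segment the increment equals ['D_h f] at an intermediate point, and the finitely many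
    coordinate derivatives are Lipschitz. The constant does not depend on z, so the remainder can be
    integrated over translates. *)
Lemma BC2_taylor (f : V -> R) : BCk 2 f ->
  exists2 M, 0 <= M & forall z h, `|f (z + h) - f z - 'D_h f z| <= M * `|h| ^+ 2.
Proof.
move=> [_ [df Df]].
have /choice[M hM] : forall i, exists M : R, 0 <= M /\
    forall z h, `|'D_(b i) f (z + h) - 'D_(b i) f z| <= M * `|h|.
  by move=> i; have [M M0 h] := BC1_lipschitz (Df (b i) : BCk 1 _); exists M.
exists (\sum_i M i); first by apply: sumr_ge0 => i _; exact: (hM i).1.
move=> z h; have [s /andP[s0 s1] ->] := derive_MVT z h df.
rewrite !derive_coordE// -sumrB (le_trans (ler_norm_sum _ _ _))// mulr_suml.
apply: ler_sum => i _; rewrite -mulrBr normrM expr2 mulrA mulrC ler_pM//.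
apply: le_trans ((hM i).2 _ _) _; rewrite normrZ ger0_norm// ler_wpM2l//.
  exact: (hM i).1.
by rewrite ler_piMl.
Qed.

Context d (X : measurableType d) (mu : {measure set X -> \bar R}) (e : X -> V).
Hypothesis e_meas : forall f : V -> R, continuous f ->
  measurable_fun setT (f \o e).
Variable w : X -> R.
Hypothesis w_int : mu.-integrable setT (EFin \o w).

(** [e] sends points of the measure space to vectors; in use it is the identity between the
    measurable and the normed version of space-time. *)
Definition convolve (f : V -> R) (z : V) : R := \int[mu]_y (f (z - e y) * w y).

Lemma convolve_integrable (f : V -> R) z M : continuous f ->
  (forall x, `|f x| <= M) ->
  mu.-integrable setT (fun y => (f (z - e y) * w y)%:E).
Proof.
move=> fc fM; have mw : measurable_fun setT w.
  by apply/measurable_EFinP; case/integrableP : w_int.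
have M0 : 0 <= M by apply: le_trans (fM 0).
have Bf : mu.-integrable setT (fun y => (M%:E * (EFin \o w) y)%E).
  exact: integrableZl.
apply: (le_integrable measurableT _ _ Bf) => [|y _].
  apply/measurable_EFinP/measurable_funM => //.
  apply: (e_meas (f := fun y => f (z - y))) => y.
  apply: (@continuous_comp _ _ _ (fun y => z - y) f); last exact: fc.
  by apply: cvgB; [exact: cvg_cst|exact: cvg_id].
by rewrite /= lee_fin !normrM ler_wpM2r// (ger0_norm M0).
Qed.

Lemma convolve_le (f : V -> R) z M : continuous f -> (forall x, `|f x| <= M) ->
  `|convolve f z| <= M * \int[mu]_y `|w y|.
Proof.
move=> fc fM; have fi := convolve_integrable z fc fM.
apply: le_trans (le_normr_Rintegral measurableT fi) _.
rewrite -RintegralZl//; last exact: integrable_norm.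
apply: le_Rintegral => //; first exact: integrable_norm fi.
- by apply: integrableZl_EFin => //; exact: integrable_norm.
- by move=> y _; rewrite normrM ler_wpM2r.
Qed.

(** Integrating the uniform Taylor remainder against |w| leaves an error of order |h|^2. Hence h |->
    [convolve ('D_h f) z], which is linear and continuous, is the differential; uniqueness
    identifies it with the library's. *)
Lemma convolve_differentiable f z : bounded_smooth f ->
  differentiable (convolve f) z /\
  forall v, 'D_v (convolve f) z = convolve ('D_v f) z.
Proof.
move=> fs; have df x : differentiable f x by exact: bounded_smooth_differentiable.
have Dfs v := bounded_smooth_derive v fs.
have int_ (g : V -> R) x : bounded_smooth g ->
    mu.-integrable setT (EFin \o (fun y => g (x - e y) * w y)).
  move=> gs; have [M _ gM] := BCk_bounded (gs 0%N).
  exact: convolve_integrable (BCk_continuous (gs 0%N)) gM.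
have intD x v := int_ _ x (Dfs v).
have intf x := int_ _ x fs.
have [M M0 hM] := BC1_derive_bound (fs 1%N).
have [N N0 hN] := BC2_taylor (fs 2%N).
pose W := \int[mu]_y `|w y|.
have W0 : 0 <= W by exact: Rintegral_ge0.
pose L h := convolve ('D_h f) z.
have Llin : linear L.
  move=> a u v; rewrite /L -[X in _ = X + _]/(a * _) /convolve.
  rewrite -[X in _ = X + _]RintegralZl//.
  rewrite -RintegralD//; last exact: integrableZl_EFin.
  apply: eq_Rintegral => y _; rewrite !deriveE// linearD linearZ/=.
  by rewrite mulrDl mulrA.
pose L' : {linear V -> R} := HB.pack L (GRing.isLinear.Build _ _ _ _ L Llin).
have LM h : `|L h| <= M * `|h| * W.
  by apply: convolve_le => [|x]; [exact: BCk_continuous (Dfs h 0%N)|exact: hM].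
have MW0 : 0 < M * W + 1 by rewrite ltr_wpDl// mulr_ge0.
have NW0 : 0 < N * W + 1 by rewrite ltr_wpDl// mulr_ge0.
have Lc : continuous L'.
  move=> x; apply/cvgrPdist_le => eps eps0; near=> y.
  rewrite -linearB; apply: le_trans (LM _) _; rewrite mulrAC.
  apply: le_trans (_ : _ <= (M * W + 1) * `|x - y|) _.
    by rewrite ler_wpM2r// lerDl.
  rewrite mulrC -ler_pdivlMr//.
  near: y; apply: cvgr_dist_le; first exact: cvg_id.
  by apply: divr_gt0.
have Lo : convolve f \o shift z = cst (convolve f z) + L' +o_ 0 id.
  apply/eqaddoP => eps eps0; near=> h.
  rewrite /= !fctE /=.
  have -> : convolve f (h + z) - (convolve f z + L h) =
      \int[mu]_y ((f (z - e y + h) - f (z - e y) - 'D_h f (z - e y)) * w y).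
    rewrite opprD addrA /convolve /L /convolve -RintegralB//.
    rewrite -RintegralB//; last exact: integrableB_EFin.
    by apply: eq_Rintegral => y _; rewrite -!mulrBl (addrAC z) (addrC h).
  have ii : mu.-integrable setT (EFin \o (fun y => (f (z - e y + h) - f (z - e y) -
       'D_h f (z - e y)) * w y)).
    rewrite (_ : (fun y => _) = fun y => ((f (z + h - e y) * w y - f (z - e y) * w y) -
      'D_h f (z - e y) * w y)); last first.
      by apply/funext => y; rewrite -!mulrBl (addrAC z).
    apply: integrableB_EFin => //.
    exact: integrableB_EFin.
  apply: le_trans (le_normr_Rintegral measurableT ii) _.
  apply: le_trans (_ : _ <= \int[mu]_y (N * `|h| ^+ 2 * `|w y|)) _.
    apply: le_Rintegral => //.
    - exact: integrable_norm ii.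
    - by apply: integrableZl_EFin => //; exact: integrable_norm.
    - by move=> y _; rewrite normrM ler_wpM2r.
  rewrite RintegralZl//; last exact: integrable_norm.
  rewrite -/W expr2 mulrA mulrAC ler_wpM2r//.
  apply: le_trans (_ : _ <= (N * W + 1) * `|h|) _.
    by rewrite mulrAC ler_wpM2r// lerDl.
  rewrite mulrC -ler_pdivlMr//; near: h.
  have := @nbhs0_le _ V (eps / (N * W + 1)); apply; exact: divr_gt0.
have dE := diff_unique Lc Lo.
have dcf : differentiable (convolve f) z.
  by apply/diff_locallyP; rewrite dE.
by split => // v; rewrite deriveE// dE.
Unshelve. all: by end_near. Qed.

Lemma convolve_smooth f U : bounded_smooth f -> smooth_on U (convolve f).
Proof.
move=> fs k; elim: k f fs => [|k ih] f fs.
  move=> x _; apply: differentiable_continuous.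
  exact: (convolve_differentiable x fs).1.
split => [x _|v]; first exact: (convolve_differentiable x fs).1.
have -> : 'D_v (convolve f) = convolve ('D_v f).
  by apply/funext => z; exact: (convolve_differentiable z fs).2.
exact/ih/bounded_smooth_derive.
Qed.

End convolution.

(** * Smooth bumps and the one-dimensional mollifier *)

Section flat_functions.
Variable R : realType.
Implicit Types (p : {poly R}) (x u : R).

(* The linear span of the functions [x^-j * exp(-1/x)], extended by [0], is
   stable under derivation and consists of bounded functions. *)
Definition flat p x : R := if 0 < x then p.[x^-1] * expR (- x^-1) else 0.

Lemma expX_expRN_bound (j : nat) u : 0 <= u -> u ^+ j * expR (- u) <= j`!%:R.
Proof.
move=> u0; rewrite expRN ler_pdivrMr ?expR_gt0//.
case: j => [|j].
  by rewrite expr0 mul1r; apply: le_trans (expR_ge1Dx u); rewrite lerDl.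
have := expR_ge1Dxn j u0.
move=> h; rewrite mulrC -ler_pdivrMr ?ltr0n ?fact_gt0//.
by apply: le_trans h; rewrite lerDr.
Qed.

Lemma flat_bounded p : exists M, forall x, `|flat p x| <= M.
Proof.
exists (\sum_(i < size p) `|p`_i| * i`!%:R) => x; rewrite /flat; case: ifPn => x0.
  rewrite horner_coef mulr_suml (le_trans (ler_norm_sum _ _ _))//.
  apply: ler_sum => i _; rewrite -mulrA normrM ler_wpM2l//.
  by rewrite ger0_norm ?expX_expRN_bound ?mulr_ge0 ?exprn_ge0 ?expR_ge0 ?invr_ge0 ?ltW.
by rewrite normr0; apply: sumr_ge0 => i _; rewrite mulr_ge0.
Qed.

(** Exhibits vanishing to second order at 0 with a bounded cofactor, whence the derivative at 0 is
    0. *)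
Lemma flatMX2 p x : flat p x = flat (p * 'X^2) x * x ^+ 2.
Proof.
rewrite /flat; case: ifPn => x0; last by rewrite mul0r.
have xn0 : x != 0 by rewrite gt_eqF.
by rewrite hornerM hornerXn (mulrAC p.[_]) -[RHS]mulrA -exprMn mulVf// expr1n mulr1.
Qed.

(** In the variable u = 1/x derivation is -u^2 d/du, and it sends p(u) exp(-u) to u^2 (p - p')(u)
    exp(-u). At x = 0 the difference quotient is a bounded function times h. *)
Lemma is_derive_flat p x :
  is_derive x 1 (flat p) (flat ('X^2 * (p - p^`())) x).
Proof.
have [x0|x0|->] := ltgtP x 0.
- rewrite [X in is_derive _ _ _ X]/flat ltNge (ltW x0)/=.
  apply: (@near_eq_is_derive _ _ _ (cst 0)).
  near=> y; rewrite /flat ltNge ltW//.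
  by near: y; exact: lt_nbhsl.
- rewrite [X in is_derive _ _ _ X]/flat x0.
  have xn0 : x != 0 by rewrite gt_eqF.
  have dV : is_derive x 1 (fun y : R => y^-1) (- x ^- 2).
    have := @is_deriveV R id x 1 1 xn0 (is_derive_id _ _).
    by rewrite [_ *: 1]mulr1.
  have dp : is_derive x 1 (horner p \o (fun y : R => y^-1)) (p^`().[x^-1] * - x ^- 2).
    exact: is_derive1_comp.
  have dN : is_derive x 1 (fun y : R => - y^-1) (x ^- 2).
    by rewrite -[X in is_derive _ _ _ X]opprK; exact: is_deriveN.
  have de : is_derive x 1 (expR \o (fun y : R => - y^-1)) (expR (- x^-1) * x ^- 2).
    exact: is_derive1_comp.
  have dF : is_derive x 1 ((horner p \o (fun y : R => y^-1)) * (expR \o (fun y : R => - y^-1)))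
    (('X^2 * (p - p^`())).[x^-1] * expR (- x^-1)).
    apply: is_derive_eq.
    rewrite -![_ *: _]/(_ * _) /= hornerM hornerXn hornerD hornerN exprVn.
    ring.
  apply: near_eq_is_derive.
  near=> y; rewrite /flat ifT//.
  by near: y; exact: lt_nbhsr.
- rewrite [X in is_derive _ _ _ X]/flat ltxx.
  have [M hM] := flat_bounded (p * 'X^2).
  have M0 : 0 <= M by apply: le_trans (hM 0).
  have M10 : 0 < M + 1 by rewrite ltr_wpDl.
  have c : (fun h => h^-1 *: ((flat p \o shift 0) (h *: 1) - flat p 0)) @ 0^' --> (0 : R).
    apply/cvgrPdist_le => e e0; near=> h.
    rewrite /= addr0 [h *: 1]mulr1 {2}/flat ltxx subr0 sub0r normrN.
    have hn0 : h != 0 by near: h; exact: nbhs_dnbhs_neq.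
    rewrite flatMX2 [h^-1 *: _]mulrCA expr2 mulKf// normrM.
    apply: le_trans (_ : _ <= (M + 1) * `|h|) _.
      by rewrite ler_wpM2r//; apply: le_trans (hM h) _; rewrite lerDl.
    rewrite mulrC -ler_pdivlMr//.
    near: h; apply: dnbhs0_le; exact: divr_gt0.
  apply: DeriveDef; first by apply/cvg_ex; exists 0.
  exact/cvg_lim.
Unshelve. all: by end_near. Qed.

End flat_functions.
Section affine_precomposition.
Variables (R : realType) (V W : normedModType R).

Lemma derive_comp_affine (f : V -> R) (A : W -> V) y u v :
  (forall h : R, A (h *: u + y) = h *: v + A y) ->
  'D_u (f \o A) y = 'D_v f (A y).
Proof. by move=> hA; rewrite /derive; under eq_fun do rewrite /= hA. Qed.

Variables (L : {linear W -> V}) (a : V).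
Hypothesis L_cont : continuous L.

Lemma differentiable_comp_affine (f : V -> R) y : differentiable f (a + L y) ->
  differentiable (fun y => f (a + L y)) y.
Proof.
move=> df; apply: (differentiable_comp (f := fun y => a + L y)) => //.
apply: differentiableD; first exact: differentiable_cst.
exact: linear_differentiable.
Qed.

Lemma derive_comp_linear (f : V -> R) y u :
  'D_u (fun y => f (a + L y)) y = 'D_(L u) f (a + L y).
Proof.
apply: (@derive_comp_affine f (fun y => a + L y)) => h.
by rewrite linearD linearZ addrCA.
Qed.

(** Used to rescale and reflect one-variable bumps, to make them functions of a single space-time
    coordinate, and to restrict space-time kernels to time slices. *)
Lemma bounded_smooth_comp_affine (f : V -> R) : bounded_smooth f ->
  bounded_smooth (fun y => f (a + L y)).
Proof.
move=> fs k; elim: k f fs => [|k ih] f fs.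
  have [M _ hM] := BCk_bounded (fs 0%N); split; first by exists M.
  move=> y; apply: differentiable_continuous.
  exact/differentiable_comp_affine/bounded_smooth_differentiable.
have [M _ hM] := BCk_bounded (fs 0%N); split; first by exists M.
split; first by move=> y; exact/differentiable_comp_affine/bounded_smooth_differentiable.
move=> u; rewrite (_ : 'D_u _ = fun y => 'D_(L u) f (a + L y)).
  by apply: (ih ('D_(L u) f)); exact: bounded_smooth_derive.
by apply/funext => y; exact: derive_comp_linear.
Qed.

End affine_precomposition.

Section flat_bump.
Variable R : realType.

Lemma bounded_smooth_flat (p : {poly R}) : @bounded_smooth R R^o (flat p).
Proof.
move=> k; elim: k p => [|k ih] p; split; try exact: flat_bounded.
  move=> x; apply: differentiable_continuous; apply/derivable1_diffP.
  by have [] := is_derive_flat p x.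
split => [x|v].
  by apply/derivable1_diffP; have [] := is_derive_flat p x.
rewrite (_ : 'D_v _ = fun x => v * flat ('X^2 * (p - p^`())) x).
  apply: BCkM => //; exact: bounded_smooth_cst.
apply/funext => x; have [d1 d2] := is_derive_flat p x.
have df : differentiable (flat p : R^o -> R) x by exact/derivable1_diffP.
by rewrite -d2 !deriveE// -[v in LHS]mulr1 -[_ * 1]/(v *: 1) linearZ.
Qed.

(** On (-1, 1) this is the classical exp(-2 / (1 - s^2)); elsewhere it is 0. *)
Definition bump (s : R) : R := flat 1 (1 + s) * flat 1 (1 - s).

Lemma bump_smooth : @bounded_smooth R R^o bump.
Proof.
apply: bounded_smoothM.
  have := @bounded_smooth_comp_affine R R^o R^o idfun 1 _ _ (bounded_smooth_flat 1).
  by apply => x; exact: cvg_id.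
have := @bounded_smooth_comp_affine R R^o R^o (-%R) 1 _ _ (bounded_smooth_flat 1).
by apply => x; exact: opp_continuous.
Qed.

Lemma flat_ge0 s : 0 <= flat 1 s :> R.
Proof. by rewrite /flat; case: ifP => // _; rewrite hornerC mul1r expR_ge0. Qed.

Lemma bump_ge0 s : 0 <= bump s.
Proof. by rewrite mulr_ge0 ?flat_ge0. Qed.

Lemma bump0 s : 1 <= `|s| -> bump s = 0.
Proof.
rewrite ler_normr => /orP[s1|s1]; rewrite /bump /flat.
  by rewrite [0 < 1 - s]ltNge (_ : 1 - s <= 0) ?mulr0//; lra.
by rewrite [0 < 1 + s]ltNge (_ : 1 + s <= 0) ?mul0r//; lra.
Qed.

Lemma bump_lb : exists2 b : R, 0 < b & forall s, `|s| <= 2^-1 -> b <= bump s.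
Proof.
have h (x : R) : 2^-1 <= x -> expR (- 2) <= flat 1 x.
  move=> x2; have x0 : 0 < x by apply: lt_le_trans x2; rewrite invr_gt0.
  rewrite /flat x0 hornerC mul1r ler_expR lerN2.
  by rewrite -[leRHS]invrK lef_pV2 ?posrE ?invr_gt0.
exists (expR (- 2) * expR (- 2)); first by rewrite mulr_gt0 ?expR_gt0.
move=> s; rewrite ler_norml => /andP[s1 s2]; rewrite ler_pM ?expR_ge0//; apply: h.
  by move: s1; rewrite (_ : 2^-1 = 1/2 :> R); lra.
by move: s2; rewrite (_ : 2^-1 = 1/2 :> R); lra.
Qed.

End flat_bump.

Section one_dimensional_mollifier.
Variable R : realType.
Local Notation mu := (@lebesgue_measure R).
Implicit Types (d s t : R).

Lemma ge0_integral_reflect (f : R -> \bar R) t :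
  measurable_fun (setT : set (measurableTypeR R)) f -> (forall s, 0 <= f s)%E ->
  (\int[mu]_s f (t - s)%R = \int[mu]_s f s)%E.
Proof.
move=> mf f0; pose phi : measurableTypeR R -> measurableTypeR R := fun s => t - s.
have mphi : measurable_fun setT phi by exact: measurable_funB.
transitivity (\int[pushforward mu phi]_s f s)%E.
  by rewrite (@ge0_integral_pushforward _ _ _ _ _ phi mphi mu setT f).
apply: eq_measure_integral => A mA _.
(* Reflection carries a half-open interval to one closed at the other end, of the same length; the
   pushforward is then Lebesgue measure by uniqueness. *)
apply/esym/lebesgue_measure_unique => //= _ [[a b]] _ <-.
rewrite /pushforward (_ : phi @^-1` _ = `[t - b, t - a[%classic).
  rewrite !lebesgue_measure_itv/= !lte_fin.
  rewrite (_ : (t - b < t - a) = (a < b)); last by apply/idP/idP; lra.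
  by case: ifP => // _; rewrite -!EFinB; congr EFin; lra.
apply/seteqP; split => s /=; rewrite !in_itv/= /phi; lra.
Qed.

Lemma measurable_bump d : measurable_fun setT (fun s : measurableTypeR R => bump (s / d)).
Proof.
apply: (@measurableT_comp _ _ _ _ _ _ (@bump R)).
  by apply: continuous_measurable_fun; exact: BCk_continuous (bump_smooth R 0%N).
exact: measurable_funM.
Qed.

Lemma integrable_bump d : 0 < d ->
  mu.-integrable setT (EFin \o (fun s => bump (s / d))).
Proof.
move=> d0; have [M M0 hM] := BCk_bounded (bump_smooth R 0%N).
have ii : mu.-integrable setT (EFin \o (fun s => M * \1_(`[- d, d]%classic) s)).
  apply: integrableZl_EFin => //; exact: integrable_indic_itv.
apply: (le_integrable measurableT _ _ ii).
  by apply/measurable_EFinP; apply: measurable_bump.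
move=> s _; rewrite /= lee_fin [leRHS]normrM (ger0_norm M0) (ger0_norm (x := \1_ _ _))//.
rewrite indicE; case: (boolP (s \in _)) => [|]; first by rewrite mulr1.
move/negP; rewrite inE/= in_itv/= => /negP sd.
rewrite bump0 ?normr0 ?mulr0//.
rewrite normf_div (gtr0_norm d0) ler_pdivlMr// mul1r.
by rewrite leNgt; apply: contra sd => /ltW; rewrite ler_norml.
Qed.

Definition bump_mass d := \int[mu]_s bump (s / d).

(** The rescaled bump is at least b on an interval of length d. This linear lower bound is what
    [mollifier_bounds] takes from the scaling of the mass. *)
Lemma bump_mass_ge : exists2 b : R, 0 < b & forall d, 0 < d -> b * d <= bump_mass d.
Proof.
have [b b0 hb] := bump_lb R; exists b => // d d0.
have ii : mu.-integrable setT (EFin \o (fun s => b * \1_(`[- (d / 2), d / 2]%classic) s)).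
  apply: integrableZl_EFin => //; exact: integrable_indic_itv.
apply: le_trans (_ : _ <= \int[mu]_s (b * \1_(`[- (d / 2), d / 2]%classic) s)) _; last first.
  apply: le_Rintegral => //; first exact: integrable_bump.
  move=> s _; rewrite indicE; case: (boolP (s \in _)); last by rewrite mulr0 bump_ge0.
  rewrite inE/= in_itv/= mulr1 -ler_norml => sd; apply: hb.
  rewrite normf_div (gtr0_norm d0) ler_pdivrMr//.
  by rewrite mulrC.
rewrite RintegralZl//; last exact: integrable_indic_itv.
have E : mu `[- (d / 2), d / 2]%classic = d%:E.
  by rewrite lebesgue_measure_itv/= lte_fin ifT -?EFinB; [congr EFin|]; lra.
by rewrite /Rintegral integral_indic// setIT [X in fine X]E/= lexx.
Qed.

Lemma bump_mass_gt0 d : 0 < d -> 0 < bump_mass d.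
Proof.
by move=> d0; have [b b0 h] := bump_mass_ge; apply: lt_le_trans (h _ d0); rewrite mulr_gt0.
Qed.

Definition mollifier d s := bump (s / d) / bump_mass d.

Lemma mollifier_ge0 d s : 0 < d -> 0 <= mollifier d s.
Proof. by move=> d0; rewrite divr_ge0 ?bump_ge0// ltW ?bump_mass_gt0. Qed.

Lemma mollifier0 d s : 0 < d -> d <= `|s| -> mollifier d s = 0.
Proof.
move=> d0 ds; rewrite /mollifier bump0 ?mul0r// normrM.
by rewrite (ger0_norm (x := d^-1)) ?invr_ge0 ?(ltW d0)// ler_pdivlMr// mul1r.
Qed.

Lemma measurable_mollifier d : measurable_fun setT (mollifier d : measurableTypeR R -> R).
Proof. by apply: measurable_funM => //; exact: measurable_bump. Qed.

Lemma integral_mollifier d t : 0 < d -> (\int[mu]_s (mollifier d (t - s))%:E = 1)%E.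
Proof.
move=> d0; rewrite (@ge0_integral_reflect (EFin \o mollifier d)).
- have -> : (\int[mu]_s (EFin \o mollifier d) s =
      \int[mu]_s ((bump_mass d)^-1%:E * (bump (s / d))%:E))%E.
    by apply: eq_integral => s _; rewrite -EFinM mulrC.
  rewrite integralZl//=; last exact: integrable_bump.
  rewrite -[X in (_ * X)%E]fineK; last exact/integrable_fin_num/integrable_bump.
  by rewrite -EFinM mulVf// gt_eqF// bump_mass_gt0.
- by apply/measurable_EFinP; apply: measurable_mollifier.
- by move=> s; rewrite lee_fin mollifier_ge0.
Qed.

Lemma mollifier_smooth_derive d : @bounded_smooth R R^o (mollifier d) /\
  forall s, 'D_1 (mollifier d : R^o -> R) s =
    'D_1 (@bump R : R^o -> R) (s / d) / d / bump_mass d.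
Proof.
pose L : R^o -> R^o := fun s => s / d.
have Ll : linear L by move=> a u v; rewrite /L mulrDl [RHS]/(_ + _) -mulrA.
pose L' : {linear R^o -> R^o} := HB.pack L (GRing.isLinear.Build _ _ _ _ L Ll).
have Lc : continuous L' by move=> x; apply: cvgMl; exact: cvg_id.
have E : (fun s => @bump R (0 + L' s)) = (fun s => bump (s / d)).
  by apply/funext => s; rewrite add0r.
have bs := @bounded_smooth_comp_affine R R^o R^o L' 0 Lc _ (@bump_smooth R).
rewrite E in bs; split; first by apply: bounded_smoothM => //; exact: bounded_smooth_cst.
move=> s; have -> : mollifier d = (bump_mass d)^-1 *: ((fun s => bump (s / d)) : R^o -> R^o).
  by apply/funext => t; rewrite /mollifier mulrC.
rewrite deriveZ; last exact/diff_derivable/bounded_smooth_differentiable.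
rewrite -E (@derive_comp_linear R R^o R^o L' 0 (@bump R)) add0r.
rewrite [RHS]mulrC -[RHS]/(_ *: _); congr (_ *: _).
have db : differentiable (@bump R : R^o -> R) (s / d).
  exact: bounded_smooth_differentiable (bump_smooth R).
have -> : L' 1 = d^-1 *: 1 by rewrite /= /L mul1r [RHS]mulr1.
by rewrite !deriveE// linearZ mulrC.
Qed.

(* The constant [B] does not depend on the scale. *)
Lemma mollifier_bounds : exists2 B : R, 0 < B & forall d, 0 < d -> forall s,
  mollifier d s <= B / d /\ `|'D_1 (mollifier d : R^o -> R) s| <= B / d ^+ 2.
Proof.
have [b b0 hb] := bump_mass_ge.
have [M M0 hM] := BCk_bounded (bump_smooth R 0%N).
have [N N0 hN] := BCk_bounded (@bounded_smooth_derive R R^o (@bump R) 1 (bump_smooth R) 0%N).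
exists ((M + N + 1) / b); first by rewrite divr_gt0// ltr_wpDl// addr_ge0.
move=> d d0 s.
have mbd : (bump_mass d)^-1 <= (b * d)^-1.
  by rewrite lef_pV2 ?posrE ?bump_mass_gt0 ?mulr_gt0// hb.
have m0 : 0 <= (bump_mass d)^-1 by rewrite invr_ge0 ltW ?bump_mass_gt0.
have main x y : 0 <= x -> x <= M + N + 1 -> 0 <= y -> x * (bump_mass d)^-1 * y <= (M + N + 1) / b / d * y.
  move=> x0 xM y0; rewrite ler_wpM2r// -mulrA -invfM.
  by rewrite ler_pM.
split.
  have := main (bump (s / d)) 1; rewrite !mulr1; apply; rewrite ?bump_ge0//.
  by have := hM (s / d); rewrite ger0_norm ?bump_ge0//; lra.
rewrite (mollifier_smooth_derive d).2 mulrAC.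
have := main `|'D_1 (@bump R : R^o -> R) (s / d)| d^-1.
rewrite normrM normrM (ger0_norm m0) [`|d^-1|]ger0_norm ?invr_ge0 ?(ltW d0)// => h.
apply: le_trans (h _ _ _) _ => //; first by have := hN (s / d); lra.
by rewrite expr2 invfM mulrA.
Qed.

End one_dimensional_mollifier.

(** * Borel sets and coordinates of space-time *)

Section space_time_borel.
Variables (R : realType) (n : nat).
Local Notation V := ('rV[R]_n * R)%type.
Local Notation X := ('rV[R]_n * measurableTypeR R)%type.

Lemma ball_xtP (z y : V) (e : R) : 0 < e ->
  ball z e y <-> (forall i, `|z.1 ord0 i - y.1 ord0 i| < e) /\ `|z.2 - y.2| < e.
Proof.
move=> e0; split=> [[[_ h1] h2]|[h1 h2]]; split => //.
  by move=> i; exact: h1.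
by split => // i j; rewrite (ord1 i); exact: h1.
Qed.

Lemma measurable_xt_coord i : measurable_fun setT (fun z : X => z.1 ord0 i).
Proof. exact: measurableT_comp (measurable_rV_coord i) measurable_fst. Qed.

(** An open set is the union of the rational boxes it contains, and there are countably many. A box
    of half-side d < e / 2 that contains z stays within the ball of radius e around z. *)
Lemma open_measurable_xt (U : set V) : open U -> measurable (U : set X).
Proof.
move=> oU.
pose C (q : 'rV[rat]_n * rat * nat) : set X :=
  [set z : X | (forall i, `|z.1 ord0 i - ratr (q.1.1 ord0 i)| < q.2.+1%:R^-1) /\
               `|z.2 - ratr q.1.2| < q.2.+1%:R^-1].
have mC q : measurable (C q).
  rewrite (_ : C q = (\bigcap_(i in [set: 'I_n])
      ((fun z : X => z.1 ord0 i) @^-1` (ball (ratr (q.1.1 ord0 i) : R) (q.2.+1%:R^-1 : R)))) `&`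
      ((fun z : X => z.2) @^-1` (ball (ratr q.1.2 : R) (q.2.+1%:R^-1 : R)))).
    apply: measurableI.
      apply: fin_bigcap_measurable => // i _; rewrite -[X in measurable X]setTI.
      by apply: measurable_xt_coord => //; exact: measurable_ball.
    by rewrite -[X in measurable X]setTI; apply: measurable_snd => //; exact: measurable_ball.
  apply/seteqP; split => z /=; rewrite /ball/=.
    move=> [h1 h2]; split => [i _|]; rewrite /preimage /ball_/= distrC//.
  by move=> [h1 h2]; split => [i|]; rewrite distrC//; exact: (h1 i).
pose D q := if `[< C q `<=` U >] then C q else set0.
rewrite (_ : (U : set X) = \bigcup_q D q).
  apply: countable_bigcupT_measurable; first exact: countableP.
  by move=> q; rewrite /D; case: ifP.
apply/seteqP; split => z; last first.
  by move=> [q _]; rewrite /D; case: ifP => // /asboolP h /h.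
move=> Uz; have /nbhs_ballP[e /= e0 eU] : nbhs (z : V) U by exact: open_nbhs_nbhs.
have [d [k [dE ke]]] : exists d (k : nat), d = k.+1%:R^-1 :> R /\ d < e / 2.
  have e20 : 0 < e / 2 by rewrite divr_gt0.
  exists (Num.trunc (e / 2)^-1).+1%:R^-1, (Num.trunc (e / 2)^-1); split => //.
  by rewrite invf_plt ?posrE// truncnS_gt.
have k0 : 0 < d by rewrite dE invr_gt0.
have ratl (x : R) : exists q : rat, `|x - ratr q| < d.
  have xk : x - d < x + d by move: k0; lra.
  have [q] := rat_in_itvoo xk.
  rewrite in_itv/= => /andP[q1 q2]; exists q.
  by rewrite ltr_norml; apply/andP; split; lra.
have [Q hQ] := choice (fun i => ratl (z.1 ord0 i)).
have [q hq] := ratl z.2.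
exists (\row_i Q i, q, k) => //; rewrite /D ifT.
  by rewrite /C /= -dE; split => //= i; rewrite mxE.
apply/asboolP => y [/=]; rewrite -dE => hy1 hy2; apply: eU; apply/ball_xtP => //; split.
  move=> i; have := hy1 i; rewrite mxE distrC => {}hy1.
  by have := ler_distD (ratr (Q i)) (z.1 ord0 i) (y.1 ord0 i); have := hQ i; lra.
rewrite distrC in hy2.
by have := ler_distD (ratr q) z.2 y.2; lra.
Qed.

Lemma within_continuous_measurable_xt (U : set V) (f : V -> R) : open U ->
  {within U, continuous f} -> measurable_fun (U : set X) (f : X -> R).
Proof.
move=> oU; rewrite continuous_open_subspace// => fc.
apply: (measurability _ (RGenOpens.measurableE R)).
move=> _ [_ [a [b ->] <-]]; apply: open_measurable_xt.
rewrite openE => z [Uz fz]; apply: filterI; first exact: open_nbhs_nbhs.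
apply: (fc z (mem_set Uz)); apply: open_nbhs_nbhs; split => //.
Qed.

Lemma continuous_measurable_xt (f : V -> R) : continuous f ->
  measurable_fun setT (f : X -> R).
Proof.
move=> fc; apply: (@within_continuous_measurable_xt setT f openT).
exact: continuous_subspaceT.
Qed.

(** The nontrivial inclusion holds because the coordinates, being continuous, are measurable for the
    sigma-algebra of the open sets. Open sets can then serve as the generating pi-system of the
    abstract convergence result. *)
Lemma measurable_xtE : @measurable _ X = <<s (open : set (set V)) >>.
Proof.
apply/seteqP; split; last first.
  by apply: smallest_sub; [exact: sigma_algebra_measurable|exact: open_measurable_xt].
pose Y := g_sigma_algebraType (open : set (set V)).
have openY (f : V -> R) : continuous f -> measurable_fun setT (f : Y -> R).
  move=> fc; apply: (measurability _ (RGenOpens.measurableE R)).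
  move=> _ [_ [a [b ->] <-]]; rewrite setTI; apply: sub_sigma_algebra.
  by apply: open_comp => [x _|]; [exact: fc|exact: interval_open].
have mid : measurable_fun setT (fun z : Y => (z : X)).
  rewrite (_ : (fun z : Y => _) = (fun z : Y => ((z : X).1, (z : X).2))); last first.
    by apply/funext => -[].
  apply/measurable_fun_pair.
    apply: measurable_fun_rVP => i; apply: openY => z.
    apply: (@continuous_comp _ _ _ fst (fun v : 'rV[R]_n => v ord0 i)).
      exact: cvg_fst.
    exact: coord_continuous.
  by apply: openY => z; exact: cvg_snd.
by move=> A mA; have := mid measurableT A mA; rewrite setTI.
Qed.

Lemma open_measurable_rV (U : set 'rV[R]_n) : open U -> measurable U.
Proof.
move=> oU; have : measurable ((U `*` setT) : set X).
  apply: open_measurable_xt; rewrite (_ : _ `*` _ = fst @^-1` U).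
    by apply: open_comp => // z _; exact: cvg_fst.
  by apply/seteqP; split => z /=; [case|].
move=> /(measurable_ysection (0 : measurableTypeR R)); rewrite ysectionE.
by rewrite (_ : _ @^-1` _ = U)//; apply/seteqP; split => x /=; [case|].
Qed.

End space_time_borel.

Section space_time_coordinates.
Variables (R : realType) (n : nat).
Local Notation V := ('rV[R]_n * R)%type.

(** [None] is time and [Some j] a space direction; with [xt_basis] this instantiates the abstract
    coordinates of the convolution section. *)
Definition xt_coord (i : option 'I_n) (h : V) : R^o :=
  if i is Some j then h.1 ord0 j else h.2.

Lemma xt_coord_linear i : linear (xt_coord i).
Proof. by case: i => [i|] a u v //=; rewrite !mxE. Qed.

HB.instance Definition _ i :=
  GRing.isLinear.Build R V R^o _ (xt_coord i) (xt_coord_linear i).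

Definition xt_basis (i : option 'I_n) : V :=
  if i is Some j then (delta_mx ord0 j, 0) else (0, 1).

Lemma xt_coord_le i (h : V) : `|xt_coord i h| <= `|h|.
Proof.
rewrite prod_normE le_max; case: i => [i|] /=; last by rewrite lexx orbT.
rewrite [X in _ <= X]/Num.norm/= mx_normrE; apply/orP; left.
by apply/bigmax_geP; right; exists (ord0, i).
Qed.

Lemma xt_coord_continuous i : continuous (xt_coord i).
Proof.
move=> x; apply/cvgrPdist_le => e e0; near=> y.
rewrite -linearB; apply: le_trans (xt_coord_le _ _) _.
by near: y; apply: cvgr_dist_le => //; exact: cvg_id.
Unshelve. all: by end_near. Qed.

Lemma xt_coord_basis (h : V) : h = \sum_i xt_coord i h *: xt_basis i.
Proof.
rewrite (bigD1 None)//= (reindex_omap (@Some _) id)/=; last by case.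
rewrite [X in _ + X](_ : _ = (h.1, 0)).
  case: h => x t /=; congr pair.
    by change (x = t *: 0 + x); rewrite scaler0 add0r.
  by change (t = t * 1 + 0); rewrite addr0 mulr1.
under eq_bigl do rewrite eqxx.
have E (s : seq 'I_n) : \sum_(i <- s) h.1 ord0 i *: ((delta_mx ord0 i, 0) : V) =
    (\sum_(i <- s) h.1 ord0 i *: delta_mx ord0 i, 0).
  elim: s => [|i s ih]; first by rewrite !big_nil.
  rewrite !big_cons ih; congr pair.
  by change (h.1 ord0 i *: (0 : R) + 0 = 0); rewrite scaler0 addr0.
by rewrite E -row_sum_delta.
Qed.

End space_time_coordinates.

(** * The space-time mollifier as a product of one-dimensional ones *)

Section space_time_mollifier.
Variables (R : realType) (n : nat).
Local Notation V := ('rV[R]_n * R)%type.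
Local Notation X := ('rV[R]_n * measurableTypeR R)%type.
Local Notation leb := (@lebesgue_measure R).

Lemma ge0_integral_rV_cons (f : 'rV[R]_n.+1 -> \bar R) :
  measurable_fun setT f -> (forall v, 0 <= f v)%E ->
  (\int[lebesgue_rV R n.+1]_v f v =
   \int[leb]_x \int[lebesgue_rV R n]_v f (rV_cons (x, v)))%E.
Proof.
move=> mf f0; pose phi := @rV_cons R n; have mphi := @measurable_rV_cons R n.
have mfp : measurable_fun setT (f \o phi) by exact: measurableT_comp.
rewrite -(@fubini_tonelli1 _ _ _ _ _ leb (lebesgue_rV R n) (f \o phi))//.
transitivity (\int[pushforward (leb \x lebesgue_rV R n) phi]_v f v)%E => //.
by rewrite (@ge0_integral_pushforward _ _ _ _ _ phi mphi).
by move=> x; exact: f0.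
Qed.

End space_time_mollifier.

Section space_time_mollifier2.
Variable (R : realType).
Local Notation leb := (@lebesgue_measure R).

Lemma measurable_prod_rV n (F : 'I_n -> R -> R) :
  (forall i, measurable_fun setT (F i : measurableTypeR R -> R)) ->
  measurable_fun setT (fun v : 'rV[R]_n => \prod_i F i (v ord0 i)).
Proof.
move=> mF; apply: measurable_prod => i _.
exact: measurableT_comp (mF i) (measurable_rV_coord i).
Qed.

Lemma integral_prod_rV n (F : 'I_n -> R -> R) :
  (forall i, measurable_fun setT (F i : measurableTypeR R -> R)) ->
  (forall i x, 0 <= F i x) ->
  (forall i, \int[leb]_x (F i x)%:E = 1)%E ->
  (\int[lebesgue_rV R n]_v (\prod_i F i (v ord0 i))%:E = 1)%E.
Proof.
elim: n F => [|n ih] F mF F0 F1.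
  under eq_integral do rewrite big_ord0.
  by rewrite integral_cst//= mul1e diracT.
rewrite ge0_integral_rV_cons; last 2 first.
- by apply/measurable_EFinP; exact: measurable_prod_rV.
- by move=> v; rewrite lee_fin; apply: prodr_ge0 => i _.
transitivity (\int[leb]_x (F ord0 x)%:E)%E => //.
apply: eq_integral => x _.
transitivity (\int[lebesgue_rV R n]_v ((F ord0 x)%:E *
   (\prod_i F (lift ord0 i) (v ord0 i))%:E))%E.
  apply: eq_integral => v _; rewrite -EFinM big_ord_recl; congr (_ * _)%:E.
    by rewrite /rV_cons mxE unlift_none.
  by apply: eq_bigr => i _; rewrite /rV_cons mxE liftK.
rewrite ge0_integralZl//=.
- by rewrite (ih (fun i => F (lift ord0 i))) ?mule1.
- by apply/measurable_EFinP; apply: (@measurable_prod_rV n (fun i => F (lift ord0 i))).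
- by move=> v _; rewrite lee_fin; apply: prodr_ge0 => i _.
- by rewrite lee_fin.
Qed.

Variable n : nat.
Local Notation V := ('rV[R]_n * R)%type.
Local Notation X := ('rV[R]_n * measurableTypeR R)%type.

Definition xt_box (z : V) (d t : R) : set X :=
  [set y : X | (forall i, `|z.1 ord0 i - y.1 ord0 i| < d) /\ `|z.2 - y.2| < t].

Lemma measurable_rV_box (z : 'rV[R]_n) (d : R) :
  measurable [set v : 'rV[R]_n | forall i, ball (z ord0 i) d (v ord0 i)].
Proof.
rewrite (_ : [set _ | _] =
    \bigcap_(i in [set: 'I_n]) (@rV_coord R n i @^-1` ball (z ord0 i) d)).
  apply: fin_bigcap_measurable => // i _; rewrite -[X in measurable X]setTI.
  by apply: measurable_rV_coord => //; exact: measurable_ball.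
by apply/seteqP; split => v /= h i; [move=> _; exact: h|exact: (h i I)].
Qed.

Lemma xt_boxE z d t : xt_box z d t =
  [set v : 'rV[R]_n | forall i, ball (z.1 ord0 i) d (v ord0 i)] `*` ball z.2 t.
Proof. by []. Qed.

Lemma measurable_xt_box z d t : measurable (xt_box z d t).
Proof.
rewrite xt_boxE; apply: measurableX; first exact: measurable_rV_box.
exact: measurable_ball.
Qed.

Lemma lebesgue_rV_ball (z : 'rV[R]_n) (d : R) : 0 <= d ->
  lebesgue_rV R n [set v | forall i, ball (z ord0 i) d (v ord0 i)] =
  ((2 * d) ^+ n)%:E.
Proof.
move=> d0; rewrite (@lebesgue_rV_box R n (fun i => ball (z ord0 i) d)); last first.
  by move=> i; exact: measurable_ball.
under eq_bigr do rewrite lebesgue_measure_ball//.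
by rewrite prodEFin prodr_const card_ord mulr_natl.
Qed.

Lemma lebesgue_xt_box z d t : 0 <= d -> 0 <= t ->
  lebesgue_xt R n (xt_box z d t) = ((2 * d) ^+ n * (2 * t))%:E.
Proof.
move=> d0 t0; rewrite xt_boxE /lebesgue_xt product_measure1E//; last 2 first.
- exact: measurable_rV_box.
- exact: measurable_ball.
rewrite EFinM; congr (_ * _)%E; first exact: lebesgue_rV_ball.
by rewrite [LHS]lebesgue_measure_ball// mulr_natl.
Qed.

Let lebesgue_xt_sigma_finite : sigma_finite setT (lebesgue_xt R n).
Proof.
exists (fun k => xt_box 0 k.+1%:R k.+1%:R).
  apply/seteqP; split => // z _.
  pose M := \sum_i `|z.1 ord0 i| + `|z.2|.
  have [k Mk] : exists k : nat, M < k.+1%:R by exists (Num.trunc M); exact: truncnS_gt.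
  exists k => //; rewrite /xt_box/= sub0r normrN; split; last first.
    by apply: le_lt_trans Mk; rewrite lerDr sumr_ge0.
  move=> i; rewrite mxE sub0r normrN; apply: le_lt_trans Mk.
  by rewrite /M (bigD1 i)//= -addrA lerDl addr_ge0// sumr_ge0.
move=> k; split; first exact: measurable_xt_box.
by rewrite lebesgue_xt_box// ltry.
Qed.

HB.instance Definition _ := Measure_isSigmaFinite.Build _ _ _ (lebesgue_xt R n)
  lebesgue_xt_sigma_finite.

Variables d t : R.
Hypotheses (d0 : 0 < d) (t0 : 0 < t).

(** The product form reduces mass, support and derivative bounds to one variable, and leaves the
    widths in space and time independent, as parabolic scaling demands. *)
Definition xt_mollifier (z : V) : R :=
  (\prod_i mollifier d (z.1 ord0 i)) * mollifier t z.2.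

Lemma xt_mollifier_ge0 z : 0 <= xt_mollifier z.
Proof.
by rewrite mulr_ge0 ?mollifier_ge0// prodr_ge0// => i _; rewrite mollifier_ge0.
Qed.

Lemma xt_mollifier_supp z : xt_mollifier z != 0 ->
  (forall i, `|z.1 ord0 i| < d) /\ `|z.2| < t.
Proof.
rewrite mulf_eq0 negb_or => /andP[/prodf_neq0 h1 h2]; split.
  move=> i; have := h1 i isT; apply: contraNT; rewrite -leNgt => h.
  by rewrite mollifier0.
by move: h2; apply: contraNT; rewrite -leNgt => h; rewrite mollifier0.
Qed.

Lemma integral_xt_mollifier z :
  (\int[lebesgue_xt R n]_y (xt_mollifier (z - y))%:E = 1)%E.
Proof.
have mm (s : R) (e : R) : measurable_fun setT (fun x : measurableTypeR R => mollifier e (s - x)).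
  apply: (@measurableT_comp _ _ _ _ _ _ (mollifier e)).
    exact: measurable_mollifier.
  by apply: measurable_funB.
rewrite [LHS](@fubini_tonelli1 _ _ _ _ _ (lebesgue_rV R n) leb
  (fun y : X => (xt_mollifier (z - y))%:E)); last 2 first.
- apply/measurable_EFinP; apply: measurable_funM.
    apply: measurable_prod => i _.
    under eq_fun do rewrite !mxE.
    exact: (measurableT_comp (mm (z.1 ord0 i) d) (measurable_xt_coord i)).
  exact: (measurableT_comp (mm z.2 t) measurable_snd).
- by move=> y; rewrite lee_fin xt_mollifier_ge0.
rewrite /fubini_F.
transitivity (\int[lebesgue_rV R n]_x (\prod_i mollifier d (z.1 ord0 i - x ord0 i))%:E)%E.
  apply: eq_integral => x _ /=.
  transitivity (\int[leb]_y ((\prod_i mollifier d (z.1 ord0 i - x ord0 i))%:E *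
      (mollifier t (z.2 - y))%:E))%E.
    apply: eq_integral => y _; rewrite -EFinM /xt_mollifier; congr (_ * _)%:E.
    by apply: eq_bigr => i _; rewrite !mxE.
  rewrite ge0_integralZl//=.
  - by rewrite integral_mollifier// mule1.
  - exact/measurable_EFinP.
  - by move=> y _; rewrite lee_fin mollifier_ge0.
  - by rewrite lee_fin prodr_ge0// => i _; rewrite mollifier_ge0.
rewrite (@integral_prod_rV n (fun i x => mollifier d (z.1 ord0 i - x)))//.
- by move=> i x; rewrite mollifier_ge0.
- by move=> i; rewrite integral_mollifier.
Qed.

Lemma xt_mollifierN z : xt_mollifier (- z) = xt_mollifier z.
Proof.
have bN (s : R) : bump (- s) = bump s by rewrite /bump opprK mulrC.
have mN e (s : R) : mollifier e (- s) = mollifier e s.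
  by rewrite /mollifier mulNr bN.
rewrite /xt_mollifier mN; congr (_ * _).
by apply: eq_bigr => i _; rewrite !mxE mN.
Qed.

Lemma xt_mollifier_smooth : bounded_smooth xt_mollifier.
Proof.
have E i e : bounded_smooth (fun z : V => mollifier e (xt_coord i z)).
  have := bounded_smooth_comp_affine (0 : R^o) (@xt_coord_continuous R n i)
    (mollifier_smooth_derive e).1.
  by under [X in bounded_smooth X -> _]eq_fun do rewrite add0r.
apply: bounded_smoothM; last exact: (E None).
by apply: bounded_smooth_prod => i; exact: (E (Some i)).
Qed.

End space_time_mollifier2.

Section derive_facts.
Variables (R : realType) (V : normedModType R).

(** A zero of a nonnegative function is a minimum along every line. It follows that the derivative
    of a mollifier vanishes wherever the mollifier does, so support statements pass to
    derivatives. *)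
Lemma derive_at_zero_min (f : V -> R) z v : (forall x, differentiable f x) ->
  (forall x, 0 <= f x) -> f z = 0 -> 'D_v f z = 0.
Proof.
move=> df f0 fz; pose g (s : R) := f (z + s *: v).
have dg (s : R) : is_derive s (1 : R) g ('D_v f (z + s *: v)) by exact: derive_line.
have : is_derive (0 : R) (1 : R) g 0.
  apply: (@derive1_at_min R g (-1) 1 0).
  - lra.
  - by move=> s _; have [] := dg s.
  - by rewrite in_itv/= oppr_lt0 ltr01.
  - by move=> s _; rewrite /g scale0r addr0 fz.
move=> [_ e0]; have [_ e1] := dg 0.
by rewrite -e0 e1 scale0r addr0.
Qed.

Lemma derive_constant_line (f : V -> R) z v :
  (forall h : R, f (h *: v + z) = f z) -> 'D_v f z = 0.
Proof.
move=> hf; rewrite /derive; under eq_fun do rewrite /= hf subrr scaler0.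
exact: lim_cst.
Qed.

End derive_facts.

Section space_time_mollifier_bounds.
Variables (R : realType) (n : nat).
Local Notation V := ('rV[R]_n * R)%type.

Lemma xt_mollifier_bounds : exists2 B : R, 0 < B &
  forall d t, 0 < d -> 0 < t -> forall z : V,
  xt_mollifier d t z <= (B / d) ^+ n * (B / t) /\
  forall i : 'I_n, `|'D_(xt_basis R (Some i)) (xt_mollifier d t) z| <=
    (B / d) ^+ n * (B / t) / d.
Proof.
have [B B0 hB] := mollifier_bounds R; exists B => // d t d0 t0 z.
have prodB (P : pred 'I_n) : \prod_(j | P j) mollifier d (z.1 ord0 j) <= \prod_(j | P j) (B / d).
  by apply: ler_prod => j _; rewrite mollifier_ge0//= (hB d d0 _).1.
have Bd0 : 0 < B / d by rewrite divr_gt0.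
split.
  apply: ler_pM; rewrite ?mollifier_ge0//.
  - by apply: prodr_ge0 => j _; rewrite mollifier_ge0.
  - by apply: le_trans (prodB xpredT) _; rewrite prodr_const card_ord.
  - exact: (hB t t0 _).1.
move=> i; pose v := xt_basis R (Some i).
(* The kernel is split into its i-th factor [F] and the product [H] of the others, which is constant
   in direction i. Differentiating therefore replaces one bound B / d by B / d^2. *)
pose F (z : V) := mollifier d (xt_coord (Some i) z).
pose H (z : V) := (\prod_(j | j != i) mollifier d (z.1 ord0 j)) * mollifier t z.2.
have E x b : bounded_smooth (fun z : V => mollifier b (xt_coord x z)).
  have := bounded_smooth_comp_affine (0 : R^o) (@xt_coord_continuous R n x)
    (mollifier_smooth_derive b).1.
  by under [X in bounded_smooth X -> _]eq_fun do rewrite add0r.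
have Hs : bounded_smooth H.
  apply: bounded_smoothM; last exact: (E None).
  rewrite (_ : (fun _ => _) = fun x : V => \prod_(j <- [seq j <- index_enum 'I_n | j != i])
     mollifier d (x.1 ord0 j)).
    by apply: bounded_smooth_prod => j; exact: (E (Some j)).
  by apply/funext => x; rewrite big_filter.
have DH : 'D_v H z = 0.
  apply: derive_constant_line => h; rewrite /H; congr (_ * mollifier _ _); last first.
    by change (h * 0 + z.2 = z.2); rewrite mulr0 add0r.
  apply: eq_bigr => j ji; congr (mollifier _ _).
  change ((h *: delta_mx ord0 i + z.1) ord0 j = z.1 ord0 j).
  by rewrite !mxE (negbTE ji) andbF mulr0 add0r.
have DF : 'D_v F z = 'D_1 (mollifier d : R^o -> R) (z.1 ord0 i).
  have -> : F = (fun z => mollifier d (0 + xt_coord (Some i) z)).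
    by apply/funext => x; rewrite add0r.
  rewrite (@derive_comp_linear R R^o _ (@xt_coord R n (Some i)) 0 (mollifier d)).
  rewrite add0r; congr (derive _ _ _).
  by rewrite /xt_coord/= mxE !eqxx.
rewrite (_ : xt_mollifier d t = F * H); last first.
  apply/funext => x; rewrite /xt_mollifier (bigD1 i)//= -mulrA.
  by [].
rewrite deriveM; last 2 first.
- exact/diff_derivable/bounded_smooth_differentiable/(E (Some i)).
- exact/diff_derivable/bounded_smooth_differentiable.
rewrite DH scaler0 add0r DF -[_ *: _]/(_ * _) normrM.
have H0 : 0 <= H z.
  by rewrite mulr_ge0 ?mollifier_ge0// prodr_ge0// => j _; rewrite mollifier_ge0.
rewrite (ger0_norm H0).
have HB : H z <= \prod_(j | j != i) (B / d) * (B / t).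
  apply: ler_pM; rewrite ?mollifier_ge0//; last exact: (hB t t0 _).1.
  by apply: prodr_ge0 => j _; rewrite mollifier_ge0.
apply: le_trans (_ : _ <= (\prod_(j | j != i) (B / d) * (B / t)) * (B / d ^+ 2)) _.
  by apply: ler_pM => //; exact: (hB d d0 _).2.
rewrite (_ : (B / d) ^+ n = B / d * \prod_(j < n | j != i) (B / d)); last first.
  by rewrite -[in LHS](card_ord n) -prodr_const (bigD1 i).
by rewrite le_eqVlt; apply/orP; left; apply/eqP; field; rewrite !gt_eqF.
Qed.

End space_time_mollifier_bounds.

(** * Time slices of translated kernels as test functions *)

Section test_functions.
Variables (R : realType) (n : nat).
Local Notation V := ('rV[R]_n * R)%type.
Variables (f : V -> R) (z : V) (s : R).

Let L (y : 'rV[R]_n) : V := (- y, 0).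

Let L_linear : linear L.
Proof.
move=> a u v; rewrite /L opprD -scalerN; congr pair.
by change (0 = a * 0 + 0 :> R); rewrite mulr0 addr0.
Qed.

HB.instance Definition _ := GRing.isLinear.Build R 'rV[R]_n V _ L L_linear.

Let L_cont : continuous L.
Proof.
move=> x; apply: ((@cvgrPdist_le R V _ (nbhs x) _ L (L x)).2) => e e0; near=> y.
rewrite -linearB prod_normE /= normrN normr0 max_l//.
Unshelve. all: by end_near.
Qed.

Let LE y : z - (y, s) = (z.1, z.2 - s) + L y.
Proof. by rewrite /L; case: z => x t; congr pair; rewrite //= addr0. Qed.

Lemma section_smooth : bounded_smooth f -> smooth_on setT (fun y => f (z - (y, s))).
Proof.
move=> fs k; apply: BCk_Ck; under eq_fun do rewrite LE.
exact: (bounded_smooth_comp_affine _ L_cont).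
Qed.

Lemma derive_section i y : bounded_smooth f ->
  'D_(delta_mx ord0 i) (fun y => f (z - (y, s))) y =
  - 'D_(xt_basis R (Some i)) f (z - (y, s)).
Proof.
move=> fs.
have -> : (fun y => f (z - (y, s))) = (fun y => f ((z.1, z.2 - s) + L y)).
  by apply/funext => x; rewrite LE.
rewrite (@derive_comp_linear R V 'rV[R]_n L) -LE.
transitivity ('D_(- xt_basis R (Some i)) f (z - (y, s))).
  congr (derive _ _ _); rewrite /= /L /xt_basis; congr pair.
  by change (0 = - 0 :> R); rewrite oppr0.
have df := bounded_smooth_differentiable (z - (y, s)) fs.
by rewrite !deriveE// linearN.
Qed.

(** The support of the slice lies in the closed box of half-side d around the space part of z, which
    is compact and contained in Om by assumption. *)
Lemma section_test_function (Om : set 'rV[R]_n) (d : R) : bounded_smooth f ->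
  (forall x, f x != 0 -> forall i, `|x.1 ord0 i| <= d) ->
  (forall y : 'rV[R]_n, (forall i, `|z.1 ord0 i - y ord0 i| <= d) -> Om y) ->
  test_function Om (fun y => f (z - (y, s))).
Proof.
move=> fs fd zd; pose K := [set y : 'rV[R]_n | forall i, `|z.1 ord0 i - y ord0 i| <= d].
have Kc : compact K.
  have := @rV_compact R n (fun i => `[z.1 ord0 i - d, z.1 ord0 i + d]%classic)
    (fun i => @segment_compact R _ _).
  congr compact; apply/seteqP; split => y /= h i; have := h i.
    by rewrite in_itv/= ler_norml => /andP[? ?]; apply/andP; split; lra.
  by rewrite in_itv/= ler_norml => /andP[? ?]; apply/andP; split; lra.
have suppK : closure [set y : 'rV[R]_n | f (z - (y, s)) != 0] `<=` K.
  rewrite [X in _ `<=` X](_ : K = closure K); last first.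
    by apply/closure_id; apply: compact_closed => //; apply: norm_hausdorff.
  apply: closure_subset => y /fd h i; have := h i.
  by rewrite /= !mxE.
split; [exact: section_smooth| |by move=> y /suppK /zd].
by apply: subclosed_compact Kc suppK; exact: closed_closure.
Qed.

End test_functions.

(** * The Euclidean norm and Jensen's inequality for vector averages *)

Section euclidean_norm.
Variables (R : realType) (n : nat).
Implicit Types u v : 'rV[R]_n.

Lemma enorm_ge0 v : 0 <= enorm v.
Proof. exact: sqrtr_ge0. Qed.

Lemma enorm_sqr v : enorm v ^+ 2 = \sum_i v ord0 i ^+ 2.
Proof. by rewrite sqr_sqrtr// sumr_ge0// => i _; rewrite sqr_ge0. Qed.

Lemma coord_le_enorm v i : `|v ord0 i| <= enorm v.
Proof.
rewrite -ler_sqr ?nnegrE ?enorm_ge0// enorm_sqr real_normK ?num_real//.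
by rewrite (bigD1 i)//= lerDl sumr_ge0// => j _; rewrite sqr_ge0.
Qed.

Lemma enorm_le_sum v : enorm v <= \sum_i `|v ord0 i|.
Proof.
have S0 : 0 <= \sum_i `|v ord0 i| by apply: sumr_ge0.
rewrite -ler_sqr ?nnegrE ?enorm_ge0// enorm_sqr expr2 mulr_suml.
apply: ler_sum => i _; rewrite -[v ord0 i ^+ 2]real_normK ?num_real// expr2.
by rewrite ler_wpM2l// (bigD1 i)//= lerDl sumr_ge0.
Qed.

(** Cauchy-Schwarz against a unit vector, obtained by summing the coordinatewise bound ab <= (a^2
    |v| + b^2 / |v|) / 2. *)
Lemma enorm_dot (e v : 'rV[R]_n) : \sum_i e ord0 i ^+ 2 = 1 ->
  \sum_i e ord0 i * v ord0 i <= enorm v.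
Proof.
move=> e1; have := enorm_ge0 v; rewrite le_eqVlt => /predU1P[v0|v0].
  rewrite -v0 big1// => i _; have := coord_le_enorm v i.
  by rewrite -v0 normr_le0 => /eqP ->; rewrite mulr0.
apply: le_trans (_ : _ <= \sum_i ((e ord0 i ^+ 2 * enorm v + v ord0 i ^+ 2 / enorm v) / 2)) _.
  apply: ler_sum => i _; set a := e ord0 i; set b := v ord0 i.
  rewrite -subr_ge0 (_ : _ - _ = (a * enorm v - b) ^+ 2 / (2 * enorm v)).
    by rewrite divr_ge0 ?sqr_ge0// mulr_ge0// ltW.
  by field; rewrite gt_eqF.
rewrite -mulr_suml big_split/= -!mulr_suml e1 -enorm_sqr expr2 mulfK ?gt_eqF//.
by rewrite mul1r; lra.
Qed.

Lemma enormD u v : enorm (u + v) <= enorm u + enorm v.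
Proof.
have := enorm_ge0 (u + v); rewrite le_eqVlt => /predU1P[<-|uv0].
  by rewrite addr_ge0 ?enorm_ge0.
pose e := (enorm (u + v))^-1 *: (u + v).
have e1 : \sum_i e ord0 i ^+ 2 = 1.
  under eq_bigr do rewrite mxE exprMn.
  by rewrite -mulr_sumr -enorm_sqr -exprMn mulVf ?expr1n// gt_eqF.
have := lerD (enorm_dot u e1) (enorm_dot v e1); rewrite -big_split/=.
apply: le_trans; under eq_bigr do rewrite -mulrDr.
rewrite (_ : \sum_i _ = (enorm (u + v))^-1 * enorm (u + v) ^+ 2).
  by rewrite expr2 mulKf// gt_eqF.
rewrite enorm_sqr mulr_sumr; apply: eq_bigr => i _.
by rewrite !mxE -mulrA expr2.
Qed.

Lemma enormN v : enorm (- v) = enorm v.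
Proof. by rewrite /enorm; under eq_bigr do rewrite mxE sqrrN. Qed.

Lemma enorm_dist u v : `|enorm u - enorm v| <= \sum_i `|u ord0 i - v ord0 i|.
Proof.
apply: le_trans (_ : _ <= enorm (u - v)) _; last first.
  by apply: le_trans (enorm_le_sum _) _; apply: ler_sum => i _; rewrite !mxE.
have h1 := enormD (u - v) v; have h2 := enormD (v - u) u.
rewrite subrK in h1; rewrite subrK -opprB enormN in h2.
by rewrite ler_norml; apply/andP; split; lra.
Qed.

Lemma enorm_small (v : 'rV[R]_n) (r : R) : (0 < n)%N -> 0 <= r ->
  (forall i, `|v ord0 i| <= r / n%:R) -> enorm v <= r.
Proof.
move=> n0 r0 h; apply: le_trans (enorm_le_sum v) _.
apply: le_trans (_ : _ <= \sum_(i < n) (r / n%:R)) _; first exact: ler_sum.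
by rewrite sumr_const card_ord -[leLHS]mulr_natr divfK// pnatr_eq0 -lt0n.
Qed.

Lemma measurable_enorm d (T : measurableType d) (D : set T) (f : T -> 'rV[R]_n) :
  measurable D -> measurable_fun D f -> measurable_fun D (fun x => enorm (f x)).
Proof.
move=> mD mf.
have : measurable_fun setT (@enorm R n).
  apply: (@measurableT_comp _ _ _ _ _ _ (@Num.sqrt R)).
    apply: continuous_measurable_fun; exact: sqrt_continuous.
  apply: measurable_sum => i; apply: measurable_funX.
  exact: measurable_rV_coord.
by move=> me; exact: (measurableT_comp me mf).
Qed.

End euclidean_norm.

Section jensen.
Context d (X : measurableType d) (R : realType) (mu : {measure set X -> \bar R}).
Variables (n : nat) (k : X -> R) (v : X -> 'rV[R]_n) (Psi : X -> R).
Hypothesis k_ge0 : forall y, 0 <= k y.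
Hypothesis k_int : mu.-integrable setT (EFin \o k).
Hypothesis k1 : \int[mu]_y k y = 1.
Hypothesis kv_int : forall i, mu.-integrable setT (EFin \o (fun y => k y * v y ord0 i)).
Hypothesis kPsi_int : mu.-integrable setT (EFin \o (fun y => k y * Psi y)).

Let Rintegral_sum (I : Type) (s : seq I) (F : I -> X -> R) :
  (forall i, mu.-integrable setT (EFin \o F i)) ->
  mu.-integrable setT (EFin \o (fun y => \sum_(i <- s) F i y)) /\
  \int[mu]_y (\sum_(i <- s) F i y) = \sum_(i <- s) \int[mu]_y F i y.
Proof.
move=> Fi; elim: s => [|i s [ih1 ih2]].
  rewrite (_ : (fun y => _) = cst 0); last by apply/funext => y; rewrite big_nil.
  split; first exact: integrable0.
  by rewrite big_nil /Rintegral integral0_eq.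
have E : (fun y => \sum_(j <- i :: s) F j y) = (fun y => F i y + \sum_(j <- s) F j y).
  by apply/funext => y; rewrite big_cons.
rewrite E; split; last by rewrite big_cons RintegralD// ih2.
rewrite (_ : _ \o _ = fun y => ((EFin \o F i) y + (EFin \o (fun y => (\sum_(j <- s) F j y)%R)) y)%E)//.
exact: integrableD.
Qed.

(* Test against the unit vector [e] in the direction of the average. *)
Lemma weighted_jensen Phi (b : R) : young Phi -> 0 <= b ->
  (forall y, k y != 0 -> b * Phi (enorm (v y)) <= Psi y) ->
  b * Phi (enorm (\row_i \int[mu]_y (k y * v y ord0 i))) <= \int[mu]_y (k y * Psi y).
Proof.
move=> yP b0 bPsi; set V := \row_i _.
have := enorm_ge0 V; rewrite le_eqVlt => /predU1P[V0|V0].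
  rewrite -V0 young0// mulr0; apply: Rintegral_ge0 => y _.
  have [->|k0] := eqVneq (k y) 0; first by rewrite mul0r.
  rewrite mulr_ge0// (le_trans _ (bPsi _ k0))// mulr_ge0// young_ge0//.
  exact: enorm_ge0.
pose e := (enorm V)^-1 *: V.
have e1 : \sum_i e ord0 i ^+ 2 = 1.
  under eq_bigr do rewrite mxE exprMn.
  by rewrite -mulr_sumr -enorm_sqr -exprMn mulVf ?expr1n// gt_eqF.
have [p p0 hp] := young_support yP (ltW V0).
have [si sE] := @Rintegral_sum _ (index_enum 'I_n)
  (fun i y => e ord0 i * (k y * v y ord0 i))
  (fun i => integrableZl_EFin (e ord0 i) measurableT (kv_int i)).
have sV : \int[mu]_y (\sum_i e ord0 i * (k y * v y ord0 i)) = enorm V.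
  rewrite sE (eq_bigr (fun i => e ord0 i * V ord0 i)); last first.
    by move=> i _; rewrite RintegralZl//; congr (_ * _); rewrite [RHS]mxE.
  rewrite (_ : \sum_i _ = (enorm V)^-1 * enorm V ^+ 2).
    by rewrite expr2 mulKf// gt_eqF.
  rewrite enorm_sqr mulr_sumr; apply: eq_bigr => i _.
  by rewrite mxE -mulrA expr2.
(* With [c] the affine function b (Phi(|V|) + p (e . v - |V|)) has average exactly b Phi(|V|). It is
   a minorant of b Phi(|v|), by the supporting line and e . v <= |v|. *)
pose c := b * (Phi (enorm V) - p * enorm V).
have -> : b * Phi (enorm V) = \int[mu]_y (c * k y + (b * p) * \sum_i e ord0 i * (k y * v y ord0 i)).
  rewrite RintegralD//; try exact: integrableZl_EFin.
  by rewrite !RintegralZl// k1 sV /c; ring.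
apply: le_Rintegral => //.
  rewrite (_ : _ \o _ = fun y => ((EFin \o (fun y => (c * k y)%R)) y + (EFin \o (fun y => ((b * p) * \sum_i e ord0 i * (k y * v y ord0 i))%R)) y)%E)//.
  by apply: integrableD => //; exact: integrableZl_EFin.
move=> y _; have [ky0|k0] := eqVneq (k y) 0.
  by rewrite ky0 mulr0 mul0r add0r big1 ?mulr0// => i _; rewrite mul0r mulr0.
apply: le_trans (_ : _ <= k y * (b * Phi (enorm (v y)))) _; last by rewrite ler_wpM2l// bPsi.
rewrite (_ : \sum_i _ = k y * \sum_i e ord0 i * v y ord0 i); last first.
  by rewrite mulr_sumr; apply: eq_bigr => i _; rewrite mulrCA.
rewrite (_ : _ + _ = k y * (b * (Phi (enorm V) + p * ((\sum_i e ord0 i * v y ord0 i) - enorm V)))); last first.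
  by rewrite /c; ring.
rewrite ler_wpM2l// ler_wpM2l//; apply: le_trans (hp _ (enorm_ge0 (v y))).
by rewrite lerD2l ler_wpM2l// lerD2r enorm_dot.
Qed.

End jensen.

(** * Measure-theoretic tools: summable errors, bounds from limsups and norms *)

(** [S] is the sum of the series: its integral is at most the sum of the 2^-(k+1). Being integrable
    it is finite almost everywhere, and there the terms of the series tend to 0. *)
Lemma summable_errors d (X : measurableType d) (R : realType)
    (mu : {measure set X -> \bar R}) (h : nat -> X -> R) :
  (forall k, measurable_fun setT (h k)) -> (forall k z, 0 <= h k z) ->
  (forall k, (\int[mu]_z (h k z)%:E <= (1 / (2 ^ k.+1)%:R)%:E)%E) ->
  exists S : X -> \bar R, [/\ mu.-integrable setT S,
    forall k z, ((h k z)%:E <= S z)%E &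
    {ae mu, forall z, h k z @[k --> \oo] --> (0 : R)}].
Proof.
move=> mh h0 hi; pose S z := (\sum_(k <oo) (h k z)%:E)%E.
have hE0 k z : (0 <= (h k z)%:E)%E by rewrite lee_fin.
have S0 z : (0 <= S z)%E by exact: nneseries_ge0.
have mS : measurable_fun setT S.
  by apply: ge0_emeasurable_sum => // k *; exact/measurable_EFinP.
have iS : mu.-integrable setT S.
  apply/integrableP; split => //.
  under eq_integral do rewrite gee0_abs//.
  rewrite integral_nneseries//; last by move=> k; exact/measurable_EFinP.
  apply: le_lt_trans (_ : _ < +oo)%E; last exact: (ltry (1 : R)).
  apply: le_trans (epsilon_trick0 xpredT (ler01)).
  apply: lee_nneseries => [k _ _|k _]; last exact: hi.
  by apply: integral_ge0 => z _.
have hS k z : ((h k z)%:E <= S z)%E.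
  apply: le_trans (nneseries_lim_ge k.+1 _); last by move=> *.
  by rewrite big_nat_recr//= leeDr// sume_ge0.
exists S; split => //.
have [N [mN N0 subN]] := integrable_ae measurableT iS.
exists N; split => // z; apply: contra_notP => /= nN.
have Sfin : S z \is a fin_num by apply: contra_notP nN => Sz; apply: subN => /=; exact/not_implyP.
apply: cvg_series_cvg_0; apply: nondecreasing_is_cvgn.
  by apply: nondecreasing_series => k _ _.
exists (fine (S z)) => _ [m _ <-].
rewrite -lee_fin fineK//; apply: le_trans (nneseries_lim_ge m _); last by move=> *.
by rewrite /series/= sumEFin.
Qed.

Lemma limsup0_bound (R : realType) (f : R -> R) : (limsup0 f < +oo)%E ->
  exists C dl : R, [/\ 0 <= C, 0 < dl & forall rho, 0 < rho < dl -> f rho <= C].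
Proof.
rewrite /limsup0 /limf_esup => /ereal_inf_lt[_ [V VF <-]] Voo.
move: VF => [e /= e0 eV].
have [C C0 hC] : exists2 C : R, 0 <= C & (ereal_sup ((EFin \o f) @` V) <= C%:E)%E.
  case: (ereal_sup _) Voo => [r _|//|_].
    by exists (Num.max r 0); rewrite ?le_max ?lexx ?orbT// lee_fin le_max lexx.
  by exists 0; rewrite // leNye.
exists C, e; split => // rho /andP[r0 re]; rewrite -lee_fin; apply: le_trans hC.
apply: ereal_sup_ubound; exists rho => //; apply: eV => //.
by rewrite /= /ball_/= sub0r normrN gtr0_norm.
Qed.

Lemma Linfty_bound d (X : measurableType d) (R : realType)
    (mu : {measure set X -> \bar R}) (f : X -> \bar R) : (0 < mu setT)%E ->
  ('N[mu]_+oo [f] < +oo)%E -> exists2 M : R, 0 <= M & {ae mu, forall x, (`|f x| <= M%:E)%E}.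
Proof.
move=> mu0; rewrite unlock mu0 => fM.
have h := ess_sup_ge mu (abse \o f).
have [M M0 hM] : exists2 M : R, 0 <= M & (ess_sup mu (abse \o f) <= M%:E)%E.
  case: (ess_sup _ _) fM => [r _|//|_].
    by exists (Num.max r 0); rewrite ?le_max ?lexx ?orbT// lee_fin le_max lexx.
  by exists 0; rewrite // leNye.
by exists M => //; apply: filterS h => x /= /le_trans; apply.
Qed.

(** Hölder's inequality against the indicator of A, whose norm of conjugate exponent is c^(1 -
    1/s). *)
Lemma hoelder_indic d (X : measurableType d) (R : realType)
    (mu : {measure set X -> \bar R}) (f : X -> R) (A : set X) (s M c : R) :
  measurable_fun setT f -> measurable A -> 1 < s -> 0 <= c -> (mu A = c%:E)%E ->
  ('N[mu]_(s%:E) [EFin \o f] <= M%:E)%E ->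
  (\int[mu]_(x in A) `|f x|%:E <= (M * c `^ (1 - s^-1))%:E)%E.
Proof.
move=> mf mA s1 c0 muA fM; have s0 : 0 < s by exact: lt_trans s1.
have q0 : 0 < 1 - s^-1 by rewrite subr_gt0 invf_lt1.
have := @hoelder _ _ _ mu f \1_A s (1 - s^-1)^-1 mf (measurable_indic mA) s0.
rewrite invr_gt0 invrK => /(_ q0); rewrite addrC subrK => /(_ erefl).
rewrite Lnorm1 => h.
rewrite integral_mkcond (_ : (fun x => _) \_ A = fun x => `|((f \* \1_A) x)%:E|%E); last first.
  apply/funext => x; rewrite /patch /= indicE; case: ifPn => xA.
    by rewrite mulr1.
  by rewrite mulr0 normr0.
apply: le_trans h _; rewrite EFinM; apply: lee_pmul => //; rewrite ?Lnorm_ge0//.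
rewrite unlock/= invrK.
rewrite (_ : (\int[mu]_x _)%E = (\int[mu]_x (\1_A x)%:E)%E).
  by rewrite integral_indic// setIT muA poweR_EFin.
apply: eq_integral => x _; rewrite /= indicE; congr EFin.
case: (x \in A); first by rewrite normr1 powR1.
by rewrite normr0 powR0// invr_neq0// gt_eqF.
Qed.

(** * The parabolic kernels and their convergence *)

Section parabolic_kernel.
Variables (R : realType) (n : nat).
Hypothesis n_gt0 : (0 < n)%N.
Local Notation V := ('rV[R]_n * R)%type.
Local Notation X := ('rV[R]_n * measurableTypeR R)%type.
Local Notation mu := (lebesgue_xt R n).

Definition scale (m : nat) : R := m.+1%:R^-1.

Lemma scale_gt0 m : 0 < scale m.
Proof. by rewrite invr_gt0. Qed.

Lemma scale_le1 m : scale m <= 1.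
Proof. by rewrite invf_le1// ler1n. Qed.

Lemma scale_cvg0 (e : R) : 0 < e -> \forall m \near \oo, scale m < e.
Proof. by move=> e0; exact: (near_infty_natSinv_lt (PosNum e0)). Qed.

Let n0 : 0 < n%:R :> R. Proof. by rewrite ltr0n. Qed.

(** Dividing by n puts the coordinate box inside the Euclidean ball of radius [scale m]; with height
    [scale m ^+ 2] the support then lies within parabolic distance [scale m], the argument at which
    the modulus of continuity is evaluated. *)
Definition radius m : R := scale m / n%:R.
Definition height m : R := scale m ^+ 2.

Lemma radius_gt0 m : 0 < radius m.
Proof. by rewrite divr_gt0 ?scale_gt0. Qed.

Lemma height_gt0 m : 0 < height m.
Proof. by rewrite exprn_gt0 ?scale_gt0. Qed.

Lemma radius_le m : radius m <= scale m.
Proof. by rewrite ler_pdivrMr// ler_peMr ?ler1n// ltW ?scale_gt0. Qed.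

Lemma height_le m : height m <= scale m.
Proof. by rewrite /height expr2 ler_piMl ?scale_le1// ltW ?scale_gt0. Qed.

Definition parabolic_kernel (m : nat) (z y : X) : R :=
  xt_mollifier (radius m) (height m) ((z : V) - y).

Lemma parabolic_kernel_ge0 m z y : 0 <= parabolic_kernel m z y.
Proof. by rewrite xt_mollifier_ge0 ?radius_gt0 ?height_gt0. Qed.

Lemma measurable_parabolic_kernel m :
  measurable_fun setT (fun p : X * X => parabolic_kernel m p.1 p.2).
Proof.
have mm e : measurable_fun setT (mollifier e : measurableTypeR R -> R).
  exact: measurable_mollifier.
apply: measurable_funM.
  apply: measurable_prod => i _.
  under eq_fun do rewrite !mxE.
  apply: (measurableT_comp (mm (radius m))); apply: measurable_funB.
    exact: (measurableT_comp (measurable_xt_coord i) measurable_fst).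
  exact: (measurableT_comp (measurable_xt_coord i) measurable_snd).
apply: (measurableT_comp (mm (height m))); apply: measurable_funB.
  exact: (measurableT_comp measurable_snd measurable_fst).
exact: (measurableT_comp measurable_snd measurable_snd).
Qed.

Lemma integral_parabolic_kernel1 m z : (\int[mu]_y (parabolic_kernel m z y)%:E = 1)%E.
Proof. by rewrite integral_xt_mollifier ?radius_gt0 ?height_gt0. Qed.

Lemma integral_parabolic_kernel2 m y : (\int[mu]_z (parabolic_kernel m z y)%:E = 1)%E.
Proof.
rewrite -(integral_parabolic_kernel1 m y); apply: eq_integral => z _.
by rewrite /parabolic_kernel -xt_mollifierN opprB.
Qed.

(** A parabolic box has volume of order rho^(n+2), whose inverse bounds a kernel of mass 1; a space
    derivative costs one more power. The powers of n in the constant come from [radius]. *)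
Lemma parabolic_kernel_bounds : exists2 B : R, 0 < B & forall m,
  (forall z y, parabolic_kernel m z y <= B * scale m ^- (n + 2)) /\
  (forall (i : 'I_n) z, `|'D_(xt_basis R (Some i)) (xt_mollifier (radius m) (height m)) z| <=
    B * scale m ^- (n + 3)).
Proof.
have [B B0 hB] := @xt_mollifier_bounds R n.
exists ((B * n%:R) ^+ n * B * n%:R); first by rewrite !mulr_gt0 ?exprn_gt0// mulr_gt0.
move=> m; have sg := scale_gt0 m; have sn : scale m != 0 by rewrite gt_eqF.
have nn : n%:R != 0 :> R by rewrite gt_eqF.
have E1 : (B / radius m) ^+ n * (B / height m) =
    (B * n%:R) ^+ n * B * scale m ^- (n + 2).
  have -> : B / radius m = B * n%:R / scale m by rewrite /radius; field; rewrite sn nn.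
  by rewrite /height expr_div_n exprD (invfM (scale m ^+ n)); ring.
split=> [z y|i z].
  apply: le_trans (hB _ _ (radius_gt0 m) (height_gt0 m) _).1 _.
  rewrite E1 ler_wpM2r ?invr_ge0 ?exprn_ge0 ?(ltW sg)//.
  by rewrite ler_peMr ?ler1n// mulr_ge0 ?exprn_ge0 ?mulr_ge0// ltW.
apply: le_trans ((hB _ _ (radius_gt0 m) (height_gt0 m) _).2 i) _.
rewrite E1 /radius invf_div le_eqVlt; apply/orP; left; apply/eqP.
have -> : (n + 3 = (n + 2).+1)%N by rewrite addnS.
by rewrite (exprS (scale m) (n + 2)) (invfM (scale m) (scale m ^+ (n + 2))); ring.
Qed.

Lemma parabolic_kernel_supp m z y : parabolic_kernel m z y != 0 ->
  (forall i, `|z.1 ord0 i - y.1 ord0 i| < radius m) /\ `|z.2 - y.2| < height m.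
Proof.
move=> /(xt_mollifier_supp (radius_gt0 m) (height_gt0 m)) [h1 h2]; split => // i.
by have := h1 i; rewrite !mxE.
Qed.

Lemma parabolic_dist_le m (z y : V) :
  (forall i, `|z.1 ord0 i - y.1 ord0 i| <= radius m) -> `|z.2 - y.2| <= height m ->
  Num.max (enorm (z.1 - y.1)) (Num.sqrt `|z.2 - y.2|) <= scale m.
Proof.
move=> h1 h2; have sg := ltW (scale_gt0 m); rewrite ge_max; apply/andP; split.
  by apply: enorm_small => // i; rewrite !mxE; exact: h1.
have -> : scale m = Num.sqrt (height m) by rewrite /height sqrtr_sqr ger0_norm.
by rewrite ler_sqrt// ltW ?height_gt0.
Qed.

Lemma parabolic_kernel_local (U : set V) (z : X) : open U -> U z ->
  \forall m \near \oo, forall y, ~ U y -> parabolic_kernel m z y = 0.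
Proof.
move=> oU Uz; have /nbhs_ballP[e /= e0 eU] : nbhs (z : V) U by exact: open_nbhs_nbhs.
have := scale_cvg0 e0; apply: filterS => m me y Uy; apply/eqP/negPn/negP.
move=> /parabolic_kernel_supp[h1 h2]; apply: Uy; apply: eU; apply/ball_xtP => //.
split => [i|].
  by apply: lt_le_trans (h1 i) _; apply: le_trans (radius_le m) (ltW me).
by apply: lt_le_trans h2 _; apply: le_trans (height_le m) (ltW me).
Qed.

(** The abstract result with the open sets as pi-system and a large ball containing U as the set of
    finite measure. *)
Lemma parabolic_smoothing_cvg (U : set V) (f : X -> R) : bounded_set U ->
  mu.-integrable setT (EFin \o f) -> (forall z, ~ U z -> f z = 0) ->
  smoothing_cvg mu parabolic_kernel f.
Proof.
move=> [M [_ UM]] fi fU.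
pose r := Num.max (M + 2) 1.
have r0 : 0 < r by rewrite lt_max ltr01 orbT.
have Ur z : U z -> ball (0 : V) r z.
  move=> Uz; have zr : `|z| <= M + 1 by apply: (UM (M + 1)) => //; rewrite ltrDl.
  rewrite -ball_normE /= sub0r normrN; apply: le_lt_trans zr _.
  by rewrite lt_max; apply/orP; left; lra.
have boxE : (ball (0 : V) r : set X) = xt_box 0 r r.
  by apply/seteqP; split => z /(ball_xtP _ _ r0).
have [B _ hB] := parabolic_kernel_bounds.
apply: (@smoothing_cvg_integrable _ X R mu parabolic_kernel parabolic_kernel_ge0
  measurable_parabolic_kernel integral_parabolic_kernel1 integral_parabolic_kernel2
  (fun m => B * scale m ^- (n + 2)) (fun m => (hB m).1) (open : set (set V)) _ _ _ (ball (0 : V) r)) => //.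
- exact: openI.
- exact: measurable_xtE.
- by move=> A z; exact: parabolic_kernel_local.
- exact: ball_open.
- by rewrite boxE [X in (X < _)%E](lebesgue_xt_box (0 : V) (ltW r0) (ltW r0)) ltry.
- by move=> z zr; apply: fU; apply: contra_not zr => /Ur.
Qed.

(** If the ball of radius e at z fits in U, then boxes of scale below e / 2 centred in the half ball
    fit too; the near-covering form of compactness makes the scale uniform over the closure of Q. *)
Lemma compactly_contained_room (Q U : set V) : open U -> compactly_contained Q U ->
  exists N, forall m, (N <= m)%N -> forall z, Q z -> forall y : V,
    (forall i, `|z.1 ord0 i - y.1 ord0 i| <= radius m) -> `|z.2 - y.2| <= height m ->
    U y.
Proof.
move=> oU [cQ QU].
pose P (m : nat) (z : V) := forall y : V,
  (forall i, `|z.1 ord0 i - y.1 ord0 i| <= radius m) -> `|z.2 - y.2| <= height m ->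
  U y.
have : \forall m \near \oo, closure Q `<=` P m.
  apply: (compact_near_coveringP (closure Q)).1 => // z cz.
  have Uz := QU _ cz.
  have /nbhs_ballP[e /= e0 eU] : nbhs z U by exact: open_nbhs_nbhs.
  have e20 : 0 < e / 2 by rewrite divr_gt0.
  exists (ball z (e / 2), [set m | scale m < e / 2]).
    by split; [exact: nbhsx_ballx|exact: scale_cvg0].
  move=> [x m] [/= /(ball_xtP _ _ e20)[x1 x2] me] y y1 y2; apply: eU.
  apply/ball_xtP => //; split.
    move=> i; have := ler_distD (x.1 ord0 i) (z.1 ord0 i) (y.1 ord0 i).
    by have := x1 i; have := y1 i; have := radius_le m; lra.
  have := ler_distD x.2 z.2 y.2.
  by have := height_le m; lra.
by move=> [N _ h]; exists N => m Nm z Qz; apply: (h m Nm); exact: subset_closure.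
Qed.

End parabolic_kernel.

(** * Extension by zero, and moving the weak gradient through the kernel *)

Section weak_gradient.
Variables (R : realType) (n : nat) (Om : set 'rV[R]_n) (T : R).
Hypothesis Om_open : open Om.
Variables (w : 'rV[R]_n * R -> R) (Dw : 'rV[R]_n * R -> 'rV[R]_n).
Hypothesis hw : L1W11 Om T w Dw.
Local Notation V := ('rV[R]_n * R)%type.
Local Notation X := ('rV[R]_n * measurableTypeR R)%type.
Local Notation mu := (lebesgue_xt R n).
Local Notation leb := (@lebesgue_measure R).
Local Notation U := (parabolic_domain Om T).

Lemma parabolic_domain_open : open U.
Proof.
rewrite (_ : U = fst @^-1` Om `&` snd @^-1` `]0, T[%classic).
  apply: openI.
    by apply: (@open_comp V 'rV[R]_n fst) => // z _; exact: cvg_fst.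
  apply: (@open_comp V R snd) => [z _|]; first exact: cvg_snd.
  exact: (@interval_open _ (BRight 0) (BLeft T)).
by apply/seteqP; split => z /=.
Qed.

Lemma measurable_parabolic_domain : measurable (U : set X).
Proof. exact: open_measurable_xt parabolic_domain_open. Qed.

Let mU := measurable_parabolic_domain.
Let mOm : measurable Om := open_measurable_rV Om_open.

Definition ext (f : V -> R) : X -> R := f \_ U.

Lemma ext_in f z : U z -> ext f z = f z.
Proof. by move=> Uz; rewrite /ext patchE mem_set. Qed.

Lemma ext_out f z : ~ U z -> ext f z = 0.
Proof. by move=> Uz; rewrite /ext patchE memNset. Qed.

Lemma measurable_ext (f : V -> R) : measurable_fun (U : set X) (f : X -> R) ->
  measurable_fun setT (ext f).
Proof. by move=> mf; exact/(measurable_restrictT _ mU). Qed.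

Lemma integrable_ext (f : V -> R) : mu.-integrable (U : set X) (EFin \o (f : X -> R)) ->
  mu.-integrable setT (EFin \o ext f).
Proof.
move=> fi; rewrite (_ : EFin \o ext f = (EFin \o (f : X -> R)) \_ U).
  exact/(integrable_mkcond _ mU).
by apply/funext => z; rewrite /= /ext !patchE; case: ifP.
Qed.

Let F (z : V) : R := `|w z| + enorm (Dw z).

Let mw : measurable_fun (U : set X) (w : X -> R). Proof. by case: hw. Qed.
Let mDw : measurable_fun (U : set X) (Dw : X -> 'rV[R]_n). Proof. by case: hw. Qed.

Let mF : measurable_fun (U : set X) (F : X -> R).
Proof.
by apply: measurable_funD; [exact: measurableT_comp|exact: measurable_enorm].
Qed.

Let F_slice (t : R) : (\int[lebesgue_rV R n]_x (ext F (x, t))%:E =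
  ((fun t => sobolev11_norm Om (fun x => w (x, t)) (fun x => Dw (x, t))) \_ `]0%R, T[%classic) t)%E.
Proof.
rewrite patchE; case: ifPn => [|tT]; last first.
  apply: integral0_eq => x _; rewrite ext_out// => -[_ /= tT'].
  by move/negP: tT; apply; exact: mem_set.
rewrite inE/= => tT.
have sl (f : V -> R) : measurable_fun (U : set X) (f : X -> R) ->
    measurable_fun Om (fun x => f (x, t)).
  move=> mf; have := measurableT_comp (measurable_ext mf) (measurable_pair2 (t : measurableTypeR R)).
  move=> /(measurable_funS measurableT (@subsetT _ Om)).
  by apply: eq_measurable_fun => x; rewrite inE => Ox /=; rewrite ext_in.
rewrite /sobolev11_norm -ge0_integralD//; last first.
- by apply/measurable_EFinP; apply: (sl (fun z => enorm (Dw z))); exact: measurable_enorm.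
- by move=> x _; rewrite lee_fin enorm_ge0.
- apply/measurable_EFinP; apply: (sl (fun z => `|w z|)); exact: measurableT_comp.
rewrite [RHS]integral_mkcond; apply: eq_integral => x _.
rewrite patchE; case: ifPn => xO.
  by rewrite ext_in//; split => //; exact: set_mem.
by rewrite ext_out// => -[/= /mem_set]; rewrite (negbTE xO).
Qed.

Let F_ge0 z : (0 <= (ext F z)%:E)%E.
Proof.
by rewrite lee_fin /ext patchE; case: ifP => // _; rewrite addr_ge0 ?enorm_ge0.
Qed.

(** By Tonelli the space-time integral of |w| + |Dw| is the time integral of the slicewise Sobolev
    norms. This turns the Bochner-space hypothesis into joint integrability. *)
Let integrable_F : mu.-integrable setT (EFin \o ext F).
Proof.
have mE : measurable_fun setT (EFin \o ext F).
  by apply/measurable_EFinP; apply: measurable_ext mF.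
apply/integrableP; split => //.
rewrite (eq_integral (EFin \o ext F)); last by move=> z _; rewrite gee0_abs// F_ge0.
rewrite [ltLHS](@fubini_tonelli2 _ _ _ _ _ (lebesgue_rV R n) leb (EFin \o ext F))//.
rewrite /fubini_G; under eq_integral do rewrite /= F_slice.
by rewrite -integral_mkcond; case: hw.
Qed.

Lemma integrable_ext_le (f : V -> R) : measurable_fun (U : set X) (f : X -> R) ->
  (forall z, `|f z| <= F z) -> mu.-integrable setT (EFin \o ext f).
Proof.
move=> mf fF; apply: le_integrable integrable_F => //.
  by apply/measurable_EFinP; apply: measurable_ext mf.
move=> z _; rewrite /= lee_fin /ext !patchE; case: ifP => // _.
by apply: le_trans (fF z) _; rewrite ler_norm.
Qed.

Lemma integrable_ext_w : mu.-integrable setT (EFin \o ext w).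
Proof. by apply: integrable_ext_le => // z; rewrite lerDl enorm_ge0. Qed.

Lemma measurable_Dw_coord i : measurable_fun (U : set X) (fun z : X => Dw z ord0 i).
Proof. exact: (measurableT_comp (measurable_rV_coord i)). Qed.

Lemma integrable_ext_Dw i : mu.-integrable setT (EFin \o ext (fun z => Dw z ord0 i)).
Proof.
apply: integrable_ext_le => [|z]; first exact: measurable_Dw_coord.
by apply: le_trans (coord_le_enorm _ _) _; rewrite lerDr.
Qed.

(** Only slicewise weak derivatives are given, so Fubini reduces to a fixed time s. If s is within h
    of the time of z, the slice of the kernel is a test function on Om and the definition of weak
    gradient applies; otherwise both integrands vanish. *)
Lemma mollified_weak_gradient (phi : V -> R) (z : V) (d h : R) i :
  bounded_smooth phi -> (forall x, 0 <= phi x) ->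
  (forall x, phi x != 0 -> (forall j, `|x.1 ord0 j| <= d) /\ `|x.2| <= h) ->
  (forall y : V, (forall j, `|z.1 ord0 j - y.1 ord0 j| <= d) -> `|z.2 - y.2| <= h -> U y) ->
  \int[mu]_y ('D_(xt_basis R (Some i)) phi (z - (y : V)) * ext w y) =
  \int[mu]_y (phi (z - (y : V)) * ext (fun z => Dw z ord0 i) y).
Proof.
move=> phis phi0 phid room; set v := xt_basis R (Some i).
set D0 := ext (fun z => Dw z ord0 i).
have bs_int (f : V -> R) (g : X -> R) : bounded_smooth f -> mu.-integrable setT (EFin \o g) ->
    mu.-integrable setT (fun y : X => (f (z - (y : V)) * g y)%:E).
  move=> fs gi; have [M _ fM] := BCk_bounded (fs 0%N).
  apply: (@convolve_integrable _ V _ X mu (fun y => y) _ _ gi f z M) => //.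
    by move=> f' fc; exact: continuous_measurable_xt.
  exact: BCk_continuous (fs 0%N).
have i1 := bs_int _ _ (bounded_smooth_derive v phis) integrable_ext_w.
have i2 := bs_int _ _ phis (integrable_ext_Dw i).
congr fine.
rewrite -[LHS](@integral21_prod_meas1 _ _ _ _ _ (lebesgue_rV R n) leb _ i1).
rewrite -[RHS](@integral21_prod_meas1 _ _ _ _ _ (lebesgue_rV R n) leb _ i2).
apply: ae_eq_integral => //.
- exact: (measurable_fubini_G i1).
- exact: (measurable_fubini_G i2).
have sl1 : {ae @lebesgue_measure R, forall s, (lebesgue_rV R n).-integrable setT
    (fun x => ('D_v phi (z - (x, s)) * ext w (x, s))%:E)} := ae_integrable2 i1.
have [_ _ hs _] := hw.
(* The hypothesis on [phi] locates its support only; nonnegativity extends it to the derivative. *)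
have Dphi0 x : phi x = 0 -> 'D_v phi x = 0.
  by move=> p0; apply: derive_at_zero_min => // y; exact: bounded_smooth_differentiable.
suff : {ae @lebesgue_measure R, forall s,
    fubini_G (lebesgue_rV R n) (fun y : X => ('D_v phi (z - (y : V)) * ext w y)%:E) s =
    fubini_G (lebesgue_rV R n) (fun y : X => (phi (z - (y : V)) * D0 y)%:E) s}.
  by apply: filterS => s ->.
apply: (@filterS2 _ _ (ae_filter_ringOfSetsType _) _ _ _ _ hs sl1) => {}s {}hs {}s1.
rewrite /fubini_G.
have [/andP[sT1 sT2]|sT] := boolP (0 < s < T); last first.
  rewrite !integral0_eq// => x _; rewrite /D0 ext_out ?mulr0// => -[_ /=];
    by rewrite in_itv/= (negbTE sT).
have [zs|zs] := leP `|z.2 - s| h; last first.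
  have p0 x : phi (z - (x, s)) = 0.
    apply/eqP/negPn/negP => /phid[_ /=].
    by rewrite leNgt zs.
  by rewrite !integral0_eq// => x _; rewrite ?Dphi0 ?p0 ?mul0r.
have [wi _ hsob] := hs (introT andP (conj sT1 sT2)).
have tf : test_function Om (fun x => phi (z - (x, s))).
  apply: (@section_test_function R n phi z s Om d) => // [x /phid[]//|y hy].
  by have [] := room (y, s) hy zs.
have := hsob _ i tf.
have UE x : Om x -> U (x, s) by move=> Ox; split => //=; rewrite in_itv/= sT1.
have UN x : ~ Om x -> ~ U (x, s) by move=> Ox [].
(* Differentiating in the subtracted variable gives a minus sign, which cancels the one in the
   definition of the weak gradient. *)
have E1 : (\int[lebesgue_rV R n]_(x in Om)
       (w (x, s) * 'D_(delta_mx ord0 i) (fun y => phi (z - (y, s))) x)%:E =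
    - \int[lebesgue_rV R n]_x ('D_v phi (z - (x, s)) * ext w (x, s))%:E)%E.
  rewrite -mulN1e -(integralZl measurableT s1) [LHS]integral_mkcond.
  apply: eq_integral => x _; rewrite patchE; case: ifPn => xO.
    rewrite ext_in; last exact/UE/set_mem.
    by rewrite derive_section// mulN1e -EFinN mulrN [w _ * _]mulrC.
  rewrite ext_out ?mulr0 ?mule0//; apply: UN => /mem_set; exact/negP.
have E2 : (\int[lebesgue_rV R n]_x (phi (z - (x, s)) * D0 (x, s))%:E =
    \int[lebesgue_rV R n]_(x in Om) (Dw (x, s) ord0 i * phi (z - (x, s)))%:E)%E.
  rewrite [RHS]integral_mkcond; apply: eq_integral => x _.
  rewrite patchE; case: ifPn => xO.
    by rewrite /D0 ext_in 1?mulrC//; exact/UE/set_mem.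
  by rewrite /D0 ext_out ?mulr0//; apply: UN => /mem_set; rewrite (negbTE xO).
by rewrite E1 -E2 => /oppe_inj.
Qed.

End weak_gradient.

(** * The smooth approximants and their gradients *)

Section mollified_function.
Variables (R : realType) (n : nat) (Om : set 'rV[R]_n) (T : R).
Hypotheses (n_gt0 : (0 < n)%N) (Om_open : open Om).
Variables (w : 'rV[R]_n * R -> R) (Dw : 'rV[R]_n * R -> 'rV[R]_n).
Hypothesis hw : L1W11 Om T w Dw.
Local Notation V := ('rV[R]_n * R)%type.
Local Notation X := ('rV[R]_n * measurableTypeR R)%type.
Local Notation mu := (lebesgue_xt R n).
Local Notation leb := (@lebesgue_measure R).
Local Notation U := (parabolic_domain Om T).
Local Notation w0 := (ext Om T w).
Local Notation D0 i := (ext Om T (fun z => Dw z ord0 i)).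
Local Notation phi m := (@xt_mollifier R n (radius R n m) (height R m)).

Definition smooth_approx (m : nat) : V -> R :=
  @convolve R V _ X mu (fun y => y) w0 (phi m).

(** Defined at every point as the average of the zero extension of [Dw]; [grad_smooth_approx]
    identifies it with the gradient of [smooth_approx] where the box around z fits in the domain. *)
Definition smoothed_gradient (m : nat) (z : V) : 'rV[R]_n :=
  \row_i kernel_smoothing mu (@parabolic_kernel R n m) (D0 i) z.

Let e_meas (f : V -> R) : continuous f -> measurable_fun setT (f \o (fun y : X => (y : V))).
Proof. exact: continuous_measurable_xt. Qed.

Let w0_int : mu.-integrable setT (EFin \o w0) := integrable_ext_w Om_open hw.

Let phi_smooth m : bounded_smooth (phi m).
Proof. exact: xt_mollifier_smooth. Qed.

Let conv_int (f : V -> R) z : bounded_smooth f ->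
  mu.-integrable setT (fun y : X => (f (z - (y : V)) * w0 y)%:E).
Proof.
move=> fs; have [M _ fM] := BCk_bounded (fs 0%N).
apply: (@convolve_integrable _ V _ X mu (fun y => y) _ _ w0_int f z M) => //.
exact: BCk_continuous (fs 0%N).
Qed.

Lemma smooth_approx_smooth m A : smooth_on A (smooth_approx m).
Proof.
exact: (convolve_smooth (@xt_coord_le R n) (@xt_coord_basis R n) e_meas w0_int).
Qed.

Lemma derive_smooth_approx m z i : 'D_(xt_basis R (Some i)) (smooth_approx m) z =
  \int[mu]_y ('D_(xt_basis R (Some i)) (phi m) (z - (y : V)) * w0 y).
Proof.
have [_ ->//] := convolve_differentiable (@xt_coord_le R n) (@xt_coord_basis R n)
  e_meas w0_int z (phi_smooth m).
Qed.

Variable m : nat.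
Variable z : V.
Hypothesis room : forall y : V,
  (forall i, `|z.1 ord0 i - y.1 ord0 i| <= radius R n m) -> `|z.2 - y.2| <= height R m -> U y.

Let phi_ge0 x : 0 <= phi m x.
Proof. by rewrite xt_mollifier_ge0 ?radius_gt0 ?height_gt0. Qed.

Lemma smoothed_gradientE i : smoothed_gradient m z ord0 i =
  'D_(xt_basis R (Some i)) (smooth_approx m) z.
Proof.
rewrite mxE derive_smooth_approx.
rewrite (mollified_weak_gradient Om_open hw i (phi_smooth m) phi_ge0 _ room)//.
move=> x /xt_mollifier_supp[||h1 h2]; rewrite ?radius_gt0 ?height_gt0//.
by split; [move=> j; exact/ltW/h1|exact: ltW].
Qed.

Lemma grad_smooth_approx : grad_x (smooth_approx m) z = smoothed_gradient m z.
Proof. by apply/rowP => i; rewrite smoothed_gradientE mxE. Qed.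

(** The derivative falls on the kernel, which vanishes together with its derivative outside the box.
    The gradient is thereby controlled by the size of [w] instead of that of [Dw]. *)
Lemma smoothed_gradient_le (A : R) i :
  (forall x, `|'D_(xt_basis R (Some i)) (phi m) x| <= A) ->
  (`|smoothed_gradient m z ord0 i|%:E <=
   A%:E * \int[mu]_(y in xt_box z (radius R n m) (height R m)) `|w0 y|%:E)%E.
Proof.
move=> hA; have A0 : 0 <= A by apply: le_trans (hA 0).
rewrite smoothed_gradientE derive_smooth_approx.
have Ds := bounded_smooth_derive (xt_basis R (Some i)) (phi_smooth m).
have ii : mu.-integrable setT
    (EFin \o (fun y : X => 'D_(xt_basis R (Some i)) (phi m) (z - (y : V)) * w0 y)).
  exact (conv_int z Ds).
rewrite EFin_normr_Rintegral//.
apply: le_trans (le_abse_integral _ measurableT (measurable_int _ ii)) _.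
have mb := measurable_xt_box z (radius R n m) (height R m).
have mw0 : measurable_fun setT (fun y : X => `|w0 y|%:E).
  by apply/measurable_EFinP/measurableT_comp => //; case/integrableP: w0_int => /measurable_EFinP.
rewrite -ge0_integralZl//; last exact: measurable_funTS.
rewrite [leRHS]integral_mkcond; apply: ge0_le_integral => //.
- by apply: measurableT_comp => //; exact: measurable_int ii.
- by apply/(measurable_restrictT _ mb); apply: measurable_funTS; exact: measurable_funeM.
move=> y _; rewrite patchE; case: ifPn => yb.
  by rewrite -EFinM lee_fin normrM ler_wpM2r.
have p0 : phi m (z - (y : V)) = 0.
  apply/eqP/negPn/negP => /xt_mollifier_supp[||h1 h2]; rewrite ?radius_gt0 ?height_gt0//.
  move/negP: yb; apply; rewrite inE; split => // j.
  by have := h1 j; rewrite !mxE.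
rewrite /= derive_at_zero_min// ?mul0r ?normr0//.
by move=> x; exact: bounded_smooth_differentiable.
Qed.

(** Jensen needs a constant weight b, whereas [Psi] may carry the variable weight a(y); comparing
    them is required only within the reach of the kernel at z. *)
Lemma jensen_smoothed_gradient Phi b (Psi : V -> R) : young Phi -> 0 <= b ->
  mu.-integrable setT (EFin \o ext Om T Psi) ->
  (forall y : V, U y -> enorm (z.1 - y.1) <= scale R m -> Num.sqrt `|z.2 - y.2| <= scale R m ->
     b * Phi (enorm (Dw y)) <= Psi y) ->
  b * Phi (enorm (smoothed_gradient m z)) <=
    kernel_smoothing mu (@parabolic_kernel R n m) (ext Om T Psi) z.
Proof.
move=> yP b0 Psii hPsi.
have [B _ /(_ m)[hB _]] := @parabolic_kernel_bounds R n n_gt0.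
have kM f := @integrable_kernelM _ X R mu _ (@parabolic_kernel_ge0 R n n_gt0 m)
  (@measurable_parabolic_kernel R n m) _ hB z f.
have k_int : mu.-integrable setT (EFin \o parabolic_kernel m (z : X)).
  apply/integrableP; split.
    apply/measurable_EFinP.
    exact: (measurableT_comp (@measurable_parabolic_kernel R n m) (measurable_pair1 (z : X))).
  under eq_integral do rewrite /= ger0_norm ?parabolic_kernel_ge0//.
  by rewrite integral_parabolic_kernel1// ltry.
rewrite /smoothed_gradient /kernel_smoothing.
have -> : (\row_i \int[mu]_y (parabolic_kernel m (z : X) y * D0 i y)) =
    \row_i \int[mu]_y (parabolic_kernel m (z : X) y * (\row_j D0 j y) ord0 i).
  by apply/rowP => i; rewrite !mxE; apply: eq_Rintegral => y _; rewrite mxE.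
apply: (weighted_jensen (v := fun y => \row_j D0 j y)) => //.
- by move=> y; exact: parabolic_kernel_ge0.
- by rewrite /Rintegral integral_parabolic_kernel1.
- move=> i; under [_ \o _]eq_fun do rewrite /= mxE.
  exact (kM _ (integrable_ext_Dw Om_open hw i)).
- exact (kM _ Psii).
move=> y /(parabolic_kernel_supp n_gt0)[h1 h2].
have h1' i := ltW (h1 i); have Uy : U y by apply: room => //; exact: ltW.
have := parabolic_dist_le n_gt0 h1' (ltW h2); rewrite ge_max => /andP[d1 d2].
rewrite ext_in//; have -> : \row_j D0 j y = Dw y.
  by apply/rowP => j; rewrite mxE ext_in.
exact: hPsi.
Qed.

End mollified_function.

(** * Energy density of the mollified gradient *)

Section energy_density.
Variables (R : realType) (n : nat) (Om : set 'rV[R]_n) (T : R).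
Hypotheses (n_gt0 : (0 < n)%N) (Om_open : open Om).
Variables (G H : R -> R) (young_G : young G) (young_H : young H).
Variable a : 'rV[R]_n * R -> R.
Local Notation V := ('rV[R]_n * R)%type.
Local Notation X := ('rV[R]_n * measurableTypeR R)%type.
Local Notation mu := (lebesgue_xt R n).
Local Notation U := (parabolic_domain Om T).
Hypothesis a_ge0 : forall z, U z -> 0 <= a z.
Hypothesis a_cont : {within U, continuous a}.

Definition density (v : V -> 'rV[R]_n) (z : V) : R :=
  G (enorm (v z)) + a z * H (enorm (v z)).

Let G_ge0 (x : 'rV[R]_n) : 0 <= G (enorm x).
Proof. by apply: young_ge0 => //; exact: enorm_ge0. Qed.

Let H_ge0 (x : 'rV[R]_n) : 0 <= H (enorm x).
Proof. by apply: young_ge0 => //; exact: enorm_ge0. Qed.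

Lemma measurable_young Phi d (Y : measurableType d) (A : set Y) (f : Y -> R) :
  young Phi -> measurable_fun A f -> (forall x, 0 <= f x) ->
  measurable_fun A (fun x => Phi (f x)).
Proof.
move=> yP mf f0; rewrite (_ : (fun x => _) = (fun t => Phi `|t|) \o f); last first.
  by apply/funext => x /=; rewrite ger0_norm.
apply: measurableT_comp => //; apply: continuous_measurable_fun.
exact: young_abs_continuous.
Qed.

Lemma measurable_density (A : set X) (v : X -> 'rV[R]_n) : measurable A -> A `<=` U ->
  measurable_fun A v -> measurable_fun A (density v : X -> R).
Proof.
move=> mA AU mv; have me : measurable_fun A (fun z => enorm (v z)) by exact: measurable_enorm.
apply: measurable_funD.
  by apply: measurable_young => // x; exact: enorm_ge0.
apply: measurable_funM; last by apply: measurable_young => // x; exact: enorm_ge0.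
apply: measurable_funS AU _; first exact: measurable_parabolic_domain.
by apply: within_continuous_measurable_xt => //; exact: parabolic_domain_open.
Qed.

Lemma density_ge0 v z : U z -> 0 <= density v z.
Proof.
by move=> Uz; rewrite /density addr_ge0 ?mulr_ge0 ?a_ge0.
Qed.

Lemma density_geG v z : U z -> G (enorm (v z)) <= density v z.
Proof. by move=> Uz; rewrite /density lerDl mulr_ge0 ?a_ge0. Qed.

Variables (w : V -> R) (Dw : V -> 'rV[R]_n).
Hypothesis hw : L1W11 Om T w Dw.
Hypothesis w_energy : (energy G H a Dw U < +oo)%E.

Let mDw : measurable_fun (U : set X) (Dw : X -> 'rV[R]_n). Proof. by case: hw. Qed.

Lemma integrable_density : mu.-integrable setT (EFin \o ext Om T (density Dw)).
Proof.
apply: integrable_ext => //; apply/integrableP; split.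
  apply/measurable_EFinP; apply: measurable_density => //.
  exact: measurable_parabolic_domain.
apply: le_lt_trans w_energy; apply: ge0_le_integral => //.
- exact: measurable_parabolic_domain.
- apply: measurableT_comp => //; apply/measurable_EFinP; apply: measurable_density => //.
  exact: measurable_parabolic_domain.
- apply/measurable_EFinP; apply: measurable_density => //.
  exact: measurable_parabolic_domain.
by move=> z Uz; rewrite /= ger0_norm ?density_ge0.
Qed.

Variable om : R -> R.
Hypothesis a_om : modulus_of_continuity om U a.

Lemma modulus_ge0 m : 0 <= om (scale R m).
Proof. by case: a_om => h _ _ _ _; apply: h; exact/ltW/scale_gt0. Qed.

Lemma modulus_scale (z y : V) m : U z -> U y -> enorm (z.1 - y.1) <= scale R m ->
  Num.sqrt `|z.2 - y.2| <= scale R m -> a z - om (scale R m) <= a y.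
Proof.
move=> Uz Uy h1 h2; have [_ hm _ _ ha] := a_om.
have := ha _ _ Uz Uy; set d := Num.max _ _ => azy.
have d0 : 0 <= d by rewrite le_max enorm_ge0.
have : om d <= om (scale R m).
  apply: hm; rewrite ?in_itv/= ?andbT//; first exact/ltW/scale_gt0.
  by rewrite ge_max h1 h2.
by move: azy; rewrite ler_norml => /andP[_]; lra.
Qed.

Local Notation Tg m z :=
  (kernel_smoothing mu (parabolic_kernel m) (ext Om T (density Dw)) z).
Local Notation v m z := (smoothed_gradient Om T Dw m z).

Definition room m (z : V) := forall y : V,
  (forall i, `|z.1 ord0 i - y.1 ord0 i| <= radius R n m) ->
  `|z.2 - y.2| <= height R m -> U y.

Lemma room_in m z : room m z -> U z.
Proof.
by apply => [i|]; rewrite subrr normr0 ltW ?radius_gt0 ?height_gt0.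
Qed.

Lemma smoothed_gradient_energyG m z : room m z -> G (enorm (v m z)) <= Tg m z.
Proof.
move=> rm; rewrite -[leLHS]mul1r.
apply: (jensen_smoothed_gradient n_gt0 Om_open hw) => //; first exact: integrable_density.
by move=> y Uy _ _; rewrite mul1r density_geG.
Qed.

(** Split a(z) <= b + om(scale). Jensen bounds G(|v|) and b H(|v|) by the averaged density, one
    each; the part with om is at most C G(|v|), which accounts for the remaining C. *)
Lemma smoothed_gradient_energy m z C : room m z -> 0 <= C ->
  om (scale R m) * H (enorm (v m z)) <= C * G (enorm (v m z)) ->
  density (smoothed_gradient Om T Dw m) z <= (2 + C) * Tg m z.
Proof.
move=> rm C0 hC; have Uz := room_in rm; have hG := smoothed_gradient_energyG rm.
(* Truncation at 0 keeps the weight nonnegative; b <= a(y) within reach of z, since a >= 0 and a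
   varies there by at most om(scale). *)
set b := Num.max 0 (a z - om (scale R m)).
have b0 : 0 <= b by rewrite le_max lexx.
have azb : a z <= b + om (scale R m) by rewrite -lerBlDr le_max lexx orbT.
have hH : b * H (enorm (v m z)) <= Tg m z.
  apply: (jensen_smoothed_gradient n_gt0 Om_open hw) => //; first exact: integrable_density.
  move=> y Uy d1 d2; have H0 := H_ge0 (Dw y).
  apply: le_trans (_ : _ <= a y * H (enorm (Dw y))) _.
    by rewrite ler_wpM2r// ge_max a_ge0//= modulus_scale.
  by rewrite lerDr.
have H0 := H_ge0 (v m z).
rewrite /density; have := ler_wpM2r H0 azb; rewrite mulrDl.
have := ler_wpM2l C0 hG; lra.
Qed.

End energy_density.

(** * Integrals of w over parabolic boxes *)

Section box_integrals.
Variables (R : realType) (n : nat) (Om : set 'rV[R]_n) (T : R).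
Hypotheses (Om_open : open Om).
Variable w : 'rV[R]_n * R -> R.
Local Notation V := ('rV[R]_n * R)%type.
Local Notation X := ('rV[R]_n * measurableTypeR R)%type.
Local Notation mu := (lebesgue_xt R n).
Local Notation leb := (@lebesgue_measure R).
Local Notation U := (parabolic_domain Om T).
Local Notation w0 := (ext Om T w).
Hypothesis mw : measurable_fun (U : set X) (w : X -> R).

Let mw0 : measurable_fun setT w0. Proof. exact: measurable_ext. Qed.

Let mw0E : measurable_fun setT (fun y : X => `|w0 y|%:E).
Proof. by apply/measurable_EFinP/measurableT_comp. Qed.

Lemma box_integral_Linfty : in_Linfty U w -> exists2 M : R, 0 <= M &
  forall (z : V) (d t : R), 0 <= d -> 0 <= t ->
  (\int[mu]_(y in xt_box z d t) `|w0 y|%:E <= (M * ((2 * d) ^+ n * (2 * t)))%:E)%E.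
Proof.
move=> wU; have mupos : (0 < mu setT)%E.
  have le1 : (mu (xt_box (0%R : V) 1%R 1%R) <= mu setT)%E.
    by apply: le_measure; rewrite ?inE//; exact: measurable_xt_box.
  apply: lt_le_trans le1.
  by rewrite [X in (_ < X)%E](lebesgue_xt_box (0 : V) ler01 ler01) lte_fin !mulr_gt0 ?exprn_gt0 ?mulr_gt0.
have [M M0 hM] := Linfty_bound mupos wU; exists M => // z d t d0 t0.
have mb := measurable_xt_box z d t.
apply: le_trans (_ : _ <= \int[mu]_(y in xt_box z d t) M%:E)%E _.
  apply: ae_ge0_le_integral => //; first exact: measurable_funTS.
  by apply: (@filterS _ _ (ae_filter_ringOfSetsType _) _ _ _ hM) => y + _.
by rewrite integral_cst// [X in (_ * X)%E](lebesgue_xt_box z d0 t0).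
Qed.

(** On almost every time slice Hölder's inequality over the space box gives the factor (2d)^(n (1 -
    1/p)); integration over the time interval of length 2t gives the rest. *)
Lemma box_integral_LinftyLs p : 1 < p -> in_LinftyLs Om T p w -> exists2 M : R, 0 <= M &
  forall (z : V) (d t : R), 0 <= d -> 0 <= t ->
  (\int[mu]_(y in xt_box z d t) `|w0 y|%:E <=
   (M * ((2 * d) ^+ n) `^ (1 - p^-1) * (2 * t))%:E)%E.
Proof.
move=> p1 wLs; have lebpos : (0 < leb setT)%E.
  have le1 : (leb (ball (0%R : R) 1%R) <= leb setT)%E.
    by apply: le_measure; rewrite ?inE//; exact: measurable_ball.
  by apply: lt_le_trans le1; rewrite lebesgue_measure_ball// lte_fin.
have [M M0 hM] := Linfty_bound lebpos wLs; exists M => // z d t d0 t0.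
have mb := measurable_xt_box z d t.
set A := [set v : 'rV[R]_n | forall i, ball (z.1 ord0 i) d (v ord0 i)].
have mA : measurable A by exact: measurable_rV_box.
have muA : lebesgue_rV R n A = ((2 * d) ^+ n)%:E by exact: lebesgue_rV_ball.
set c := M * _.
have c0 : 0 <= c by rewrite mulr_ge0 ?powR_ge0.
rewrite integral_mkcond.
have mF : measurable_fun setT ((fun y : X => `|w0 y|%:E) \_ (xt_box z d t)).
  by apply/(measurable_restrictT _ mb); exact: measurable_funTS.
have F0 y : (0 <= ((fun y : X => `|w0 y|%:E) \_ (xt_box z d t)) y)%E.
  by rewrite patchE; case: ifP => // _; rewrite lee_fin.
rewrite [leLHS](@fubini_tonelli2 _ _ _ _ _ (lebesgue_rV R n) leb)//.
apply: le_trans (_ : _ <= \int[leb]_s ((cst c%:E) \_ (ball z.2 t)) s)%E _; last first.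
  rewrite -integral_mkcond integral_cst; last exact: measurable_ball.
  by rewrite [X in (_ * X)%E](lebesgue_measure_ball z.2 t0) -EFinM -(mulr_natl t 2).
apply: ae_ge0_le_integral => //.
- by move=> s _; apply: integral_ge0.
- exact: measurable_fun_fubini_tonelli_G.
- by move=> s _; rewrite patchE; case: ifP => // _; rewrite lee_fin.
- apply/(measurable_restrictT _ (measurable_ball _ _)); exact: measurable_cst.
apply: (@filterS _ _ (ae_filter_ringOfSetsType _) _ _ _ hM) => s + _; rewrite /fubini_G => hs.
have -> : (\int[lebesgue_rV R n]_x ((fun y : X => `|w0 y|%:E) \_ (xt_box z d t)) (x, s) =
    if (s : R) \in (ball z.2 t : set R) then \int[lebesgue_rV R n]_(x in A) `|w0 (x, s)|%:E else 0)%E.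
  case: ifPn => sb; last first.
    apply: integral0_eq => x _; rewrite patchE; case: ifPn => //.
    by rewrite inE xt_boxE => -[_ /mem_set]; rewrite (negbTE sb).
  rewrite [RHS]integral_mkcond; apply: eq_integral => x _; rewrite !patchE.
  rewrite (_ : ((x, s) \in xt_box z d t) = (x \in A))//.
  apply/idP/idP; rewrite !inE xt_boxE; first by case.
  by move=> xA; split => //; exact: set_mem.
rewrite patchE; case: ifPn => // _.
have [sT|sT] := boolP ((s : R) \in (`]0, T[%classic : set R)); last first.
  rewrite integral0_eq ?lee_fin// => x _; rewrite ext_out ?normr0// => -[_ /=].
  by move=> h; move/negP: sT; apply; exact: mem_set.
apply: (@hoelder_indic _ _ _ (lebesgue_rV R n) (fun x => w0 (x, s)) A p M) => //.
- exact: (measurableT_comp mw0 (measurable_pair2 (s : measurableTypeR R))).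
- by rewrite exprn_ge0 ?mulr_ge0.
move: hs; rewrite patchE sT gee0_abs ?Lnorm_ge0//.
rewrite (_ : (fun x => w (x, s)) \_ Om = (fun x => w0 (x, s)))//.
apply/funext => x; rewrite patchE; case: ifPn => xO.
  by rewrite ext_in//; split => //=; [exact: set_mem|move: sT; rewrite inE].
by rewrite ext_out// => -[/mem_set]; rewrite (negbTE xO).
Qed.

End box_integrals.

(** * Absorbing om H into G: the size of the mollified gradient under each condition *)

Lemma exists_pow2_ge (R : realType) (c : R) : exists j, c <= 2 ^+ j.
Proof.
exists (Num.bound c); apply: le_trans (ler_norm c) _.
have := archi_boundP (normr_ge0 c); rewrite /Num.bound normr_id => /ltW /le_trans; apply.
by rewrite -natrX ler_nat ltnW// ltn_expl.
Qed.

Section gradient_growth.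
Variables (R : realType) (n : nat) (Om : set 'rV[R]_n) (T : R).
Hypotheses (n_gt0 : (0 < n)%N) (Om_open : open Om).
Variables (G H : R -> R) (young_G : young G) (young_H : young H).
Hypotheses (G_Delta2 : Delta2 G) (H_Delta2 : Delta2 H) (GH : young_prec G H).
Variable a : 'rV[R]_n * R -> R.
Local Notation V := ('rV[R]_n * R)%type.
Local Notation X := ('rV[R]_n * measurableTypeR R)%type.
Local Notation mu := (lebesgue_xt R n).
Local Notation U := (parabolic_domain Om T).
Hypothesis a_ge0 : forall z, U z -> 0 <= a z.
Hypothesis a_cont : {within U, continuous a}.
Variables (w : V -> R) (Dw : V -> 'rV[R]_n).
Hypothesis hw : L1W11 Om T w Dw.
Hypothesis w_energy : (energy G H a Dw U < +oo)%E.
Variable om : R -> R.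
Hypothesis a_om : modulus_of_continuity om U a.
Local Notation v m z := (smoothed_gradient Om T Dw m z).
Local Notation sc m := (scale R m).

Let mw : measurable_fun (U : set X) (w : X -> R). Proof. by case: hw. Qed.

(** The common frame of the three conditions: a reference size [th m] at which the comparison of H
    and G is known, dominating the gradient up to c. The factor c is rounded up to a power of 2 so
    that doubling applies. *)
Lemma growth_of_size (P : nat -> V -> Prop) (th : nat -> R) (c C : R) : 0 <= C ->
  (forall m z, P m z -> [/\ 0 < th m, om (sc m) * H (th m) <= C * G (th m) &
    enorm (v m z) <= c * th m]) ->
  exists2 C' : R, 0 <= C' & forall m z, P m z ->
    om (sc m) * H (enorm (v m z)) <= C' * G (enorm (v m z)).
Proof.
move=> C0 hP; have [K K0 hK] := H_Delta2; have [j cj] := exists_pow2_ge c.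
exists (C * K ^+ j); first by rewrite mulr_ge0 ?exprn_ge0 ?(ltW K0).
move=> m z /hP[th0 omH vth].
apply: (young_prec_growth young_G young_H G_Delta2 GH (ltW K0) hK (modulus_ge0 a_om m) C0 th0) => //.
  exact: enorm_ge0.
by apply: le_trans vth _; rewrite ler_wpM2r// ltW.
Qed.

(** The bound on the derivative of the kernel, summed over the n components; the n enters the
    constant. *)
Lemma gradient_size : exists2 B : R, 0 < B & forall m z L, room Om T m z ->
  (\int[mu]_(y in xt_box z (radius R n m) (height R m)) `|ext Om T w y|%:E <= L%:E)%E ->
  enorm (v m z) <= B * sc m ^- (n + 3) * L.
Proof.
have [B B0 hB] := @parabolic_kernel_bounds R n n_gt0.
have n0 : 0 < n%:R :> R by rewrite ltr0n.
exists (n%:R * B); first by rewrite mulr_gt0.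
move=> m z L rm hL; apply: le_trans (enorm_le_sum _) _.
have -> : n%:R * B * sc m ^- (n + 3) * L = \sum_(i < n) (B * sc m ^- (n + 3) * L).
  by rewrite sumr_const card_ord -[RHS]mulr_natl; ring.
apply: ler_sum => i _; rewrite -lee_fin.
apply: le_trans (smoothed_gradient_le n_gt0 Om_open hw rm (fun x => (hB m).2 i x)) _.
rewrite [leRHS]EFinM; apply: lee_wpmul2l => //.
by rewrite lee_fin mulr_ge0 ?(ltW B0)// invr_ge0 exprn_ge0// ltW// scale_gt0.
Qed.

Lemma scale_lt_near (dl : R) : 0 < dl -> exists N, forall m, (N <= m)%N -> 0 < sc m < dl.
Proof.
move=> dl0; have [N _ hN] := scale_cvg0 dl0; exists N => m Nm.
by rewrite scale_gt0 /= hN.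
Qed.

(** By Jensen G(|v|) is at most an average of the density, hence at most B rho^-(n+2) J with J the
    total energy. Convexity of [G] turns this into a bound of |v| by a multiple of th =
    G^-1(rho^-(n+2)). *)
Lemma gradient_growth_energy :
  (limsup0 (fun rho => om rho *
     (H (young_linv G (rho ^- (n + 2))) / rho ^- (n + 2)))%R < +oo)%E ->
  exists N, exists2 C : R, 0 <= C & forall m z, (N <= m)%N /\ room Om T m z ->
    om (sc m) * H (enorm (v m z)) <= C * G (enorm (v m z)).
Proof.
move=> /limsup0_bound[C [dl [C0 dl0 hC]]]; have [N hN] := scale_lt_near dl0; exists N.
have [B B0 hB] := @parabolic_kernel_bounds R n n_gt0.
have gi := integrable_density Om_open young_G young_H a_ge0 a_cont hw w_energy.
set g0 := ext Om T _ in gi.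
have g0_ge0 y : 0 <= g0 y.
  have [Uy|Uy] := pselect (U y); last by rewrite /g0 ext_out.
  by rewrite /g0 ext_in//; exact: (density_ge0 young_G young_H a_ge0 Dw Uy).
set J := \int[mu]_y g0 y.
pose th m := young_linv G (sc m ^- (n + 2)).
apply: (@growth_of_size _ th (Num.max 1 (B * J)) C) => // m z [Nm rm].
have sg := scale_gt0 R m; set u := sc m ^- (n + 2).
have u0 : 0 < u by rewrite invr_gt0 exprn_gt0.
have [th0 uG] := young_linv_ge young_G (ltW u0).
split.
- rewrite lt_neqAle th0 andbT; apply/eqP => th00.
  by move: uG; rewrite -/(th m) -th00 young0// leNgt u0.
(* The limsup bounds om H(th) by C u, and u <= G(th) because the left-inverse attains its
   infimum. *)
- have := hC _ (hN m Nm); rewrite mulrA ler_pdivrMr// => /le_trans; apply.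
  by rewrite ler_wpM2l.
apply: young_linv_bound => //; [exact: ltW|by rewrite le_max lexx|exact: enorm_ge0|].
apply: le_trans (smoothed_gradient_energyG n_gt0 Om_open young_G young_H a_ge0 a_cont hw w_energy rm) _.
rewrite /kernel_smoothing.
apply: le_trans (_ : _ <= B * u * J) _; last first.
  by rewrite mulrAC ler_wpM2r ?(ltW u0)// le_max lexx orbT.
rewrite /J -RintegralZl//; apply: le_Rintegral => //.
- apply: (@integrable_kernelM _ X R mu _ (@parabolic_kernel_ge0 R n n_gt0 m)
  (@measurable_parabolic_kernel R n m) _ (hB m).1 z _ gi).
- exact: integrableZl_EFin.
by move=> y _; rewrite ler_wpM2r// (hB m).1.
Qed.

(** A derivative bound rho^-(n+3) against a box of volume of order rho^(n+2) leaves the size th = 1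
    / rho. *)
Lemma gradient_growth_bounded : in_Linfty U w ->
  (limsup0 (fun rho => om rho * (H rho^-1 / G rho^-1))%R < +oo)%E ->
  exists N, exists2 C : R, 0 <= C & forall m z, (N <= m)%N /\ room Om T m z ->
    om (sc m) * H (enorm (v m z)) <= C * G (enorm (v m z)).
Proof.
move=> wU /limsup0_bound[C [dl [C0 dl0 hC]]]; have [N hN] := scale_lt_near dl0; exists N.
have [B B0 hB] := gradient_size; have [M M0 hM] := box_integral_Linfty Om_open mw wU.
pose th m : R := (sc m)^-1.
apply: (@growth_of_size _ th (B * M * (2 ^+ n * 2)) C) => // m z [Nm rm].
have sg := scale_gt0 R m; have th0 : 0 < th m by rewrite invr_gt0.
have rg := radius_gt0 R n_gt0 m; have hg := height_gt0 R m.
split => //.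
  have := hC _ (hN m Nm); rewrite mulrA ler_pdivrMr// young_gt0//.
apply: le_trans (hB _ _ _ rm (hM z _ _ (ltW rg) (ltW hg))) _.
have -> : B * M * (2 ^+ n * 2) * th m = B * sc m ^- (n + 3) *
    (M * ((2 * sc m) ^+ n * (2 * height R m))).
  rewrite /th /height !exprMn !exprD; field.
  by rewrite !gt_eqF ?exprn_gt0.
rewrite ler_wpM2l//; first by rewrite mulr_ge0 ?(ltW B0)// invr_ge0 exprn_ge0// ltW.
rewrite ler_wpM2l//; apply: ler_wpM2r; first by rewrite mulr_ge0 ?(ltW hg).
by rewrite lerXn2r ?nnegrE ?mulr_ge0 ?(ltW rg) ?(ltW sg)// ler_wpM2l// radius_le.
Qed.

(** As for bounded w, with the box integral of order rho^(n (1 - 1/p) + 2). *)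
Lemma gradient_growth_Ls p : 2 <= p -> in_LinftyLs Om T p w ->
  (limsup0 (fun rho => om rho * (H (rho `^ (- ((n%:R + p) / p))) /
     G (rho `^ (- ((n%:R + p) / p)))))%R < +oo)%E ->
  exists N, exists2 C : R, 0 <= C & forall m z, (N <= m)%N /\ room Om T m z ->
    om (sc m) * H (enorm (v m z)) <= C * G (enorm (v m z)).
Proof.
move=> p2 wU /limsup0_bound[C [dl [C0 dl0 hC]]]; have [N hN] := scale_lt_near dl0; exists N.
have p1 : 1 < p by lra.
have [B B0 hB] := gradient_size; have [M M0 hM] := box_integral_LinftyLs Om_open mw p1 wU.
pose th m : R := sc m `^ (- ((n%:R + p) / p)).
pose q := 1 - p^-1.
have q0 : 0 <= q by rewrite subr_ge0 invf_le1; lra.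
apply: (@growth_of_size _ th (B * M * ((2 ^+ n) `^ q * 2)) C) => // m z [Nm rm].
have sg := scale_gt0 R m; have th0 : 0 < th m by rewrite powR_gt0.
have rg := radius_gt0 R n_gt0 m; have hg := height_gt0 R m.
split => //.
  have := hC _ (hN m Nm); rewrite mulrA ler_pdivrMr// young_gt0//.
apply: le_trans (hB _ _ _ rm (hM z _ _ (ltW rg) (ltW hg))) _.
have -> : B * M * ((2 ^+ n) `^ q * 2) * th m = B * sc m ^- (n + 3) *
    (M * ((2 * sc m) ^+ n) `^ q * (2 * height R m)).
  (* Exponent count: -(n + 3) + n (1 - 1/p) + 2 = -(n + p)/p. *)
  have -> : th m = sc m ^- (n + 3) * (sc m ^+ n) `^ q * height R m.
    rewrite -!powR_mulrn ?(ltW sg)// -powRN -powRrM /height -powR_mulrn ?(ltW sg)//.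
    rewrite -!powRD ?(gt_eqF sg) ?implybT// /th; congr (_ `^ _).
    by rewrite /q natrD; field; lra.
  rewrite exprMn powRM ?exprn_ge0 ?(ltW sg)//; ring.
rewrite ler_wpM2l//; first by rewrite mulr_ge0 ?(ltW B0)// invr_ge0 exprn_ge0// ltW.
apply: ler_wpM2r; first by rewrite mulr_ge0 ?(ltW hg).
rewrite ler_wpM2l//; apply: ge0_ler_powR => //; rewrite ?nnegrE ?exprn_ge0 ?mulr_ge0 ?(ltW rg) ?(ltW sg)//.
by rewrite lerXn2r ?nnegrE ?mulr_ge0 ?(ltW rg) ?(ltW sg)// ler_wpM2l// radius_le.
Qed.

End gradient_growth.

(** * Passage to the limit: fast indices, energies and the Luxemburg norm *)

(** The finitely many error sequences are added, and for each k an index at least N is picked with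
    total error at most 2^-(k+1). A single integrable S then dominates all the errors, and they tend
    to 0 almost everywhere and in L^1. *)
Lemma fast_subsequence d (X : measurableType d) (R : realType)
    (mu : {measure set X -> \bar R}) (J : finType) (h : nat -> J -> X -> R) (N : nat) :
  (forall m j, measurable_fun setT (h m j)) -> (forall m j z, 0 <= h m j z) ->
  (forall j (e : R), 0 < e -> \forall m \near \oo, (\int[mu]_z (h m j z)%:E <= e%:E)%E) ->
  exists sg : nat -> nat, (forall k, (N <= sg k)%N) /\
  exists S : X -> \bar R, [/\ mu.-integrable setT S,
    forall k j z, ((h (sg k) j z)%:E <= S z)%E,
    {ae mu, forall z, forall j, h (sg k) j z @[k --> \oo] --> (0 : R)} &
    forall j, (\int[mu]_z (h (sg k) j z)%:E)%E @[k --> \oo] --> 0%E].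
Proof.
move=> mh h0 hc; pose F m z := \sum_j h m j z.
have mF m : measurable_fun setT (F m) by apply: measurable_sum.
have F0 m z : 0 <= F m z by apply: sumr_ge0.
have hF m j z : h m j z <= F m z.
  by rewrite /F (bigD1 j)//= lerDl; apply: sumr_ge0.
have FE m : (\int[mu]_z (F m z)%:E = \sum_j \int[mu]_z (h m j z)%:E)%E.
  under eq_integral do rewrite /F -sumEFin.
  rewrite ge0_integral_sum// => [j|j z _]; first exact/measurable_EFinP.
  by rewrite lee_fin.
have Fc (e : R) : 0 < e -> \forall m \near \oo, (\int[mu]_z (F m z)%:E <= e%:E)%E.
  move=> e0; have c0 : 0 < (#|J|.+1)%:R :> R by rewrite ltr0n.
  (* The successor keeps the divisor positive even for an empty index type. *)
  have : \forall m \near \oo, forall j, (\int[mu]_z (h m j z)%:E <= (e / #|J|.+1%:R)%:E)%E.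
    by apply: filter_forall => j; apply: hc; rewrite divr_gt0.
  apply: filterS => m hm; rewrite FE.
  apply: le_trans (lee_sum _ (fun j _ => hm j)) _.
  rewrite sumEFin lee_fin sumr_const -[leLHS]mulr_natl mulrCA ler_piMr ?(ltW e0)//.
  by rewrite ler_pdivrMr// mul1r ler_nat.
have /choice[sg hsg] k : exists m, (N <= m)%N /\
    (\int[mu]_z (F m z)%:E <= (1 / (2 ^ k.+1)%:R)%:E)%E.
  have e0 : 0 < 1 / (2 ^ k.+1)%:R :> R by rewrite divr_gt0// ltr0n expn_gt0.
  have [M _ hM] := Fc _ e0; exists (maxn N M); split; first exact: leq_maxl.
  by apply: hM => /=; exact: leq_maxr.
exists sg; split => [k|]; first by case: (hsg k).
have [S [Si FS Fae]] := summable_errors (fun k => mF (sg k)) (fun k => F0 (sg k)) (fun k => (hsg k).2).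
exists S; split => //.
- by move=> k j z; apply: le_trans (FS k z); rewrite lee_fin.
- apply: filterS Fae => z Fz j.
  by apply: (squeeze_cvgr _ (cvg_cst 0) Fz); apply: nearW => k; rewrite h0 hF.
move=> j; have geo : (1 / (2 ^ k.+1)%:R)%:E @[k --> \oo] --> (0%:E : \bar R).
  apply: cvg_EFin; first exact: nearW.
  rewrite (_ : _ \o _ = fun k => 2^-1 * 2^-1 ^+ k :> R); last first.
    by apply/funext => k /=; rewrite div1r natrX exprS invfM exprVn.
  rewrite -[X in _ --> X](mulr0 (2^-1)); apply: cvgMr.
  by apply: cvg_expr; rewrite ger0_norm ?invf_lt1 ?ltr1n// invr_ge0.
apply: (squeeze_cvge _ (cvg_cst 0%E) geo); apply: nearW => k.
rewrite integral_ge0/= => [|z _]; last by rewrite lee_fin.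
apply: le_trans (hsg k).2; apply: ge0_le_integral => //.
- by move=> z _; rewrite lee_fin.
- exact/measurable_EFinP.
- exact/measurable_EFinP.
by move=> z _; rewrite lee_fin.
Qed.

Section modular_convergence.
Variables (R : realType) (n : nat) (Om : set 'rV[R]_n) (T : R).
Hypotheses (Om_open : open Om).
Variables (G H : R -> R) (young_G : young G) (young_H : young H) (G_Delta2 : Delta2 G).
Variable a : 'rV[R]_n * R -> R.
Local Notation V := ('rV[R]_n * R)%type.
Local Notation X := ('rV[R]_n * measurableTypeR R)%type.
Local Notation mu := (lebesgue_xt R n).
Local Notation U := (parabolic_domain Om T).
Hypothesis a_ge0 : forall z, U z -> 0 <= a z.
Hypothesis a_cont : {within U, continuous a}.
Variables (Q : set V) (Dw : V -> 'rV[R]_n) (v : nat -> V -> 'rV[R]_n) (E : X -> \bar R).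
Hypotheses (mQ : measurable (Q : set X)) (QU : Q `<=` U).
Hypothesis mDw : measurable_fun (Q : set X) (Dw : X -> 'rV[R]_n).
Hypothesis mv : forall k, measurable_fun (Q : set X) (v k : X -> 'rV[R]_n).
Hypothesis E_int : mu.-integrable (Q : set X) E.
Hypothesis v_le : forall k z, Q z -> ((density G H a (v k) z)%:E <= E z)%E.
Hypothesis Dw_int : mu.-integrable (Q : set X) (EFin \o (density G H a Dw : X -> R)).
Hypothesis v_cvg : {ae mu, forall z : X, Q z -> forall i,
  v k z ord0 i @[k --> \oo] --> Dw z ord0 i}.

Let md (u : X -> 'rV[R]_n) : measurable_fun (Q : set X) u ->
  measurable_fun (Q : set X) (density G H a u : X -> R).
Proof. by move=> mu'; exact: (@measurable_density R n Om T). Qed.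

Let d0 u z : Q z -> 0 <= density G H a u z.
Proof. by move=> /QU Uz; exact: (density_ge0 young_G young_H a_ge0 u Uz). Qed.

Let dG u z : Q z -> G (enorm (u z)) <= density G H a u z.
Proof. by move=> /QU Uz; exact: (density_geG G young_H a_ge0 u Uz). Qed.

Let G_ge0 t : 0 <= t -> 0 <= G t. Proof. by apply: young_ge0. Qed.

Let young_cvg (Phi : R -> R) (u : nat -> R) (l : R) : young Phi -> (forall k, 0 <= u k) -> 0 <= l ->
  u k @[k --> \oo] --> l -> Phi (u k) @[k --> \oo] --> Phi l.
Proof.
move=> yP u0 l0 ul; rewrite -[l]ger0_norm//.
rewrite (_ : (fun k => Phi (u k)) = (fun t => Phi `|t|) \o u); last first.
  by apply/funext => k /=; rewrite ger0_norm.
have h := @young_abs_continuous R Phi yP l; apply: cvg_comp ul _; exact: h.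
Qed.

Let sum_cvg0 z : (forall i, v k z ord0 i @[k --> \oo] --> Dw z ord0 i) ->
  \sum_i `|v k z ord0 i - Dw z ord0 i| @[k --> \oo] --> (0 : R).
Proof.
move=> vc; elim: (index_enum _) => [|i s ih].
  rewrite (_ : (fun _ => _) = cst 0); first exact: cvg_cst.
  by apply/funext => k; rewrite big_nil.
rewrite (_ : (fun _ => _) = (fun k => `|v k z ord0 i - Dw z ord0 i| +
    \sum_(j <- s) `|v k z ord0 j - Dw z ord0 j|)); last first.
  by apply/funext => k; rewrite big_cons.
rewrite -[X in _ --> X](addr0 0); apply: (cvgD _ ih).
rewrite -(@normr0 _ R); apply: cvg_norm.
by rewrite -(subrr (Dw z ord0 i)); apply: cvgB => //; exact: cvg_cst.
Qed.

Let enorm_cvg z : (forall i, v k z ord0 i @[k --> \oo] --> Dw z ord0 i) ->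
  enorm (v k z) @[k --> \oo] --> enorm (Dw z).
Proof.
move=> /sum_cvg0 vc; apply/cvgrPdist_le => e e0.
apply: filterS ((cvgr0Pnorm_le _).1 vc _ e0) => k hk.
by rewrite distrC; apply: le_trans (enorm_dist _ _) (le_trans (ler_norm _) hk).
Qed.

Lemma energy_cvg : energy G H a (v k) Q @[k --> \oo] --> energy G H a Dw Q.
Proof.
have [] := @dominated_convergence _ X R mu Q mQ
  (fun k => EFin \o (density G H a (v k) : X -> R)) (EFin \o (density G H a Dw : X -> R)) E _ _ _ E_int _ => //.
- by move=> k; apply/measurable_EFinP; exact: md.
- by apply/measurable_EFinP; exact: md.
- apply: (@filterS _ _ (ae_filter_ringOfSetsType _) _ _ _ v_cvg) => z hz Qz.
  have ec := enorm_cvg (hz Qz); apply: cvg_EFin; first exact: nearW.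
  apply: cvgD; first by apply: young_cvg => // [k|]; exact: enorm_ge0.
  apply: cvgM; first exact: cvg_cst.
  by apply: young_cvg => // [k|]; exact: enorm_ge0.
by apply/aeW => z k Qz; rewrite /= ger0_norm ?d0//; exact: v_le.
Qed.

Lemma in_LG_density (u : V -> 'rV[R]_n) : measurable_fun (Q : set X) (u : X -> 'rV[R]_n) ->
  (energy G H a u Q < +oo)%E -> in_LG G Q u.
Proof.
move=> mu' uoo; split => //; exists 1 => //; apply: le_lt_trans uoo.
apply: ge0_le_integral => //.
- by move=> z _; rewrite lee_fin G_ge0// divr1 enorm_ge0.
- apply/measurable_EFinP; under eq_fun do rewrite divr1.
  by apply: measurable_young => // [|x]; [exact: measurable_enorm|exact: enorm_ge0].
- by apply/measurable_EFinP; exact: md.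
by move=> z Qz; rewrite lee_fin divr1; exact: dG.
Qed.

(** With 2 / l <= 2^j, doubling bounds G(|v - Dw| / l) by K^j G(max(|v|, |Dw|)), hence by K^j times
    the sum of the two densities, which has an integrable majorant. Dominated convergence applies at
    every level l. *)
Lemma modular_cvg l : 0 < l ->
  (\int[mu]_(z in Q) (G (enorm (v k z - Dw z) / l))%:E)%E @[k --> \oo] --> 0%E.
Proof.
move=> l0; have [K K0 hK] := G_Delta2; have [j lj] := exists_pow2_ge (2 / l).
have bnd k z : Q z -> G (enorm (v k z - Dw z) / l) <=
    K ^+ j * (density G H a (v k) z + density G H a Dw z).
  move=> Qz; have e1 := enorm_ge0 (v k z); have e2 := enorm_ge0 (Dw z).
  set t := Num.max (enorm (v k z)) (enorm (Dw z)).
  have t0 : 0 <= t by rewrite le_max e1.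
  have tle : enorm (v k z - Dw z) / l <= 2 ^+ j * t.
    apply: le_trans (_ : _ <= 2 / l * t) _; last by rewrite ler_wpM2r.
    rewrite mulrAC ler_wpM2r ?invr_ge0 ?(ltW l0)//.
    apply: le_trans (enormD _ _) _; rewrite enormN.
    have h1 : enorm (v k z) <= t by rewrite le_max lexx.
    have h2 : enorm (Dw z) <= t by rewrite le_max lexx orbT.
    by lra.
  have q0 : 0 <= enorm (v k z - Dw z) / l by rewrite divr_ge0 ?enorm_ge0 ?(ltW l0).
  apply: le_trans (young_le young_G q0 tle) _.
  apply: le_trans (Delta2_iter j (ltW K0) hK t0) _.
  rewrite ler_wpM2l ?exprn_ge0 ?(ltW K0)//.
  have := dG (v k) Qz; have := dG Dw Qz; have := d0 (v k) Qz; have := d0 Dw Qz.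
  by rewrite /t; case: (leP (enorm (v k z)) (enorm (Dw z))) => _; lra.
have [] := @dominated_convergence _ X R mu Q mQ
  (fun k (z : X) => (G (enorm (v k z - Dw z) / l))%:E) (cst 0%E)
  (fun z => (K ^+ j)%:E * (E z + (density G H a Dw z)%:E))%E _ _ _ _ _ => //.
- move=> k; apply/measurable_EFinP; apply: measurable_young => //.
    apply: measurable_funM => //.
    apply: (@measurableT_comp _ _ _ _ _ _ (@Num.sqrt R)).
      by apply: continuous_measurable_fun; exact: sqrt_continuous.
    apply: measurable_sum => i; apply: measurable_funX.
    under eq_fun do rewrite !mxE.
    by apply: measurable_funB; exact: (measurableT_comp (measurable_rV_coord i)).
  by move=> x; rewrite divr_ge0 ?enorm_ge0 ?(ltW l0).
- apply: (@filterS _ _ (ae_filter_ringOfSetsType _) _ _ _ v_cvg) => z hz Qz.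
  apply: cvg_EFin; first exact: nearW.
  have sc0 := sum_cvg0 (hz Qz).
  rewrite -(young0 young_G); apply: young_cvg => // [k|].
    by rewrite divr_ge0 ?enorm_ge0 ?(ltW l0).
  rewrite -[X in _ --> X](mul0r l^-1); apply: cvgMl.
  apply: (squeeze_cvgr _ (cvg_cst 0) sc0); apply: nearW => k; rewrite enorm_ge0/=.
  by apply: le_trans (enorm_le_sum _) _; apply: ler_sum => i _; rewrite !mxE.
- by apply: integrableZl => //; exact: integrableD.
- apply/aeW => z k Qz; rewrite gee0_abs; last first.
    by rewrite lee_fin G_ge0// divr_ge0 ?enorm_ge0 ?(ltW l0).
  apply: le_trans (_ : _ <= (K ^+ j * (density G H a (v k) z + density G H a Dw z))%:E)%E _.
    by rewrite lee_fin bnd.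
  rewrite EFinM EFinD; apply: lee_wpmul2l; first by rewrite lee_fin exprn_ge0 ?(ltW K0).
  by rewrite leeD2r// v_le.
by move=> _ _; rewrite integral0.
Qed.

(** The modular at level e tends to 0, so it is eventually at most 1, and e is then admissible in
    the infimum. *)
Lemma luxemburg_cvg : luxemburg G Q (fun z => v k z - Dw z) @[k --> \oo] --> 0%E.
Proof.
have lge0 k : (0 <= luxemburg G Q (fun z => v k z - Dw z)%R)%E.
  by apply: le_ereal_inf_tmp => _ [l [l0 _] <-]; rewrite lee_fin ltW.
have lle (e : R) : 0 < e -> \forall k \near \oo,
    (luxemburg G Q (fun z => v k z - Dw z)%R <= e%:E)%E.
  move=> e0; have /fine_cvgP[f1 f2] := modular_cvg e0.
  apply: filterS2 f1 ((cvgr0Pnorm_le _).1 f2 _ ltr01) => k fk hk.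
  apply: ereal_inf_lbound; exists e => //; split => //.
  by rewrite -(fineK fk) lee_fin; exact: le_trans (ler_norm _) hk.
have ffin : \forall k \near \oo, luxemburg G Q (fun z => v k z - Dw z)%R \is a fin_num.
  by apply: filterS (lle _ ltr01) => k hk; rewrite ge0_fin_numE// (le_lt_trans hk)// ltry.
apply/fine_cvgP; split => //; apply/cvgr0Pnorm_le => e e0.
apply: filterS2 ffin (lle _ e0) => k fk hk.
by rewrite /= ger0_norm ?fine_ge0// -lee_fin fineK.
Qed.

Let integral_lty (f : X -> R) : mu.-integrable (Q : set X) (EFin \o f) ->
  (\int[mu]_(z in Q) (f z)%:E < +oo)%E.
Proof.
move=> fi; apply: le_lt_trans (_ : _ <= \int[mu]_(z in Q) `|(f z)%:E|)%E _.
  exact: le_trans (lee_abs _) (le_abse_integral _ mQ (measurable_int _ fi)).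
by case/integrableP: fi.
Qed.

Lemma cvg_LG_density : cvg_LG G Q v Dw.
Proof.
split; last exact: luxemburg_cvg.
  move=> k; apply: in_LG_density => //.
  apply: (@integral_lty (density G H a (v k))) => //.
  apply: le_integrable E_int => //; first by apply/measurable_EFinP; exact: md.
  move=> z Qz; rewrite /= ger0_norm ?d0//; apply: le_trans (v_le k Qz) _.
  exact: lee_abs.
by apply: in_LG_density => //; exact: integral_lty Dw_int.
Qed.

End modular_convergence.

(** * Assembling the approximating sequence *)

Section approximation.
Variables (R : realType) (n : nat) (n_gt0 : (0 < n)%N).
Local Notation V := ('rV[R]_n * R)%type.
Local Notation X := ('rV[R]_n * measurableTypeR R)%type.
Local Notation mu := (lebesgue_xt R n).

Lemma measurable_cylinder (z0 : V) (r : R) : measurable (cylinder z0 r : set X).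
Proof.
apply: measurableX; last exact: measurable_itv.
have m : measurable_fun setT (fun x : 'rV[R]_n => enorm (x - z0.1)).
  apply: measurable_enorm => //; apply: measurable_fun_rVP => i.
  under eq_fun do rewrite !mxE.
  by apply: measurable_funB => //; exact: measurable_rV_coord.
rewrite (_ : [set x | _] = setT `&` (fun x : 'rV[R]_n => enorm (x - z0.1)) @^-1` `]-oo, r[%classic).
  by apply: m => //; exact: measurable_itv.
by rewrite setTI; apply/seteqP; split => x /=; rewrite in_itv.
Qed.

Lemma bounded_parabolic_domain (Om : set 'rV[R]_n) (T : R) : bounded_set Om ->
  bounded_set (parabolic_domain Om T).
Proof.
move=> [M [_ hM]]; exists (Num.max (M + 1) T); split; first exact: num_real.
move=> M' hM' [x t] [/= Omx]; rewrite in_itv/= => /andP[t0 tT].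
rewrite prod_normE ge_max; apply/andP; split => /=.
  by apply: hM Omx; apply: lt_le_trans (ltW hM'); rewrite lt_max ltrDl ltr01.
rewrite ger0_norm ?(ltW t0)//; apply: le_trans (ltW tT) (le_trans _ (ltW hM')).
by rewrite le_max lexx orbT.
Qed.

Variables (Om : set 'rV[R]_n) (Om_open : open Om) (Om_bounded : bounded_set Om) (T : R).
Variables (G H : R -> R) (young_G : young G) (young_H : young H) (G_Delta2 : Delta2 G).
Variable a : V -> R.
Local Notation U := (parabolic_domain Om T).
Hypothesis a_ge0 : forall z, U z -> 0 <= a z.
Hypothesis a_cont : {within U, continuous a}.
Variables (om : R -> R) (a_om : modulus_of_continuity om U a).
Variables (w : V -> R) (Dw : V -> 'rV[R]_n).
Hypothesis hw : L1W11 Om T w Dw.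
Hypothesis w_energy : (energy G H a Dw U < +oo)%E.
Local Notation v m z := (smoothed_gradient Om T Dw m z).

Lemma measurable_smoothed_gradient m :
  measurable_fun setT (smoothed_gradient Om T Dw m : X -> 'rV[R]_n).
Proof.
have [B _ /(_ m)[hB _]] := @parabolic_kernel_bounds R n n_gt0.
apply: measurable_fun_rVP => i; under eq_fun do rewrite mxE.
apply: (@measurable_kernel_smoothing _ X R mu _ (@parabolic_kernel_ge0 R n n_gt0 m)
  (@measurable_parabolic_kernel R n m) (integral_parabolic_kernel2 n_gt0 m)).
exact: (integrable_ext_Dw Om_open hw i).
Qed.

(** The conditions on [w] and om enter only through the constant C; the rest is L^1 convergence
    along fast indices and dominated convergence. *)
Lemma mollified_approximation (Q : set V) (N : nat) (C : R) : measurable (Q : set X) ->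
  (forall m, (N <= m)%N -> forall z, Q z -> room Om T m z) -> 0 <= C ->
  (forall m z, (N <= m)%N /\ room Om T m z ->
    om (scale R m) * H (enorm (v m z)) <= C * G (enorm (v m z))) ->
  exists w_ : nat -> V -> R,
    [/\ forall m, smooth_on Q (w_ m), cvg_L1 Q w_ w,
        cvg_LG G Q (fun m => grad_x (w_ m)) Dw &
        energy G H a (grad_x (w_ m)) Q @[m --> \oo] --> energy G H a Dw Q].
Proof.
move=> mQ rmQ C0 hC.
have QU : Q `<=` U by move=> z Qz; exact: (room_in n_gt0 (rmQ N (leqnn N) z Qz)).
have wi := integrable_ext_w Om_open hw.
have Dwi := integrable_ext_Dw Om_open hw.
have gi := integrable_density Om_open young_G young_H a_ge0 a_cont hw w_energy.
(* Three kinds of averages must converge along the same indices: [w] for the L^1 statement, the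
   components of [Dw] for pointwise convergence, the density for the majorant. *)
pose F (j : option (option 'I_n)) : X -> R := match j with
  | None => ext Om T w
  | Some None => ext Om T (density G H a Dw)
  | Some (Some i) => ext Om T (fun z => Dw z ord0 i) end.
have Fi j : mu.-integrable setT (EFin \o F j).
  by case: j => [[i|]|]; [exact: Dwi|exact: gi|exact: wi].
have F_out j z : ~ U z -> F j z = 0 by move=> Uz; case: j => [[i|]|]; rewrite /F ext_out.
have Fc j := parabolic_smoothing_cvg n_gt0 (bounded_parabolic_domain T Om_bounded) (Fi j) (F_out j).
have [B _ hB] := @parabolic_kernel_bounds R n n_gt0.
have Ti m j : mu.-integrable setT (EFin \o kernel_smoothing mu (parabolic_kernel m) (F j)).
  exact: (@integrable_kernel_smoothing _ X R mu _ (@parabolic_kernel_ge0 R n n_gt0 m)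
    (@measurable_parabolic_kernel R n m) (integral_parabolic_kernel2 n_gt0 m) _ (hB m).1 _ (Fi j)).
have [|//|j e e0|sg [sgN [S [Si hS hae hL1]]]] := @fast_subsequence _ X R mu _
  (fun m j z => `|kernel_smoothing mu (parabolic_kernel m) (F j) z - F j z|) N.
- move=> m j; apply: measurableT_comp => //; apply: measurable_funB.
    by apply/measurable_EFinP; exact: measurable_int (Ti m j).
  by apply/measurable_EFinP; exact: measurable_int (Fi j).
- exact: ((smoothing_cvgP _ (Fi j)).1 (Fc j)).
have gradE k z : Q z -> grad_x (smooth_approx Om T w (sg k)) z = v (sg k) z.
  by move=> Qz; apply: (grad_smooth_approx n_gt0 Om_open hw); exact: rmQ.
exists (fun k => smooth_approx Om T w (sg k)).
have iQ f : mu.-integrable setT f -> mu.-integrable (Q : set X) f.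
  by apply: integrableS.
have mv k : measurable_fun (Q : set X)
    (grad_x (smooth_approx Om T w (sg k)) : X -> 'rV[R]_n).
  apply: (eq_measurable_fun (smoothed_gradient Om T Dw (sg k) : X -> 'rV[R]_n)).
    by move=> z; rewrite inE => Qz; rewrite gradE.
  exact: measurable_funS (measurable_smoothed_gradient (sg k)).
have mDw : measurable_fun (Q : set X) (Dw : X -> 'rV[R]_n).
  by apply: measurable_funS QU _; [exact: measurable_parabolic_domain|case: hw].
have EQ (f : V -> R) (b : V -> R) : mu.-integrable setT (EFin \o (ext Om T f : X -> R)) ->
    mu.-integrable (Q : set X) (EFin \o (f : X -> R)).
  move=> /iQ; apply: eq_integrable => // z; rewrite inE => /QU Uz.
  by rewrite /= ext_in.
(* The averaged density is at most the density plus its smoothing error, and [S] bounds that error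
   for all k; the factor 2 + C comes from [smoothed_gradient_energy]. *)
have Ei : mu.-integrable (Q : set X)
    (fun z => (2 + C)%:E * ((density G H a Dw z)%:E + S z))%E.
  apply: integrableZl => //; apply: integrableD => //; last exact: iQ.
  exact: (EQ (density G H a Dw)).
have vE k z : Q z -> ((density G H a (grad_x (smooth_approx Om T w (sg k))) z)%:E <=
    (2 + C)%:E * ((density G H a Dw z)%:E + S z))%E.
  move=> Qz; rewrite /density gradE// -/(density G H a (smoothed_gradient Om T Dw (sg k)) z).
  have rm := rmQ _ (sgN k) _ Qz.
  have := smoothed_gradient_energy n_gt0 Om_open young_G young_H a_ge0 a_cont hw
    w_energy a_om rm C0 (hC _ _ (conj (sgN k) rm)).
  rewrite -lee_fin => /le_trans; apply; rewrite EFinM; apply: lee_wpmul2l.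
    by rewrite lee_fin; lra.
  apply: le_trans (_ : _ <= (F (Some None) z)%:E + (`|kernel_smoothing mu
      (parabolic_kernel (sg k)) (F (Some None)) z - F (Some None) z|)%:E)%E _.
    by rewrite -EFinD lee_fin -lerBlDl ler_norm.
  by rewrite {1}/F ext_in; [rewrite leeD2l|exact: QU].
have vc : {ae mu, forall z : X, Q z -> forall i,
    grad_x (smooth_approx Om T w (sg k)) z ord0 i @[k --> \oo] --> Dw z ord0 i}.
  apply: (@filterS _ _ (ae_filter_ringOfSetsType _) _ _ _ hae) => z hz Qz i.
  have := hz (Some (Some i)); rewrite /F ext_in; last exact: QU.
  move=> h; apply/cvgrPdist_le => e e0.
  apply: filterS ((cvgr0Pnorm_le _).1 h _ e0) => k; rewrite normr_id distrC.
  by rewrite gradE// mxE.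
split.
- by move=> k; exact (smooth_approx_smooth Om_open hw (sg k) Q).
- split; [|exact: EQ wi|].
    by move=> k; apply: iQ; exact: (Ti (sg k) None).
  apply: (squeeze_cvge _ (cvg_cst 0%E) (hL1 None)); apply: nearW => k.
  rewrite integral_ge0//=.
  apply: le_trans (_ : _ <= \int[mu]_(z in Q) (`|kernel_smoothing mu
      (parabolic_kernel (sg k)) (F None) z - F None z|)%:E)%E _.
    rewrite le_eqVlt; apply/orP; left; apply/eqP; apply: eq_integral => z.
    by rewrite inE => /QU Uz; rewrite {2}/F ext_in.
  apply: ge0_subset_integral => //; apply/measurable_EFinP/measurableT_comp => //.
  apply: measurable_funB.
    by apply/measurable_EFinP; exact: measurable_int (Ti (sg k) None).
  by apply/measurable_EFinP; exact: measurable_int (Fi None).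
- by apply: (cvg_LG_density Om_open young_G young_H G_Delta2 a_ge0 a_cont mQ QU mDw mv Ei vE _ vc); exact: EQ.
by apply: (energy_cvg Om_open young_G young_H a_ge0 a_cont mQ QU mDw mv Ei vE vc).
Qed.

End approximation.

Theorem theorem1p1 (R : realType) (n : nat) (hn : (0 < n)%N)
  (Om : set 'rV[R]_n) (Om_open : open Om) (Om_bounded : bounded_set Om)
  (T : R) (hT : 0 < T)
  (G H : R -> R) (young_G : young G) (young_H : young H)
  (G_Delta2 : Delta2 G) (G_nabla2 : nabla2 G)
  (H_Delta2 : Delta2 H) (H_nabla2 : nabla2 H)
  (GH : young_prec G H)
  (a : 'rV[R]_n * R -> R)
  (a_ge0 : forall z, parabolic_domain Om T z -> 0 <= a z)
  (a_cont : {within parabolic_domain Om T, continuous a})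
  (om : R -> R) (a_om : modulus_of_continuity om (parabolic_domain Om T) a)
  (w : 'rV[R]_n * R -> R) (Dw : 'rV[R]_n * R -> 'rV[R]_n)
  (hw : L1W11 Om T w Dw)
  (w_energy : (energy G H a Dw (parabolic_domain Om T) < +oo)%E)
  (z0 : 'rV[R]_n * R) (r : R) (hr : 0 < r)
  (hQ : compactly_contained (cylinder z0 r) (parabolic_domain Om T))
  (hcond :
    [\/ (limsup0 (fun rho => om rho *
           (H (young_linv G (rho ^- (n + 2))) / rho ^- (n + 2)))%R < +oo)%E,
        in_Linfty (parabolic_domain Om T) w /\
        (limsup0 (fun rho => om rho * (H rho^-1 / G rho^-1))%R < +oo)%E |
        exists s : R, [/\ 2 <= s, in_LinftyLs Om T s w &
          (limsup0 (fun rho => om rho *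
             (H (rho `^ (- ((n%:R + s) / s))) /
              G (rho `^ (- ((n%:R + s) / s)))))%R < +oo)%E]]) :
  exists w_ : nat -> 'rV[R]_n * R -> R,
    [/\ forall m, smooth_on (cylinder z0 r) (w_ m),
        cvg_L1 (cylinder z0 r) w_ w,
        cvg_LG G (cylinder z0 r) (fun m => grad_x (w_ m)) Dw &
        energy G H a (grad_x (w_ m)) (cylinder z0 r) @[m --> \oo] -->
          energy G H a Dw (cylinder z0 r)].
Proof.
have [N1 rm] := compactly_contained_room hn (@parabolic_domain_open R n Om T Om_open) hQ.
(* The three conditions serve solely to produce this constant; the maximum of [N1] and [N2] secures
   both room around the cylinder and the growth bound. *)
suff : exists N, exists2 C : R, 0 <= C & forall m z, (N <= m)%N /\ room Om T m z ->
    om (scale R m) * H (enorm (smoothed_gradient Om T Dw m z)) <=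
    C * G (enorm (smoothed_gradient Om T Dw m z)).
  move=> [N2 [C C0 hC]].
  apply: (@mollified_approximation R n hn Om Om_open Om_bounded T G H young_G young_H
    G_Delta2 a a_ge0 a_cont om a_om w Dw hw w_energy _ (maxn N1 N2) C _ _ C0).
  - exact: measurable_cylinder.
  - by move=> m Nm z Qz; apply: (rm m) => //; apply: leq_trans Nm; exact: leq_maxl.
  by move=> m z [Nm rmz]; apply: hC; split => //; apply: leq_trans Nm; exact: leq_maxr.
case: hcond => [h|[wU h]|[s [s2 wLs h]]].
- exact: (gradient_growth_energy hn Om_open young_G young_H G_Delta2 H_Delta2 GH a_ge0
    a_cont hw w_energy a_om h).
- exact: (gradient_growth_bounded hn Om_open young_G young_H G_Delta2 H_Delta2 GH hw a_om wU h).
exact: (gradient_growth_Ls hn Om_open young_G young_H G_Delta2 H_Delta2 GH hw a_om s2 wLs h).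
Qed.
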